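(* There exist a knot $K\subset S^1\times S^2$ that is $\mathbb{Z}_2$-homologically non trivial (i.e. $0\neq[K]\in H_1(S^1\times S^2;\mathbb{Z}_2)$) and two alternating, simple link diagrams in $S^1\times[-1,1]$ with different numbers of crossings that both represent $K$ via the same fixed proper embedding of the annulus in a solid torus of the H-decomposition of $S^1\times S^2$.
   Context: H-decomposition: the decomposition $S^1\times S^2=V_1\cup V_2$ into two solid tori, unique up to isotopy. Diagrams: a solid torus $V$ of the H-decomposition is the thickening $V\cong A\times[-1,1]$ of a properly embedded annulus $A=S^1\times[-1,1]$ (identified with $A\times\{0\}$); once such an embedding is fixed, every link in $S^1\times S^2$ is represented by a link diagram $D\subset S^1\times[-1,1]$, and each such diagram determines a link in $S^1\times S^2$. A diagram is alternating if the parametrization of each of its components meets overpasses and underpasses alternately. Crossings of type I: a crossing $c$ of $D$ is of type I if there is an embedded disk in the annulus whose boundary circle meets $D$ only at $c$, passing through $c$ from one of the four local corners to the opposite one. Crossings of type II: a crossing $c$ is of type II if it is adjacent to the two external regions, i.e. there is a properly embedded arc in the annulus joining $S^1\times\{-1\}$ to $S^1\times\{1\}$ that meets $D$ only at $c$, passing through $c$ from one local corner to the opposite one. The diagram $D$ is simple if it has no crossings of type I and no crossings of type II. *)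

(* Defs.v *)
From mathcomp Require Import all_boot all_order all_algebra.
From mathcomp Require Import all_classical all_reals all_analysis.
Import Order.TTheory GRing.Theory Num.Theory.
Import numFieldNormedType.Exports.

Set Implicit Arguments.
Unset Strict Implicit.
Unset Printing Implicit Defensive.

Local Open Scope classical_set_scope.
Local Open Scope ring_scope.

Definition homeomorphism {X Y : topologicalType} (A : set X) (B : set Y)
    (f : X -> Y) : Prop :=
  [/\ set_fun A B f, {within A, continuous f} &
      exists g : Y -> X, [/\ set_fun B A g, {within B, continuous g},
        {in A, cancel f g} & {in B, cancel g f}]].

(* [f] restricts to a homeomorphism from [A] onto a relatively open subset of
   [B]. *)
Definition open_chart {X Y : topologicalType} (A : set X) (B : set Y)
    (f : X -> Y) : Prop :=
  homeomorphism A (f @` A) f /\ exists2 U : set Y, open U & f @` A = B `&` U.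

Definition circle (R : realType) : set (R * R) :=
  [set p | p.1 ^+ 2 + p.2 ^+ 2 = 1].
Arguments circle R : clear implicits.

Definition disk (R : realType) : set (R * R) :=
  [set p | p.1 ^+ 2 + p.2 ^+ 2 <= 1].
Arguments disk R : clear implicits.

Definition sphere (R : realType) : set (R * R * R) :=
  [set p | p.1.1 ^+ 2 + p.1.2 ^+ 2 + p.2 ^+ 2 = 1].
Arguments sphere R : clear implicits.

Definition open_square (R : realType) : set (R * R) := `]-1, 1[ `*` `]-1, 1[.
Arguments open_square R : clear implicits.

Definition open_cube (R : realType) : set (R * R * R) :=
  open_square R `*` `]-1, 1[.
Arguments open_cube R : clear implicits.

Definition annulus (R : realType) : set (R * R * R) := circle R `*` `[-1, 1].
Arguments annulus R : clear implicits.

Definition open_annulus (R : realType) : set (R * R * R) :=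
  circle R `*` `]-1, 1[.
Arguments open_annulus R : clear implicits.

Definition thick_annulus (R : realType) : set (R * R * R * R) :=
  annulus R `*` `[-1, 1].
Arguments thick_annulus R : clear implicits.

Definition thick_annulus_boundary (R : realType) : set (R * R * R * R) :=
  thick_annulus R `&` [set q | `|q.1.2| = 1 \/ `|q.2| = 1].
Arguments thick_annulus_boundary R : clear implicits.

Notation space5 R := ((R * R) * (R * R * R))%type.

Definition S1xS2 (R : realType) : set (space5 R) := circle R `*` sphere R.
Arguments S1xS2 R : clear implicits.

Definition ambient_isotopy {R : realType} (H : R -> space5 R -> space5 R) :
    Prop :=
  [/\ {within `[0, 1] `*` S1xS2 R,
        continuous (fun q : R * space5 R => H q.1 q.2)},
      forall t, 0 <= t <= 1 -> homeomorphism (S1xS2 R) (S1xS2 R) (H t) &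
      {in S1xS2 R, H 0 =1 id}].

Definition ambient_isotopic {R : realType} (L L' : set (space5 R)) : Prop :=
  exists2 H : R -> space5 R -> space5 R, ambient_isotopy H & H 1 @` L = L'.

Definition upper_torus (R : realType) : set (space5 R) :=
  circle R `*` (sphere R `&` [set p | 0 <= p.2]).
Arguments upper_torus R : clear implicits.

Definition lower_torus (R : realType) : set (space5 R) :=
  circle R `*` (sphere R `&` [set p | p.2 <= 0]).
Arguments lower_torus R : clear implicits.

(* The decomposition of S^1 x S^2 into two solid tori is unique up to isotopy:
   [V1], [V2] is any decomposition in the isotopy class of the standard one. *)
Definition H_decomposition {R : realType} (V1 V2 : set (space5 R)) : Prop :=
  exists2 H : R -> space5 R -> space5 R, ambient_isotopy H &
    H 1 @` upper_torus R = V1 /\ H 1 @` lower_torus R = V2.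

(* [phi] identifies S^1 x [-1,1] x [-1,1] with the solid torus [V], whose
   boundary is the torus [T]; the corresponding properly embedded annulus is
   [fun a => phi (a, 0)].  That boundaries correspond is automatic, by
   invariance of domain. *)
Definition annulus_thickening {R : realType} (V T : set (space5 R))
    (phi : R * R * R * R -> space5 R) : Prop :=
  homeomorphism (thick_annulus R) V phi /\
  phi @` thick_annulus_boundary R = T.

(* Closed curves are functions on [R] of period 1, i.e., on R / Z. *)
Definition same_mod1 {R : realType} (s t : R) : Prop :=
  exists k : int, t = s + k%:~R.

(* Tame knots: locally flat embedded circles. *)
Definition locally_flat {R : realType} (K : set (space5 R)) : Prop :=
  forall p, K p -> exists chi : R * R * R -> space5 R,
    [/\ open_chart (open_cube R) (S1xS2 R) chi, chi (0, 0, 0) = p &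
        forall q, open_cube R q -> (K (chi q) <-> q.1.2 = 0 /\ q.2 = 0)].

Definition is_knot {R : realType} (kappa : R -> space5 R) : Prop :=
  [/\ continuous kappa, range kappa `<=` S1xS2 R,
      forall s t, kappa s = kappa t <-> same_mod1 s t &
      locally_flat (range kappa)].

(* Singular 1-simplices are maps on [0,1], and singular 2-simplices are maps on
   the triangle with vertices (0,0), (1,0), (0,1).  A Z_2-chain is a finite list
   of simplices, in which only the parity of multiplicities matters. *)
Definition triangle (R : realType) : set (R * R) :=
  [set p | [/\ 0 <= p.1, 0 <= p.2 & p.1 + p.2 <= 1]].
Arguments triangle R : clear implicits.

Definition singular_triangle {R : realType} (X : set (space5 R))
    (sigma : R * R -> space5 R) : Prop :=
  set_fun (triangle R) X sigma /\ {within triangle R, continuous sigma}.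

Definition faces {R : realType} (sigma : R * R -> space5 R) :
    seq (R -> space5 R) :=
  [:: fun t => sigma (1 - t, t); fun t => sigma (0, t); fun t => sigma (t, 0)].

Definition Z2_coef {R : realType} (c : seq (R -> space5 R))
    (tau : R -> space5 R) : bool :=
  odd (count (fun tau' => `[< {in `[0, 1], tau' =1 tau} >]) c).

(* The singular 1-cycle given by the closed curve [kappa] is the boundary of a
   Z_2-chain of singular 2-simplices of [X]. *)
Definition Z2_null_homologous {R : realType} (X : set (space5 R))
    (kappa : R -> space5 R) : Prop :=
  exists2 c : seq (R * R -> space5 R),
    (forall i, (i < size c)%N ->
       singular_triangle X (nth (fun=> kappa 0) c i)) &
    forall tau : R -> space5 R,
      Z2_coef (flatten (map faces c)) tau = Z2_coef [:: kappa] tau.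

(* [passes_over i t] tells whether the [i]-th component passes over at parameter
   [t]; it is meaningful only when [t] is the parameter of a crossing. *)
Record diagram (R : realType) := Diagram {
  ncomp : nat;
  curve : 'I_ncomp -> R -> R * R * R;
  passes_over : 'I_ncomp -> R -> bool
}.

Definition smooth {R : realType} (f : R -> R) : Prop :=
  forall n t, derivable (derive1n n f) t 1.

Definition smooth_curve {R : realType} (g : R -> R * R * R) : Prop :=
  [/\ smooth (fun t => (g t).1.1), smooth (fun t => (g t).1.2) &
      smooth (fun t => (g t).2)].

Definition velocity {R : realType} (g : R -> R * R * R) (t : R) : R * R * R :=
  (derive1 (fun u => (g u).1.1) t, derive1 (fun u => (g u).1.2) t,
   derive1 (fun u => (g u).2) t).

Definition same_param {R : realType} (D : diagram R) (i : 'I_(ncomp D)) (s : R)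
    (j : 'I_(ncomp D)) (t : R) : Prop :=
  i = j /\ same_mod1 s t.

Definition double_point {R : realType} (D : diagram R) (i : 'I_(ncomp D))
    (s : R) (j : 'I_(ncomp D)) (t : R) : Prop :=
  curve i s = curve j t /\ ~ same_param i s j t.

Definition diagram_support {R : realType} (D : diagram R) : set (R * R * R) :=
  [set c | exists i t, c = curve (d := D) i t].

Definition crossings {R : realType} (D : diagram R) : set (R * R * R) :=
  [set c | exists i s j t, double_point (D := D) i s j t /\ c = curve i s].

Record is_link_diagram {R : realType} (D : diagram R) : Prop := {
  curve_periodic : forall (i : 'I_(ncomp D)) t, curve i (t + 1) = curve i t;
  over_periodic : forall (i : 'I_(ncomp D)) t,
    passes_over i (t + 1) = passes_over i t;
  curve_in : forall (i : 'I_(ncomp D)) t, open_annulus R (curve i t);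
  curve_smooth : forall i : 'I_(ncomp D), smooth_curve (curve i);
  curve_immersed : forall (i : 'I_(ncomp D)) t, velocity (curve i) t <> 0;
  transverse : forall (i j : 'I_(ncomp D)) s t, double_point i s j t ->
    forall a b : R,
      a *: velocity (curve i) s + b *: velocity (curve j) t = 0 ->
      a = 0 /\ b = 0;
  no_triple_point : forall (i j k : 'I_(ncomp D)) s t u,
    double_point i s j t -> curve k u = curve i s ->
    same_param k u i s \/ same_param k u j t;
  finite_crossings : finite_set (crossings D);
  over_under : forall (i j : 'I_(ncomp D)) s t,
    double_point i s j t -> passes_over i s = ~~ passes_over j t
}.

Definition crossing_param {R : realType} (D : diagram R) (i : 'I_(ncomp D))
    (s : R) : Prop :=
  exists j t, double_point i s j t.

Definition alternating_diagram {R : realType} (D : diagram R) : Prop :=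
  forall (i : 'I_(ncomp D)) s t, s < t ->
    crossing_param i s -> crossing_param i t ->
    (forall u, s < u < t -> ~ crossing_param i u) ->
    passes_over i s <> passes_over i t.

(* [psi] is a chart of the annulus centred at the crossing of the branches
   [(i, s)] and [(j, t)], which it straightens to the two coordinate axes. *)
Definition crossing_chart {R : realType} (D : diagram R) (i : 'I_(ncomp D))
    (s : R) (j : 'I_(ncomp D)) (t : R) (psi : R * R -> R * R * R) : Prop :=
  [/\ open_chart (open_square R) (annulus R) psi,
      psi (0, 0) = curve i s,
      (forall q, open_square R q ->
         (diagram_support D (psi q) <-> q.1 = 0 \/ q.2 = 0)) &
      exists2 e : R, 0 < e & forall q, open_square R q ->
        ((exists2 u, `|u - s| < e & psi q = curve i u) <-> q.2 = 0) /\
        ((exists2 u, `|u - t| < e & psi q = curve j u) <-> q.1 = 0)].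

(* The four local corners at a crossing are the images of the quadrants. *)
Definition quadrant {R : realType} (a b : bool) : set (R * R) :=
  open_square R `&` [set q | 0 < (-1) ^+ a * q.1 /\ 0 < (-1) ^+ b * q.2].

(* The path [beta] goes through the crossing [beta t0] from one of the local
   corners to the opposite one. *)
Definition passes_opposite {R : realType} (D : diagram R)
    (beta : R -> R * R * R) (t0 : R) : Prop :=
  exists (i : 'I_(ncomp D)) (s : R) (j : 'I_(ncomp D)) (t : R)
         (psi : R * R -> R * R * R),
  [/\ double_point i s j t, beta t0 = curve i s, crossing_chart i s j t psi &
      exists a b : bool, exists2 e : R, 0 < e & forall u,
        (t0 < u < t0 + e -> (psi @` quadrant a b) (beta u)) /\
        (t0 - e < u < t0 -> (psi @` quadrant (~~ a) (~~ b)) (beta u))].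

Definition typeI {R : realType} (D : diagram R) (c : R * R * R) : Prop :=
  exists (d : R * R -> R * R * R) (t0 : R),
  let beta := fun t => d (cos t, sin t) in
  [/\ homeomorphism (disk R) (d @` disk R) d, d @` disk R `<=` annulus R,
      beta t0 = c, (forall t, diagram_support D (beta t) -> beta t = c) &
      passes_opposite D beta t0].

Definition typeII {R : realType} (D : diagram R) (c : R * R * R) : Prop :=
  exists (alpha : R -> R * R * R) (t0 : R),
  [/\ homeomorphism (`[0, 1] : set R) (alpha @` `[0, 1]) alpha,
      [/\ (circle R `*` [set -1]) (alpha 0), (circle R `*` [set 1]) (alpha 1) &
          forall t, 0 < t < 1 -> open_annulus R (alpha t)],
      0 < t0 < 1 /\ alpha t0 = c,
      (forall t, 0 <= t <= 1 -> diagram_support D (alpha t) -> alpha t = c) &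
      passes_opposite D alpha t0].

Definition simple_diagram {R : realType} (D : diagram R) : Prop :=
  forall c, crossings D c -> ~ typeI D c /\ ~ typeII D c.

(* Heights, in the last [-1,1] direction of the thickened annulus, of a link
   projecting onto the diagram; its isotopy class does not depend on [h]. *)
Definition diagram_height {R : realType} (D : diagram R)
    (h : 'I_(ncomp D) -> R -> R) : Prop :=
  [/\ forall i t, h i (t + 1) = h i t, forall i t, -1 < h i t < 1,
      forall i, smooth (h i) &
      forall i s j t, double_point i s j t -> passes_over i s -> h j t < h i s].

(* Links are considered up to ambient isotopy. *)
Definition represents {R : realType} (phi : R * R * R * R -> space5 R)
    (D : diagram R) (L : set (space5 R)) : Prop :=
  exists2 h : 'I_(ncomp D) -> R -> R, diagram_height h &
    ambient_isotopic [set p | exists i t, p = phi (curve i t, h i t)] L.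

(* Main.v *)
Require Import Defs.
From mathcomp Require Import all_boot all_order all_algebra.
From mathcomp Require Import all_classical all_reals all_analysis.
From mathcomp Require Import ring lra zify.
Import Order.TTheory GRing.Theory Num.Theory.
Import numFieldNormedType.Exports.
Set Implicit Arguments.
Unset Strict Implicit.
Unset Printing Implicit Defensive.
Local Open Scope classical_set_scope.
Local Open Scope ring_scope.

(** The proof uses closed 3-braids.  Three points that run along a figure eight,
    a third of its length apart, trace the alternating braid [s1 s2^-1] each
    time they move by a third of the figure.  Repeating this [n] times and
    closing up gives an alternating diagram [braid_diagram] with [2 n]
    crossings ([crossings_card]) of a knot whose angular coordinate runs three
    times around the annulus, as soon as [n] is prime to 3; below, [n = 3 k + 2].

    In [S^1 x S^2], braids may move through the whole sphere, and the braid group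
    of the sphere on three strands is finite, so that many of these diagrams
    represent the same knot.  Explicitly, the figure eight unfolds on the sphere
    into a great circle covered twice, and the closed braid becomes a curve of
    type [(3, 2 n)] on the torus [S^1 x circle].  Twice the loop of rotations
    around an axis is null-homotopic in [SO(3)], so that the types [(3, m)] and
    [(3, m + 6)] are isotopic: all the knots with [n = 3 k + 2] are isotopic to
    the curve [torus_knot] of type [(3, 4)] ([straightening_braid]).  All these
    deformations preserve the projection to [S^1], and are given on the fibres
    by homogeneous maps of the 3-space, acting on the sphere of rays
    ([fibre_map_isotopy]).

    The thickening of the annulus is arbitrary.  But [S^1 x S^2] is the double of
    a solid torus, so that the homeomorphism that compares a thickening with the
    standard one extends to [S^1 x S^2] by reflection ([standardize]); the
    standard knot and isotopies are then transported by it.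

    The diagrams are simple when [n] is even and positive.  The union of the
    strands is the zero set of a cubic polynomial in the height ([braid_eqn]),
    and opposite corners of a crossing lie in different faces because explicit
    functions keep a constant sign on connected subsets of the complement of the
    diagram ([opposite_corners], [outer_face]).

    The knot is not null-homologous modulo 2, as it winds three times around
    [S^1]: the parity of a winding number is a cocycle on singular simplices
    ([triangle_winding], [odd_winding_not_null]).

    The theorem compares [n = 2] and [n = 8], that is 4 and 16 crossings. *)

(** * Continuity of explicit maps *)
Section Continuity.
Context {R : realType} {T : topologicalType}.
Implicit Types (f g : T -> R) (x : T).

Lemma cat_cst {S : topologicalType} (c : S) x :
  continuous_at x (fun _ : T => c).
Proof. exact: cvg_cst. Qed.

Lemma cat_id x : continuous_at x (fun y : T => y).
Proof. exact: cvg_id. Qed.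

Lemma catD f g x : continuous_at x f -> continuous_at x g ->
  continuous_at x (fun y => f y + g y).
Proof. by move=> cf cg; exact: (cvgD cf cg). Qed.

Lemma catN f x : continuous_at x f -> continuous_at x (fun y => - f y).
Proof. by move=> cf; exact: (cvgN cf). Qed.

Lemma catM f g x : continuous_at x f -> continuous_at x g ->
  continuous_at x (fun y => f y * g y).
Proof. by move=> cf cg; exact: (cvgM cf cg). Qed.

Lemma catV f x : f x != 0 -> continuous_at x f ->
  continuous_at x (fun y => (f y)^-1).
Proof. by move=> f0 cf; exact: (cvgV f0 cf). Qed.

Lemma catX f n x : continuous_at x f -> continuous_at x (fun y => f y ^+ n).
Proof.
move=> cf; elim: n => [|n IHn]; first exact: cvg_cst.
have -> : (fun y => f y ^+ n.+1) = (fun y => f y * f y ^+ n).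
  by apply/funext => y; rewrite exprS.
exact: catM.
Qed.

Lemma cat_norm f x : continuous_at x f -> continuous_at x (fun y => `|f y|).
Proof. by move=> cf; exact: (cvg_comp _ _ cf (@norm_continuous _ R (f x))). Qed.

Lemma cat_sqrt f x : continuous_at x f ->
  continuous_at x (fun y => Num.sqrt (f y)).
Proof. by move=> cf; exact: (cvg_comp _ _ cf (@sqrt_continuous R (f x))). Qed.

Lemma cat_cos f x : continuous_at x f -> continuous_at x (fun y => cos (f y)).
Proof. by move=> cf; exact: (cvg_comp _ _ cf (@continuous_cos R (f x))). Qed.

Lemma cat_sin f x : continuous_at x f -> continuous_at x (fun y => sin (f y)).
Proof. by move=> cf; exact: (cvg_comp _ _ cf (@continuous_sin R (f x))). Qed.

Lemma cat_atan f x : continuous_at x f ->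
  continuous_at x (fun y => atan (f y)).
Proof. by move=> cf; exact: (cvg_comp _ _ cf (@continuous_atan R (f x))). Qed.

Lemma cat_max f g x : continuous_at x f -> continuous_at x g ->
  continuous_at x (fun y => Num.max (f y) (g y)).
Proof. by move=> cf cg; exact: (continuous_max cf cg). Qed.

Lemma cat_pair {A B : topologicalType} (f : T -> A) (g : T -> B) x :
  continuous_at x f -> continuous_at x g ->
  continuous_at x (fun y => (f y, g y)).
Proof. by move=> cf cg; exact: (cvg_pair cf cg). Qed.

Lemma cat_fst {A B : topologicalType} (f : T -> A * B) x :
  continuous_at x f -> continuous_at x (fun y => (f y).1).
Proof. by move=> cf; apply: (cvg_comp _ _ cf); exact: cvg_fst. Qed.

Lemma cat_snd {A B : topologicalType} (f : T -> A * B) x :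
  continuous_at x f -> continuous_at x (fun y => (f y).2).
Proof. by move=> cf; apply: (cvg_comp _ _ cf); exact: cvg_snd. Qed.

Lemma cat_comp {A B : topologicalType} (f : T -> A) (g : A -> B) x :
  continuous_at x f -> continuous_at (f x) g ->
  continuous_at x (fun y => g (f y)).
Proof. by move=> cf cg; exact: (cvg_comp _ _ cf cg). Qed.

End Continuity.

(** Matching on the head symbol keeps the unifier from unfolding [pi] and the
    ring operations. *)
Ltac cont1 :=
  lazymatch goal with
  | |- continuous_at _ (fun _ => ?c) => apply: cat_cst
  | |- continuous_at _ (fun y => y) => apply: cat_id
  | |- continuous_at _ fst => exact: cvg_fst
  | |- continuous_at _ snd => exact: cvg_snd
  | |- continuous_at _ (fun y => (@?f y, @?g y)) =>
      apply: (@cat_pair _ _ _ f g)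
  | |- continuous_at _ (fun y => @?f y + @?g y) => apply: (@catD _ _ f g)
  | |- continuous_at _ (fun y => - @?f y) => apply: (@catN _ _ f)
  | |- continuous_at _ (fun y => @?f y * @?g y) => apply: (@catM _ _ f g)
  | |- continuous_at _ (fun y => @?f y ^+ ?n) => apply: (@catX _ _ f n)
  | |- continuous_at _ (fun y => (@?f y)^-1) => apply: (@catV _ _ f)
  | |- continuous_at _ (fun y => `|@?f y|) => apply: (@cat_norm _ _ f)
  | |- continuous_at _ (fun y => Num.sqrt (@?f y)) => apply: (@cat_sqrt _ _ f)
  | |- continuous_at _ (fun y => cos (@?f y)) => apply: (@cat_cos _ _ f)
  | |- continuous_at _ (fun y => sin (@?f y)) => apply: (@cat_sin _ _ f)
  | |- continuous_at _ (fun y => atan (@?f y)) => apply: (@cat_atan _ _ f)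
  | |- continuous_at _ (fun y => Num.max (@?f y) (@?g y)) =>
      apply: (@cat_max _ _ f g)
  | |- continuous_at _ (fun y => fst (@?f y)) => apply: (@cat_fst _ _ _ f)
  | |- continuous_at _ (fun y => snd (@?f y)) => apply: (@cat_snd _ _ _ f)
  end.
Ltac cont := repeat cont1.

Lemma within_cat {S T : topologicalType} (A : set S) (f : S -> T) :
  (forall x, A x -> continuous_at x f) -> {within A, continuous f}.
Proof.
by move=> cf; apply: continuous_in_subspaceT => x; rewrite inE => /cf.
Qed.

Lemma within_comp {S T U : topologicalType} (A : set S) (B : set T)
    (f : S -> T) (g : T -> U) :
  set_fun A B f -> {within A, continuous f} -> {within B, continuous g} ->
  {within A, continuous (fun x => g (f x))}.
Proof.
move=> AB /subspace_continuousP cf /subspace_continuousP cg.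
apply/subspace_continuousP => x Ax.
have h : f y @[y --> within A (nbhs x)] --> within B (nbhs (f x)).
  move=> W; rewrite /= /within /= => hW.
  have /(_ _ hW) := cf x Ax; rewrite /= /nbhs /= /within /=.
  by apply: filterS => y /= h Ay; apply: h => //; exact: AB.
exact: (cvg_comp _ _ h (cg _ (AB _ Ax))).
Qed.

Lemma within_congr {S T : topologicalType} (A : set S) (f g : S -> T) :
  (forall x, A x -> f x = g x) -> {within A, continuous f} ->
  {within A, continuous g}.
Proof.
move=> fg; apply: subspace_eq_continuous => x.
by rewrite inE => /fg.
Qed.

(** * The circle, with angles measured in turns *)
Section Circle.
Context {R : realType}.
Implicit Types (x y z : R) (p q : R * R).

Definition cis x : R * R := (cos (2 * pi * x), sin (2 * pi * x)).

Definition cmul p q : R * R :=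
  (p.1 * q.1 - p.2 * q.2, p.2 * q.1 + p.1 * q.2).

Definition cconj p : R * R := (p.1, - p.2).

Fixpoint cpow p (n : nat) : R * R := if n is m.+1 then cmul p (cpow p m) else (1, 0).

Lemma cis_circle x : circle R (cis x).
Proof. exact: cos2Dsin2. Qed.

Lemma cisD x y : cis (x + y) = cmul (cis x) (cis y).
Proof. by rewrite /cis /cmul /= mulrDr cosD sinD; congr (_, _); ring. Qed.

Lemma cisN x : cis (- x) = cconj (cis x).
Proof. by rewrite /cis /cconj /= mulrN cosN sinN. Qed.

Lemma cis0 : cis 0 = (1, 0).
Proof. by rewrite /cis mulr0 cos0 sin0. Qed.

Lemma cis1 : cis 1 = (1, 0).
Proof.
by rewrite /cis mulr1 mulr_natl cos2pi sin2pi.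
Qed.

Lemma cisD1 x : cis (x + 1) = cis x.
Proof.
rewrite cisD cis1 /cmul /=; rewrite !mulr1 !mulr0 subr0 addr0.
by [].
Qed.

Lemma cis_natmul n x : cis (n%:R * x) = cpow (cis x) n.
Proof.
elim: n => [|n IHn]; first by rewrite mul0r cis0.
by rewrite -natr1 mulrDl mul1r addrC cisD IHn.
Qed.

Lemma cis_nat (n : nat) x : cis (x + n%:R) = cis x.
Proof.
elim: n => [|n IHn]; first by rewrite addr0.
by rewrite -natr1 addrA cisD1.
Qed.

Lemma cis_int (k : int) x : cis (x + k%:~R) = cis x.
Proof.
case: k => n; first exact: cis_nat.
by rewrite NegzE -[in RHS](subrK n.+1%:R x) cis_nat mulrNz.
Qed.

(** The fractional part [f] satisfies [1 = cos (2 pi f) = 1 - 2 sin (pi f) ^ 2],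
    and the sine is positive inside a half-turn. *)
Lemma cis_eq1 z : cis z = (1, 0) -> exists k : int, z = k%:~R.
Proof.
move=> cz; exists (Num.floor z).
set f := z - (Num.floor z)%:~R.
have f0 : 0 <= f by rewrite subr_ge0 ge_floor.
have f1 : f < 1 by rewrite ltrBlDl; have := lt_succ_floor z; rewrite intrD.
have cf : cos (2 * pi * f) = 1.
  have : cis f = (1, 0) by rewrite -cz /f -mulrNz cis_int.
  by case.
have [|f00] := eqVneq f 0; first by move/eqP; rewrite subr_eq0 => /eqP.
have fp : 0 < f by rewrite lt_neqAle eq_sym f00.
have s0 : 0 < sin (pi * f).
  apply: sin_gt0_pi; rewrite mulr_gt0 ?pi_gt0//=.
  by rewrite gtr_pMr ?pi_gt0.
have : cos (2 * pi * f) = 1 - 2 * sin (pi * f) ^+ 2.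
  have -> : 2 * pi * f = pi * f + pi * f by ring.
  by rewrite cosD -!expr2 cos2sin2; ring.
rewrite cf => /esym/eqP; rewrite subr_eq addrC -subr_eq subrr eq_sym.
by rewrite mulf_eq0 pnatr_eq0 /= expf_eq0 /= gt_eqF.
Qed.

Lemma cis_eq x y : cis x = cis y <-> same_mod1 x y.
Proof.
split=> [cxy|[k ->]]; last by rewrite cis_int.
have [k yxk] : exists k : int, y - x = k%:~R.
  apply: cis_eq1; rewrite cisD cisN -cxy /cmul /cconj /=.
  by have := cis_circle x; rewrite /circle /= => h; congr (_, _); nra.
by exists k; rewrite -yxk; ring.
Qed.

Lemma cis_surj p : circle R p -> exists x, p = cis x.
Proof.
case: p => a b; rewrite /circle /= => h.
have a1 : -1 <= a <= 1 by apply/andP; split; nra.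
have ca : cos (acos a) = a by rewrite acosK // in_itv.
have sa : sin (acos a) = `|b|.
  rewrite sin_acos //; have -> : 1 - a ^+ 2 = b ^+ 2 by lra.
  by rewrite sqrtr_sqr.
have pi0 : (pi : R) != 0 by rewrite gt_eqF ?pi_gt0.
have [b0|b0] := leP 0 b.
- exists (acos a / (2 * pi)); rewrite /cis.
  rewrite mulrC divfK ?mulf_neq0 //.
  by rewrite ca sa ger0_norm.
- exists (- acos a / (2 * pi)); rewrite /cis.
  rewrite mulrC divfK ?mulf_neq0 //.
  by rewrite cosN sinN ca sa ltr0_norm // opprK.
Qed.

(** A continuous choice of the angle on the open right half-plane. *)
Definition ang p : R := atan (p.2 / p.1) / (2 * pi).

Lemma angK p : circle R p -> 0 < p.1 -> cis (ang p) = p.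
Proof.
case: p => a b; rewrite /circle /ang /= => h a0.
have pi0 : (pi : R) != 0 by rewrite gt_eqF ?pi_gt0.
have an0 : a != 0 by rewrite gt_eqF.
rewrite /cis.
rewrite mulrC divfK ?mulf_neq0 //.
have c : cos (atan (b / a)) = a.
  rewrite cos_atan; have -> : 1 + (b / a) ^+ 2 = (a^-1) ^+ 2.
    have -> : 1 + (b / a) ^+ 2 = (a ^+ 2 + b ^+ 2) * a^-1 ^+ 2 by field.
    by rewrite h mul1r.
  by rewrite sqrtr_sqr ger0_norm ?invrK // invr_ge0 ltW.
have : tan (atan (b / a)) = b / a by rewrite atanK.
rewrite /tan c => /(congr1 (fun t => t * a)); rewrite !divfK // => ->.
by [].
Qed.

Lemma quarter_itv x : `|x| < 4^-1 -> 2 * pi * x \in `](- (pi / 2)), (pi / 2)[.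
Proof.
move=> /ltr_normlP [h1 h2]; rewrite in_itv /=.
have := @pi_gt0 R => pi0.
by apply/andP; split; nra.
Qed.

Lemma cisK x : `|x| < 4^-1 -> ang (cis x) = x.
Proof.
move=> hx; rewrite /ang /cis /= -/(tan _) tanK; last exact: quarter_itv.
have pi0 : (pi : R) != 0 by rewrite gt_eqF ?pi_gt0.
by rewrite mulrC mulKf // mulf_neq0.
Qed.

Lemma cis_gt0 x : `|x| < 4^-1 -> 0 < (cis x).1.
Proof.
move=> /quarter_itv; rewrite in_itv /= => h; exact: cos_gt0_pihalf.
Qed.

Lemma cis_sin_gt0 x : 0 < x < 2^-1 -> 0 < (cis x).2.
Proof.
move=> /andP[x0 x1]; apply: sin_gt0_pi; have := @pi_gt0 R => pi0.
by apply/andP; split; nra.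
Qed.

Lemma cmulK p q : circle R p -> cmul (cconj p) (cmul p q) = q.
Proof.
case: p q => a b [c d]; rewrite /circle /cmul /cconj /= => h.
by congr (_, _); [rewrite -[RHS]mul1r|rewrite -[RHS]mul1r]; rewrite -h; ring.
Qed.

Lemma circle_mul p q : circle R p -> circle R q -> circle R (cmul p q).
Proof.
case: p q => a b [c d]; rewrite /circle /cmul /= => h1 h2.
by transitivity ((a ^+ 2 + b ^+ 2) * (c ^+ 2 + d ^+ 2)); [ring|rewrite h1 h2 mulr1].
Qed.

Lemma circle_conj p : circle R p -> circle R (cconj p).
Proof. by case: p => a b; rewrite /circle /cconj /= sqrrN. Qed.

Lemma circle_pow p n : circle R p -> circle R (cpow p n).
Proof.
move=> cp; elim: n => [|n IHn] /=; last exact: circle_mul.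
by rewrite /circle /= expr1n expr0n addr0.
Qed.

Lemma no_int_between01 (m : int) : 0 < (m%:~R : R) < 1 -> False.
Proof.
by rewrite (_ : 1 = 1%:~R :> R) // (_ : 0 = 0%:~R :> R) // !ltr_int; lia.
Qed.

End Circle.

Arguments cis : simpl never.

Lemma cat_cmul {R : realType} {T : topologicalType} (f g : T -> R * R) x :
  continuous_at x f -> continuous_at x g ->
  continuous_at x (fun y => cmul (f y) (g y)).
Proof. by move=> cf cg; rewrite /cmul; cont. Qed.

Lemma cat_cpow {R : realType} {T : topologicalType} (f : T -> R * R) n x :
  continuous_at x f -> continuous_at x (fun y => cpow (f y) n).
Proof.
move=> cf; elim: n => [|n IHn] /=; first exact: cat_cst.
exact: cat_cmul.
Qed.

(** * Isotopies of the product given by homogeneous maps on the fibres *)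
Section Rays.
Context {R : realType}.
Implicit Types (p q : R * R * R) (e : R * R) (l tau : R).

Definition scale3 l p : R * R * R := (l * p.1.1, l * p.1.2, l * p.2).

Definition sqnorm3 p : R := p.1.1 ^+ 2 + p.1.2 ^+ 2 + p.2 ^+ 2.

Definition normalize p : R * R * R := scale3 (Num.sqrt (sqnorm3 p))^-1 p.

Lemma sqnorm3_ge0 p : 0 <= sqnorm3 p.
Proof. by rewrite /sqnorm3 !addr_ge0 // sqr_ge0. Qed.

Lemma sqnorm3_eq0 p : sqnorm3 p = 0 -> p = 0.
Proof.
case: p => [[a b] c]; rewrite /sqnorm3 /= => h.
have := sqr_ge0 a; have := sqr_ge0 b; have := sqr_ge0 c => hc hb ha.
have a0 : a ^+ 2 = 0 by lra.
have b0 : b ^+ 2 = 0 by lra.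
have c0 : c ^+ 2 = 0 by lra.
by move: a0 b0 c0 => /eqP + /eqP + /eqP; rewrite !sqrf_eq0 => /eqP-> /eqP-> /eqP->.
Qed.

Lemma sqnorm3_gt0 p : p <> 0 -> 0 < sqnorm3 p.
Proof.
move=> p0; rewrite lt_neqAle sqnorm3_ge0 andbT eq_sym.
by apply/eqP => /sqnorm3_eq0.
Qed.

Lemma scale3_sqnorm l p : sqnorm3 (scale3 l p) = l ^+ 2 * sqnorm3 p.
Proof. by rewrite /sqnorm3 /scale3 /=; ring. Qed.

Lemma scale3A l l' p : scale3 l (scale3 l' p) = scale3 (l * l') p.
Proof. by rewrite /scale3 /= !mulrA. Qed.

Lemma scale31 p : scale3 1 p = p.
Proof. by rewrite /scale3 !mul1r -!surjective_pairing. Qed.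

Lemma scale30 l : scale3 l 0 = 0.
Proof. by rewrite /scale3 /= !mulr0. Qed.

Lemma normalize_sphere p : p <> 0 -> sphere R (normalize p).
Proof.
move=> /sqnorm3_gt0 p0.
suff : sqnorm3 (normalize p) = 1 by [].
by rewrite scale3_sqnorm exprVn sqr_sqrtr ?sqnorm3_ge0 // mulVf // gt_eqF.
Qed.

Lemma normalize_id p : sphere R p -> normalize p = p.
Proof.
move=> sp; have n1 : sqnorm3 p = 1 := sp.
by rewrite /normalize n1 sqrtr1 invr1 scale31.
Qed.

Lemma normalize_scale l p : 0 < l -> normalize (scale3 l p) = normalize p.
Proof.
move=> l0; rewrite /normalize scale3_sqnorm sqrtrM ?sqr_ge0 //.
rewrite sqrtr_sqr gtr0_norm // scale3A; congr (scale3 _ _).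
by rewrite invfM mulrAC mulVf ?mul1r // gt_eqF.
Qed.

Lemma normalizeE p : p <> 0 ->
  exists2 l, 0 < l & normalize p = scale3 l p.
Proof.
move=> p0; exists (Num.sqrt (sqnorm3 p))^-1 => //.
by rewrite invr_gt0 sqrtr_gt0 sqnorm3_gt0.
Qed.

Lemma sphere_neq0 p : sphere R p -> p <> 0.
Proof.
move=> + p0; rewrite p0 /sphere /= expr0n !addr0 /=.
by move/eqP; rewrite eq_sym oner_eq0.
Qed.

Lemma cat_normalize {T : topologicalType} (f : T -> R * R * R) x :
  f x <> 0 -> continuous_at x f -> continuous_at x (fun y => normalize (f y)).
Proof.
move=> fx0 cf; rewrite /normalize /scale3 /sqnorm3; cont => //;
  by rewrite gt_eqF // sqrtr_gt0; exact: sqnorm3_gt0.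
Qed.

(** Positively homogeneous bijections permute the rays from the origin, hence act
    on the sphere.  The families below depend on a time and on a point of the
    circle; they are given with an inverse that is continuous as well. *)
Definition homogeneous3 (M : R -> R * R -> R * R * R -> R * R * R) :=
  forall tau e l p, 0 < l -> M tau e (scale3 l p) = scale3 l (M tau e p).

Definition continuous3 (M : R -> R * R -> R * R * R -> R * R * R) :=
  continuous (fun x : R * (R * R) * (R * R * R) => M x.1.1 x.1.2 x.2).

Record ray_family (M M' : R -> R * R -> R * R * R -> R * R * R) : Prop := {
  ray_homog : homogeneous3 M;
  ray_homog' : homogeneous3 M';
  ray_cont : continuous3 M;
  ray_cont' : continuous3 M';
  rayK : forall tau e, circle R e -> cancel (M tau e) (M' tau e);
  rayK' : forall tau e, circle R e -> cancel (M' tau e) (M tau e)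
}.

Lemma ray_sym M M' : ray_family M M' -> ray_family M' M.
Proof. by case=> *; split. Qed.

Lemma ray_comp M M' L L' : ray_family M M' -> ray_family L L' ->
  ray_family (fun tau e p => L tau e (M tau e p))
             (fun tau e p => M' tau e (L' tau e p)).
Proof.
have cc A B : continuous3 A -> continuous3 B ->
    continuous3 (fun tau e p => B tau e (A tau e p)).
  move=> cA cB x.
  by apply: (cat_comp (f := fun x => (x.1, A x.1.1 x.1.2 x.2))
    (g := fun y => B y.1.1 y.1.2 y.2)); [cont; exact: cA|exact: cB].
case=> hM hM' cM cM' MK MK' [hL hL' cL cL' LK LK']; split.
- by move=> tau e l p l0; rewrite hM // hL.
- by move=> tau e l p l0; rewrite hL' // hM'.
- exact: cc.
- exact: cc.
- by move=> tau e ce p; rewrite LK // MK.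
- by move=> tau e ce p; rewrite MK' // LK'.
Qed.

(** The value at the origin is its own double. *)
Lemma homog0 M tau e : homogeneous3 M -> M tau e 0 = 0.
Proof.
move=> hM; have p2 : 0 < 2 :> R by [].
have := hM tau e 2 0 p2; rewrite scale30.
case: (M tau e 0) => [[a b] c]; rewrite /scale3 /= => -[ha hb hc].
by congr (_, _, _); lra.
Qed.

Lemma ray_neq0 M M' tau e p : ray_family M M' -> circle R e -> p <> 0 ->
  M tau e p <> 0.
Proof.
move=> MM ce p0 Mp0; apply: p0.
by rewrite -(rayK MM tau ce p) Mp0 homog0 //; exact: ray_homog' MM.
Qed.

Definition fibre_map (M : R -> R * R -> R * R * R -> R * R * R) tau
  (x : space5 R) : space5 R := (x.1, normalize (M tau x.1 x.2)).

Lemma fibre_map_sub M M' tau : ray_family M M' ->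
  set_fun (S1xS2 R) (S1xS2 R) (fibre_map M tau).
Proof.
move=> MM [e p] [/= ce sp]; split => //=.
by apply: normalize_sphere; apply: (ray_neq0 MM ce); exact: sphere_neq0.
Qed.

Lemma fibre_mapK M M' tau : ray_family M M' ->
  {in S1xS2 R, cancel (fibre_map M tau) (fibre_map M' tau)}.
Proof.
move=> MM [e p]; rewrite inE => -[/= ce sp]; rewrite /fibre_map /=.
have Mp0 : M tau e p <> 0.
  by apply: (ray_neq0 MM ce); exact: sphere_neq0.
have [l l0 ->] := normalizeE Mp0.
by rewrite (ray_homog' MM) // (rayK MM) // normalize_scale // normalize_id.
Qed.

Lemma fibre_map_cont M M' (tau : R) (x : space5 R) : ray_family M M' ->
  S1xS2 R x ->
  continuous_at (tau, x) (fun y : R * space5 R => fibre_map M y.1 y.2).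
Proof.
case: x => e p MM [/= ce sp]; rewrite /fibre_map; cont.
apply: cat_normalize => /=.
  by apply: (ray_neq0 MM ce); exact: sphere_neq0.
apply: (cat_comp (f := fun y : R * space5 R => ((y.1, y.2.1), y.2.2))
    (g := fun y => M y.1.1 y.1.2 y.2)); first by cont.
exact: ray_cont MM _.
Qed.

Lemma fibre_map_homeo M M' tau : ray_family M M' ->
  homeomorphism (S1xS2 R) (S1xS2 R) (fibre_map M tau).
Proof.
move=> MM; have MM' := ray_sym MM.
have ct A A' : ray_family A A' ->
    {within S1xS2 R, continuous (fibre_map A tau)}.
  move=> AA; apply: within_cat => x Sx.
  apply: (cat_comp (f := fun x => (tau, x))
    (g := fun y : R * space5 R => fibre_map A y.1 y.2)); first by cont.
  exact: fibre_map_cont AA Sx.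
split; [exact: fibre_map_sub MM|exact: ct MM|].
exists (fibre_map M' tau); split; [exact: fibre_map_sub MM'|exact: ct MM'|..].
- exact: fibre_mapK MM.
- exact: fibre_mapK MM'.
Qed.

(** Homogeneity makes normalization harmless in a composition, so that [M'] gives
    the inverse homeomorphisms. *)
Lemma fibre_map_isotopy M M' : ray_family M M' ->
  (forall e p, circle R e -> M 0 e p = p) -> ambient_isotopy (fibre_map M).
Proof.
move=> MM M0; split.
- apply: within_cat => -[tau x] [_ /= Sx]; exact: fibre_map_cont MM Sx.
- by move=> t _; exact: fibre_map_homeo MM.
- move=> [e p]; rewrite inE => -[/= ce sp].
  by rewrite /fibre_map /= M0 // normalize_id.
Qed.

End Rays.

(** * The isotopy from the closed braids to the torus knot *)
Section Families.
Context {R : realType}.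
Implicit Types (p q : R * R * R) (e : R * R) (l tau : R).

(** On the points [(s / 2, s c / 2)] of the figure eight, where [c^2 + s^2 = 1],
    this is [|s| / 2 - 2 s^2].  It is homogeneous, and the figure eight stays in
    the cone where the argument of the square root is nonnegative. *)
Definition lift_gap p : R := `|p.1.1| - 4 * Num.sqrt (p.1.1 ^+ 2 - p.1.2 ^+ 2).

Definition lift_shear (sg : R) tau e p : R * R * R :=
  (p.1.1, p.1.2, p.2 + sg * tau * lift_gap p).

(** If [u] is the phase of a point of the closed braid over [e], then
    [e ^ n = cis (3 u)], and [sin u = sin (3 u) cos (2 u) - cos (3 u) sin (2 u)] is a
    linear function of [sin (2 u)] and [cos (2 u)] whose coefficients depend on [e]
    only. *)
Definition side_shear (sg : R) (n : nat) tau e p : R * R * R :=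
  (p.1.1 + sg * tau * (2^-1 * (cpow e n).2 * p.2 - 2 * (cpow e n).1 * p.1.2),
   p.1.2, p.2).

(** The factor is 4 at time 1 and is nonzero at all times. *)
Definition stretch tau e p : R * R * R := (p.1.1, (1 + 3 * tau ^+ 2) * p.1.2, p.2).

Definition shrink tau e p : R * R * R := (p.1.1, (1 + 3 * tau ^+ 2)^-1 * p.1.2, p.2).

Definition spin e p : R * R * R :=
  (p.1.1, e.1 * p.1.2 - e.2 * p.2, e.2 * p.1.2 + e.1 * p.2).

Definition tilt e p : R * R * R :=
  (e.1 * p.1.1 - e.2 * p.2, p.1.2, e.2 * p.1.1 + e.1 * p.2).

Lemma lift_shear_family : ray_family (lift_shear 1) (lift_shear (-1)).
Proof.
have hom sg : homogeneous3 (lift_shear sg).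
  move=> tau e l [[a b] c] l0; rewrite /lift_shear /lift_gap /scale3 /=.
  congr (_, _, _).
  have nl : `|l| = l by exact: gtr0_norm.
  rewrite normrM nl !exprMn -mulrBr sqrtrM ?sqr_ge0 // sqrtr_sqr.
  by rewrite nl; ring.
have ct sg : continuous3 (lift_shear sg).
  by move=> x; rewrite /lift_shear /lift_gap; cont.
by split=> // tau e ce [[a b] c]; rewrite /lift_shear /lift_gap /=;
  congr (_, _, _); ring.
Qed.

Lemma side_shear_family n : ray_family (side_shear (-1) n) (side_shear 1 n).
Proof.
have hom sg : homogeneous3 (side_shear sg n).
  move=> tau e l [[a b] c] l0; rewrite /side_shear /scale3 /=.
  by congr (_, _, _); ring.
have ct sg : continuous3 (side_shear sg n).
  by move=> x; rewrite /side_shear; cont; apply: cat_cpow; cont.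
by split=> // tau e ce [[a b] c]; rewrite /side_shear /=;
  congr (_, _, _); ring.
Qed.

Lemma stretch_family : ray_family stretch shrink.
Proof.
have t0 tau : 1 + 3 * tau ^+ 2 != 0.
  by rewrite gt_eqF //; have := sqr_ge0 tau => h; lra.
split.
- by move=> tau e l [[a b] c] l0; rewrite /stretch /scale3 /=; congr (_, _, _); ring.
- by move=> tau e l [[a b] c] l0; rewrite /shrink /scale3 /=; congr (_, _, _); ring.
- by move=> x; rewrite /stretch; cont.
- by move=> x; rewrite /shrink; cont.
- by move=> tau e ce [[a b] c]; rewrite /stretch /shrink /= mulKf.
- by move=> tau e ce [[a b] c]; rewrite /stretch /shrink /= mulVKf.
Qed.

Lemma spinK e : circle R e -> cancel (spin e) (spin (cconj e)).
Proof.
case: e => x y; rewrite /circle /= => h [[a b] c]; rewrite /spin /cconj /=.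
congr (_, _, _); [rewrite -[RHS]mul1r|rewrite -[RHS]mul1r]; rewrite -h; ring.
Qed.

Lemma tiltK e : circle R e -> cancel (tilt e) (tilt (cconj e)).
Proof.
case: e => x y; rewrite /circle /= => h [[a b] c]; rewrite /tilt /cconj /=.
congr (_, _, _); [rewrite -[RHS]mul1r|rewrite -[RHS]mul1r]; rewrite -h; ring.
Qed.

Lemma cconjK e : cconj (cconj e) = e.
Proof. by case: e => a b; rewrite /cconj /= opprK. Qed.

Lemma spin_family k : ray_family (fun tau e => spin (cpow e k))
  (fun tau e => spin (cconj (cpow e k))).
Proof.
have ck e : circle R e -> circle R (cpow e k) by exact: circle_pow.
split.
- by move=> tau e l [[a b] c] l0; rewrite /spin /scale3 /=; congr (_, _, _); ring.
- by move=> tau e l [[a b] c] l0; rewrite /spin /scale3 /=; congr (_, _, _); ring.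
- by move=> x; rewrite /spin; cont; apply: cat_cpow; cont.
- by move=> x; rewrite /spin /cconj /=; cont; apply: cat_cpow; cont.
- by move=> tau e ce; apply: spinK; exact: ck.
- move=> tau e ce p; rewrite -{1}(cconjK (cpow e k)); apply: spinK.
  by apply: circle_conj; exact: ck.
Qed.

Lemma tilt_family : ray_family (fun tau e => tilt (cis (2^-1 * (1 - tau))))
  (fun tau e => tilt (cconj (cis (2^-1 * (1 - tau))))).
Proof.
split.
- by move=> tau e l [[a b] c] l0; rewrite /tilt /scale3 /=; congr (_, _, _); ring.
- by move=> tau e l [[a b] c] l0; rewrite /tilt /scale3 /=; congr (_, _, _); ring.
- by move=> x; rewrite /tilt /cis /=; cont.
- by move=> x; rewrite /tilt /cconj /cis /=; cont.
- by move=> tau e ce; apply: tiltK; exact: cis_circle.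
- move=> tau e ce p; rewrite -{1}(cconjK (cis _)); apply: tiltK.
  by apply: circle_conj; exact: cis_circle.
Qed.

(** The two shears and the stretch unfold the figure eight into the great circle
    [p.1.1 = 0], covered twice.  At time 1, the tilts are the identity and the two
    spins add up to the rotation by [e ^ (2 k)]; at time 0, the tilts are
    half-turns, and conjugation by a half-turn reverses the spin, so that the four
    rotations cancel: twice a loop of rotations is null-homotopic. *)
Definition straightening k tau e p : R * R * R :=
  let a := cis (2^-1 * (1 - tau)) in
  spin (cpow e k) (tilt a (spin (cpow e k) (tilt (cconj a)
    (stretch tau e (side_shear (-1) (3 * k + 2) tau e (lift_shear 1 tau e p)))))).

Lemma straightening_family k : exists M', ray_family (straightening k) M'.
Proof.
eexists.
apply: (ray_comp (M := fun tau e p => _) (L := fun tau e => spin (cpow e k)));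
  last exact: spin_family.
apply: (ray_comp (M := fun tau e p => _)
  (L := fun tau e => tilt (cis (2^-1 * (1 - tau))))); last exact: tilt_family.
apply: (ray_comp (M := fun tau e p => _) (L := fun tau e => spin (cpow e k)));
  last exact: spin_family.
apply: (ray_comp (M := fun tau e p => _)
  (L := fun tau e => tilt (cconj (cis (2^-1 * (1 - tau))))));
  last exact: (ray_sym tilt_family).
apply: (ray_comp (M := fun tau e p => _) (L := stretch));
  last exact: stretch_family.
apply: (ray_comp (M := lift_shear 1) (L := side_shear (-1) (3 * k + 2)));
  [exact: lift_shear_family|exact: side_shear_family].
Qed.

Lemma cis_half : cis (2^-1 : R) = (-1, 0).
Proof.
rewrite /cis; have -> : 2 * pi * 2^-1 = pi :> R by rewrite mulrAC divff ?mul1r.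
by rewrite cospi sinpi.
Qed.

Lemma straightening0 k e p : circle R e -> straightening k 0 e p = p.
Proof.
move=> ce; rewrite /straightening subr0 mulr1 cis_half.
have : circle R (cpow e k) by exact: circle_pow.
case: (cpow e k) => x y; case: p => [[a b] c]; rewrite /circle /= => h.
rewrite /side_shear /lift_shear /stretch /spin /tilt /cconj /=.
congr (_, _, _); first by ring.
- by transitivity ((x ^+ 2 + y ^+ 2) * b); [ring|rewrite h mul1r].
- by transitivity ((x ^+ 2 + y ^+ 2) * c); [ring|rewrite h mul1r].
Qed.

(** The square is the base of a pyramid of height 1, projected from the centre of
    the base to the upper hemisphere; its boundary goes to the equator. *)
Definition std_thickening (q : R * R * R * R) : space5 R :=
  (q.1.1, normalize (q.1.2, q.2, 1 - Num.max `|q.1.2| `|q.2|)).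

(** Together with [braid_height], the Lissajous curve [(sin u / 2, sin (2 u) / 4)]
    of phase [u = n t] turns, in the fibre over the angle [3 t]. *)
Definition braid_curve (n : nat) (t : R) : R * R * R :=
  (cis (3 * t), 2^-1 * (cis (n%:R * t)).2).

Definition braid_height (n : nat) (t : R) : R := 4^-1 * (cis (2 * (n%:R * t))).2.

(** The curve of type [(3, 4)] on the product of [S^1] and the great circle
    [p.1.1 = 0]. *)
Definition torus_knot (t : R) : space5 R :=
  (cis (3 * t), (0, (cis (4 * t)).2, (cis (4 * t)).1)).

(** If [cis (n t) = (c, s)], the rays through the successive images of the point
    are those of [(s / 2, s c / 2, 1 - |s| / 2)], [(s / 2, s c / 2, c^2 - s^2)],
    [(0, s c / 2, c^2 - s^2)] and [(0, 2 s c, c^2 - s^2)].  The last one has angle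
    [2 n t] on the great circle, and the spins subtract [2 k (3 t)], which leaves
    [(2 n - 6 k) t = 4 t]. *)
Lemma straightening_braid k t :
  fibre_map (straightening k) 1
    (std_thickening (braid_curve (3 * k + 2) t, braid_height (3 * k + 2) t)) = torus_knot t.
Proof.
set n := (3 * k + 2)%N.
have [C [S E4]] : exists a b : R, cis (4 * t) = (a, b) by do 2 eexists.
have CS : C ^+ 2 + S ^+ 2 = 1 by have := cis_circle (4 * t); rewrite E4.
rewrite /fibre_map /std_thickening /torus_knot E4 /=; congr (_, _).
have [M' MM] := straightening_family k.
set v := (_, _, 1 - _).
have [s [c cE]] : exists s c : R, cis (n%:R * t) = (c, s) by do 2 eexists.
have cs : c ^+ 2 + s ^+ 2 = 1 by have := cis_circle (n%:R * t); rewrite cE.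
have c2 : cis (2 * (n%:R * t)) = (c ^+ 2 - s ^+ 2, 2 * s * c).
  have -> : 2 * (n%:R * t) = n%:R * t + n%:R * t by ring.
  by rewrite cisD cE /cmul /=; congr (_, _); ring.
have c3 : cpow (cis (3 * t)) n = (c ^+ 3 - 3 * c * s ^+ 2, 3 * c ^+ 2 * s - s ^+ 3).
  rewrite -cis_natmul.
  have -> : n%:R * (3 * t) = 2 * (n%:R * t) + n%:R * t by ring.
  by rewrite cisD c2 cE /cmul /=; congr (_, _); ring.
have vE : v = (2^-1 * s, 2^-1 * s * c, 1 - `|2^-1 * s|).
  have [_ sE] := cE.
  rewrite /v /braid_height c2 /= sE.
  have -> : 4^-1 * (2 * s * c) = 2^-1 * s * c by field.
  congr (_, _, _).
  congr (1 - _); rewrite max_l //.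
  rewrite normrM -[leRHS]mulr1 ler_wpM2l //.
  by rewrite ler_norml; apply/andP; split; nra.
have s2 : Num.sqrt ((2^-1 * s) ^+ 2 - (2^-1 * s * c) ^+ 2) = 2^-1 * s ^+ 2.
  have -> : (2^-1 * s) ^+ 2 - (2^-1 * s * c) ^+ 2 = (2^-1 * s ^+ 2) ^+ 2.
    have h : 1 - c ^+ 2 = s ^+ 2 by rewrite -cs; ring.
    by transitivity (4^-1 * s ^+ 2 * (1 - c ^+ 2)); [|rewrite h]; field.
  by rewrite sqrtr_sqr ger0_norm // mulr_ge0 // sqr_ge0.
have Ev : straightening k 1 (cis (3 * t)) v = (0, S, C).
  rewrite /straightening -/n subrr mulr0 cis0 vE.
  rewrite /lift_shear /lift_gap /= s2.
  rewrite /side_shear /= c3 /= /stretch /=.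
  have hc : 1 - `|2^-1 * s| + 1 * 1 * (`|2^-1 * s| - 4 * (2^-1 * s ^+ 2))
      = c ^+ 2 - s ^+ 2.
    by transitivity (c ^+ 2 + s ^+ 2 - 2 * s ^+ 2); [rewrite cs; field|ring].
  rewrite hc; set x1 := 2^-1 * s + _; have -> : x1 = 0.
    transitivity (2^-1 * s * (1 - (c ^+ 2 + s ^+ 2) ^+ 2)); first by rewrite /x1; field.
    by rewrite cs expr1n subrr mulr0.
  have : cis (4 * t) = cmul (cconj (cpow (cis (3 * t)) k))
      (cmul (cconj (cpow (cis (3 * t)) k)) (cis (2 * (n%:R * t)))).
    rewrite -cis_natmul -cisN -!cisD; congr cis.
    by rewrite /n natrD natrM; ring.
  rewrite c2 E4; case: (cpow (cis (3 * t)) k) => x y.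
  rewrite /spin /tilt /cmul /cconj /= => -[-> ->].
  by congr (_, _, _); field.
have v0 : v <> 0.
  move=> v0; move: Ev; rewrite v0 (homog0 _ _ (ray_homog MM)) => -[E1 E2].
  by move: CS => /eqP; rewrite -E1 -E2 expr0n addr0 eq_sym oner_eq0.
have [l l0 ->] := normalizeE v0.
rewrite (ray_homog MM) // normalize_scale // Ev normalize_id //.
by rewrite /sphere /= expr0n add0r addrC.
Qed.

End Families.

(** * Homeomorphisms between subsets *)
Section Homeomorphisms.
Context {X Y Z : topologicalType}.

Lemma homeo_comp (A : set X) (B : set Y) (C : set Z) (f : X -> Y) (g : Y -> Z) :
  homeomorphism A B f -> homeomorphism B C g ->
  homeomorphism A C (fun x => g (f x)).
Proof.
case=> fAB cf [f' [f'BA cf' fK f'K]] [gBC cg [g' [g'CB cg' gK g'K]]]; split.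
- by move=> x Ax; apply: gBC; exact: fAB.
- exact: within_comp cg.
exists (fun z => f' (g' z)); split.
- by move=> z Cz; apply: f'BA; exact: g'CB.
- exact: within_comp cf'.
- by move=> x Ax; rewrite gK ?fK// inE; apply: fAB; rewrite inE in Ax.
- by move=> z Cz; rewrite f'K ?g'K// inE; apply: g'CB; rewrite inE in Cz.
Qed.

Lemma homeo_inj (A : set X) (B : set Y) (f : X -> Y) x y :
  homeomorphism A B f -> A x -> A y -> f x = f y -> x = y.
Proof.
case=> _ _ [g [_ _ fK _]] Ax Ay fxy.
by rewrite -(fK x) ?inE // fxy fK ?inE.
Qed.

Lemma homeo_sub (A A' : set X) (B : set Y) (f : X -> Y) :
  A' `<=` A -> homeomorphism A B f -> homeomorphism A' (f @` A') f.
Proof.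
move=> sA [fAB cf [g [gBA cg fK gK]]].
have sB : f @` A' `<=` B by move=> y [x A'x <-]; apply: fAB; exact: sA.
split; [by move=> x A'x; exists x|exact: continuous_subspaceW cf|].
exists g; split.
- by move=> y [x A'x <-]; rewrite fK // inE; exact: sA.
- exact: continuous_subspaceW cg.
- by move=> x; rewrite !inE => A'x; apply: fK; rewrite inE; exact: sA.
- by move=> y; rewrite !inE => fA'y; apply: gK; rewrite inE; exact: sB.
Qed.

End Homeomorphisms.

Lemma homeo_inv {X Y : topologicalType} (A : set X) (B : set Y) (f : X -> Y) :
  homeomorphism A B f ->
  exists2 g, homeomorphism B A g &
    (forall x, A x -> g (f x) = x) /\ (forall y, B y -> f (g y) = y).
Proof.
case=> fAB cf [g [gBA cg fK gK]]; exists g.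
  by split => //; exists f.
by split=> [x Ax|y By]; [apply: fK|apply: gK]; rewrite inE.
Qed.

(** * The product as the double of a solid torus *)
Section Doubling.
Context {R : realType}.
Implicit Types (x y : space5 R).

Definition height x : R := x.2.2.

Definition mirror x : space5 R := (x.1, (x.2.1, - x.2.2)).

Lemma mirrorK x : mirror (mirror x) = x.
Proof. by case: x => e [p c]; rewrite /mirror /= opprK. Qed.

Lemma height_mirror x : height (mirror x) = - height x.
Proof. by []. Qed.

Lemma upperE x : upper_torus R x <-> S1xS2 R x /\ 0 <= height x.
Proof. by split=> [[? [? ?]]|[[? ?] ?]]. Qed.

Lemma lowerE x : lower_torus R x <-> S1xS2 R x /\ height x <= 0.
Proof. by split=> [[? [? ?]]|[[? ?] ?]]. Qed.

Lemma S1xS2_mirror x : S1xS2 R x -> S1xS2 R (mirror x).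
Proof.
by case: x => e [p c] [/= ce sp]; split=> //=; move: sp; rewrite /sphere /= sqrrN.
Qed.

Lemma upper_mirror x : lower_torus R x -> upper_torus R (mirror x).
Proof.
move=> /lowerE[Sx x0]; apply/upperE; split; first exact: S1xS2_mirror.
by rewrite height_mirror oppr_ge0.
Qed.

Lemma lower_mirror x : upper_torus R x -> lower_torus R (mirror x).
Proof.
move=> /upperE[Sx x0]; apply/lowerE; split; first exact: S1xS2_mirror.
by rewrite height_mirror oppr_le0.
Qed.

Lemma continuous_mirror : continuous mirror.
Proof. by move=> x; rewrite /mirror; cont. Qed.

Lemma mirror_homeo (A B : set (space5 R)) :
  set_fun A B mirror -> set_fun B A mirror -> homeomorphism A B mirror.
Proof.
move=> AB BA; split=> //; first exact/continuous_subspaceT/continuous_mirror.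
exists mirror; split=> //; first exact/continuous_subspaceT/continuous_mirror.
- by move=> x _; exact: mirrorK.
- by move=> x _; exact: mirrorK.
Qed.

Lemma closed_S1xS2_height (a : set R) : closed a ->
  closed [set x | S1xS2 R x /\ a (height x)].
Proof.
move=> ca.
have cl (F : space5 R -> R) (b : set R) : closed b -> continuous F ->
    closed (F @^-1` b).
  by move=> cb cF; apply: closed_comp => // x _; exact: cF.
pose F1 x := x.1.1 ^+ 2 + x.1.2 ^+ 2.
pose F2 x := x.2.1.1 ^+ 2 + x.2.1.2 ^+ 2 + x.2.2 ^+ 2.
have -> : [set x | S1xS2 R x /\ a (height x)] =
    (F1 @^-1` [set 1] `&` F2 @^-1` [set 1]) `&` height @^-1` a.
  by apply/seteqP; split.
apply: closedI; [apply: closedI|]; apply: cl => //.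
- by move=> x; rewrite /F1; cont.
- by move=> x; rewrite /F2; cont.
- by move=> x; rewrite /height; cont.
Qed.

Lemma closed_upper : closed (upper_torus R).
Proof.
have -> : upper_torus R = [set x | S1xS2 R x /\ [set t | 0 <= t] (height x)].
  by apply/seteqP; split=> x /upperE.
by apply: closed_S1xS2_height; exact: closed_ge.
Qed.

Lemma closed_lower : closed (lower_torus R).
Proof.
have -> : lower_torus R = [set x | S1xS2 R x /\ [set t | t <= 0] (height x)].
  by apply/seteqP; split=> x /lowerE.
by apply: closed_S1xS2_height; exact: closed_le.
Qed.

Lemma upperUlower : upper_torus R `|` lower_torus R = S1xS2 R.
Proof.
apply/seteqP; split=> x.
  by case=> [/upperE[]|/lowerE[]].
move=> Sx; have [h|h] := leP 0 (height x); [left|right].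
  exact/upperE.
by apply/lowerE; split => //; exact: ltW.
Qed.

(** On the lower torus, the conjugate of [f] by the reflection. *)
Definition doubled_map (f : space5 R -> space5 R) x : space5 R :=
  if 0 <= height x then f x else mirror (f (mirror x)).

Definition preserves_rim (f : space5 R -> space5 R) : Prop :=
  forall x, upper_torus R x -> (height (f x) = 0 <-> height x = 0).

Lemma doubled_map_lower f x : set_fun (upper_torus R) (upper_torus R) f ->
  preserves_rim f -> lower_torus R x -> doubled_map f x = mirror (f (mirror x)).
Proof.
move=> fU rim /lowerE[Sx x0]; rewrite /doubled_map; case: ifPn => // x0'.
have hx : height x = 0 by apply/eqP; rewrite eq_le x0 x0'.
have -> : mirror x = x.
  by case: x hx {Sx x0 x0'} => e [p c]; rewrite /height /mirror /= => ->; rewrite oppr0.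
have Ux : upper_torus R x by apply/upperE.
have := (rim x Ux).2 hx; rewrite /height /mirror => fx0.
by rewrite fx0 oppr0 -fx0 -!surjective_pairing.
Qed.

Lemma doubled_map_sub f : set_fun (upper_torus R) (upper_torus R) f ->
  set_fun (S1xS2 R) (S1xS2 R) (doubled_map f).
Proof.
move=> fU x Sx; rewrite /doubled_map; case: ifPn => x0.
  by have /upperE[] := fU x (proj2 (upperE x) (conj Sx x0)).
apply: S1xS2_mirror; have /upperE[//] : upper_torus R (f (mirror x)).
apply: fU; apply: upper_mirror; apply/lowerE; split=> //.
by apply: ltW; rewrite ltNge.
Qed.

(** The two formulas agree on the common boundary torus, since [f] preserves it and
    the reflection fixes its points. *)
Lemma doubled_map_cont f : set_fun (upper_torus R) (upper_torus R) f ->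
  preserves_rim f -> {within upper_torus R, continuous f} ->
  {within S1xS2 R, continuous (doubled_map f)}.
Proof.
move=> fU rim cf; rewrite -upperUlower; apply: withinU_continuous.
- exact: closed_upper.
- exact: closed_lower.
- apply: (within_congr _ cf) => x /upperE[_ x0].
  by rewrite /doubled_map x0.
- have cfm : {within lower_torus R, continuous (fun x => mirror (f (mirror x)))}.
    apply: (within_comp (B := setT) (f := fun x => f (mirror x))) => //.
      apply: (within_comp (B := upper_torus R)) => //.
        exact: upper_mirror.
      exact/continuous_subspaceT/continuous_mirror.
    exact/continuous_subspaceT/continuous_mirror.
  by apply: (within_congr _ cfm) => x Lx; rewrite doubled_map_lower.
Qed.

Lemma doubled_map_cancel f g : set_fun (upper_torus R) (upper_torus R) f ->
  preserves_rim f -> (forall x, upper_torus R x -> g (f x) = x) ->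
  {in S1xS2 R, cancel (doubled_map f) (doubled_map g)}.
Proof.
move=> fU rim fK x; rewrite inE => Sx.
rewrite {2}/doubled_map; case: ifPn => x0.
  have Ux : upper_torus R x by apply/upperE.
  have /upperE[_ h] := fU x Ux.
  by rewrite /doubled_map h fK.
move: x0; rewrite -ltNge => x0.
have Ux : upper_torus R (mirror x).
  by apply: upper_mirror; apply/lowerE; split=> //; exact: ltW.
have /upperE[_ h] := fU _ Ux.
have h0 : 0 < height (f (mirror x)).
  rewrite lt_neqAle h andbT eq_sym; apply/eqP => /(rim _ Ux).
  by rewrite height_mirror => /eqP; rewrite oppr_eq0 lt_eqF.
by rewrite /doubled_map height_mirror leNgt oppr_lt0 h0 /= mirrorK fK // mirrorK.
Qed.

Lemma doubled_map_homeo f : homeomorphism (upper_torus R) (upper_torus R) f ->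
  preserves_rim f -> homeomorphism (S1xS2 R) (S1xS2 R) (doubled_map f).
Proof.
move=> hf rim; have [g hg [fK gK]] := homeo_inv hf.
have [fU cf _] := hf; have [gU cg _] := hg.
have rimg : preserves_rim g.
  by move=> x Ux; rewrite -(rim _ (gU _ Ux)) gK.
split; [exact: doubled_map_sub|exact: doubled_map_cont|].
exists (doubled_map g); split; [exact: doubled_map_sub|exact: doubled_map_cont|..].
- exact: doubled_map_cancel.
- exact: doubled_map_cancel.
Qed.

End Doubling.

(** * Reduction to the standard thickening *)
Section Standardization.
Context {R : realType}.
Implicit Types (x y : space5 R) (q : R * R * R * R).

Definition std_thickening_inv x : R * R * R * R :=
  let d := Num.max `|x.2.1.1| `|x.2.1.2| + x.2.2 in
  (x.1, x.2.1.1 / d, x.2.1.2 / d).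

Lemma thickE e (a b : R) : thick_annulus R (e, a, b) <->
  [/\ circle R e, `|a| <= 1 & `|b| <= 1].
Proof.
rewrite /thick_annulus /annulus /= !in_itv /= -!ler_norml.
by split=> [[[? ?] ?]|[? ? ?]].
Qed.

Lemma std_thickening_arg_neq0 (a b : R) : (a, b, 1 - Num.max `|a| `|b|) <> (0 : R * R * R).
Proof.
move=> [-> ->]; rewrite normr0 maxxx subr0 => /eqP; by rewrite oner_eq0.
Qed.

Lemma std_thickening_height q : thick_annulus R q ->
  upper_torus R (std_thickening q) /\ (height (std_thickening q) = 0 <-> thick_annulus_boundary R q).
Proof.
case: q => [[e a] b] tq; have /thickE[ce a1 b1] := tq.
have [l l0 El] := normalizeE (@std_thickening_arg_neq0 a b).
have m1 : Num.max `|a| `|b| <= 1 by rewrite ge_max a1 b1.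
split.
  apply/upperE; split.
    split => //=; exact/normalize_sphere/std_thickening_arg_neq0.
  by rewrite /height /std_thickening El /= mulr_ge0 ?subr_ge0 // ltW.
rewrite /height /std_thickening El /=; split.
  move=> /eqP; rewrite mulf_eq0 gt_eqF //= subr_eq0 eq_sym => /eqP h.
  split=> //=; move: h; rewrite /Num.max /Order.max; case: ifP; by [right|left].
move=> [_ /= h]; apply/eqP; rewrite mulf_eq0 gt_eqF //= subr_eq0 eq_sym eq_le m1 /=.
by rewrite le_max; case: h => ->; rewrite lexx ?orbT.
Qed.

Lemma std_thickening_cont q : continuous_at q std_thickening.
Proof.
rewrite /std_thickening; cont; apply: cat_normalize; first exact: std_thickening_arg_neq0.
by cont.
Qed.

(** The sum of the maximum and the height, both nonnegative, is the gauge of the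
    pyramid. *)
Lemma std_thickening_inv_denom x : upper_torus R x ->
  0 < Num.max `|x.2.1.1| `|x.2.1.2| + x.2.2.
Proof.
case: x => e [[a b] c] /upperE[[/= _ sp]]; rewrite /height /= => c0.
rewrite lt_neqAle eq_sym addr_ge0 ?le_max ?normr_ge0 // andbT.
apply/eqP => h; apply: (sphere_neq0 sp).
have m0 : 0 <= Num.max `|a| `|b| by rewrite le_max normr_ge0.
have hc : c = 0 by lra.
have hm : Num.max `|a| `|b| <= 0 by lra.
by move: hm; rewrite ge_max !normr_le0 => /andP[/eqP-> /eqP->]; rewrite hc.
Qed.

Lemma std_thickening_inv_cont x : upper_torus R x -> continuous_at x std_thickening_inv.
Proof.
move=> /std_thickening_inv_denom h; rewrite /std_thickening_inv /=; cont => //; by rewrite gt_eqF.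
Qed.

Lemma std_thickening_inv_thick x : upper_torus R x -> thick_annulus R (std_thickening_inv x).
Proof.
move=> Ux; have d0 := std_thickening_inv_denom Ux; have /upperE[[ce _] c0] := Ux.
apply/thickE; split=> //; rewrite normrM normfV (gtr0_norm d0) ler_pdivrMr // mul1r.
  by rewrite ler_wpDr // le_max lexx.
by rewrite ler_wpDr // le_max lexx orbT.
Qed.

Lemma maxM (l a b : R) : 0 <= l -> Num.max (l * a) (l * b) = l * Num.max a b.
Proof. by move=> l0; rewrite maxr_pMr. Qed.

Lemma std_thickeningK q : thick_annulus R q -> std_thickening_inv (std_thickening q) = q.
Proof.
case: q => [[e a] b] /thickE[ce a1 b1].
have [l l0 El] := normalizeE (@std_thickening_arg_neq0 a b).
have ln0 : l != 0 by rewrite gt_eqF.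
rewrite /std_thickening_inv /std_thickening El /=.
rewrite !normrM (gtr0_norm l0) maxM ?(ltW l0) // -mulrDr addrC subrK mulr1.
by congr (_, _, _); rewrite mulrAC divff ?mul1r.
Qed.

Lemma std_thickening_invK x : upper_torus R x -> std_thickening (std_thickening_inv x) = x.
Proof.
move=> Ux; have d0 := std_thickening_inv_denom Ux; have /upperE[[ce sp] c0] := Ux.
case: x Ux d0 ce sp c0 => e [[a b] c] Ux d0 /= ce sp c0.
rewrite /std_thickening /std_thickening_inv /=; congr (_, _).
set d := _ + c in d0 *; have dn0 : d != 0 by rewrite gt_eqF.
have -> : (a / d, b / d, 1 - Num.max `|a / d| `|b / d|) = scale3 d^-1 (a, b, c).
  rewrite /scale3 /=; congr (_, _, _); rewrite 1?mulrC //.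
  have i0 : 0 < d^-1 by rewrite invr_gt0.
  rewrite !(mulrC _ d^-1) !normrM (gtr0_norm i0) maxM ?(ltW i0) //.
  by rewrite -[1](mulVf dn0) -mulrBr; congr (_ * _); rewrite /d addrAC subrr add0r.
by rewrite normalize_scale ?invr_gt0 // normalize_id.
Qed.

Lemma std_thickening_inv_homeo : homeomorphism (upper_torus R) (thick_annulus R) std_thickening_inv.
Proof.
split.
- exact: std_thickening_inv_thick.
- by apply: within_cat => x; exact: std_thickening_inv_cont.
exists std_thickening; split.
- by move=> q /std_thickening_height[].
- by apply: within_cat => q _; exact: std_thickening_cont.
- by move=> x; rewrite inE; exact: std_thickening_invK.
- by move=> q; rewrite inE; exact: std_thickeningK.
Qed.

(** Let [J] be the final homeomorphism of the isotopy that carries the standard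
    solid tori to [V1] and [V2], and let [s] be the identity or the reflection,
    according to whether [V] is [V1] or [V2].  Then [phi], followed by the inverse of
    [J] and by [s], differs from the standard thickening by a homeomorphism [f] of
    the upper torus, which preserves the boundary torus because [phi] maps boundary
    to boundary.  Its double, followed by [s] and [J], is the required map. *)
Lemma standardize (V1 V2 V : set (space5 R)) (phi : R * R * R * R -> space5 R) :
  H_decomposition V1 V2 -> V = V1 \/ V = V2 ->
  annulus_thickening V (V1 `&` V2) phi ->
  exists2 Phi, homeomorphism (S1xS2 R) (S1xS2 R) Phi &
    forall q, thick_annulus R q -> phi q = Phi (std_thickening q).
Proof.
move=> [H [_ HJ _] [J1 J2]] VV [hphi hbd].
have {HJ} hJ : homeomorphism (S1xS2 R) (S1xS2 R) (H 1).
  by apply: HJ; rewrite ler01 lexx.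
set J := H 1 in hJ J1 J2.
have [s [W [hs hsU ss sh [WS VW]]]] : exists (s : space5 R -> space5 R) W,
   [/\ homeomorphism (S1xS2 R) (S1xS2 R) s, homeomorphism W (upper_torus R) s,
       forall x, s (s x) = x, forall x, height (s x) = 0 <-> height x = 0
       & W `<=` S1xS2 R /\ V = J @` W].
  case: VV => ->.
  - exists id, (upper_torus R).
    have hid (A : set (space5 R)) : homeomorphism A A id.
      split=> //; first by apply: continuous_subspaceT => x; exact: cvg_id.
      by exists id; split=> //; apply: continuous_subspaceT => x; exact: cvg_id.
    by split=> //; split=> // x /upperE[].
  - exists mirror, (lower_torus R); split=> //.
    + by apply: mirror_homeo => x; exact: S1xS2_mirror.
    + by apply: mirror_homeo => x; [exact: upper_mirror|exact: lower_mirror].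
    + exact: mirrorK.
    + by move=> x; rewrite height_mirror; split=> [/eqP|->];
        rewrite ?oppr0 // oppr_eq0 => /eqP.
    + by split=> // x /lowerE[].
have hJW : homeomorphism W V J by rewrite VW; exact: homeo_sub hJ.
have [J' hJ' [JK J'K]] := homeo_inv hJW.
pose f x := s (J' (phi (std_thickening_inv x))).
have hf : homeomorphism (upper_torus R) (upper_torus R) f.
  exact: (homeo_comp std_thickening_inv_homeo (homeo_comp hphi (homeo_comp hJ' hsU))).
have [phiV _ _] := hphi; have [J'W _ _] := hJ'.
have rimJ z : W z -> (V1 `&` V2) (J z) <-> height z = 0.
  move=> Wz; have Sz := WS _ Wz; split.
    rewrite -J1 -J2 => -[[u Uu Ju] [w Lw Jw]].
    have [Su u0] := (upperE u).1 Uu; have [Sw w0] := (lowerE w).1 Lw.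
    have uz := homeo_inj hJ Su Sz Ju; have wz := homeo_inj hJ Sw Sz Jw.
    by apply/eqP; rewrite eq_le -{1}wz w0 /= -uz u0.
  move=> z0; rewrite -J1 -J2; split; exists z => //.
    by apply/upperE; rewrite z0.
  by apply/lowerE; rewrite z0.
have rim : preserves_rim f.
  move=> x Ux; rewrite /f sh.
  have tx := std_thickening_inv_thick Ux.
  rewrite -rimJ; last by apply: J'W; exact: phiV.
  rewrite J'K; last exact: phiV.
  rewrite -[X in height X = 0](std_thickening_invK Ux) (std_thickening_height tx).2 -hbd; split.
    by move=> [q bq pq]; rewrite -(homeo_inj hphi _ tx pq) //; case: bq.
  by move=> bq; exists (std_thickening_inv x).
exists (fun x => J (s (doubled_map f x))).
  exact: (homeo_comp (doubled_map_homeo hf rim) (homeo_comp hs hJ)).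
move=> q tq; have [Uq _] := std_thickening_height tq.
have /upperE[_ h] := Uq.
by rewrite /doubled_map h /f std_thickeningK // ss J'K //; exact: phiV.
Qed.

End Standardization.

Lemma within_pair {S A B : topologicalType} (D : set S) (f : S -> A) (g : S -> B) :
  {within D, continuous f} -> {within D, continuous g} ->
  {within D, continuous (fun x => (f x, g x))}.
Proof.
move=> /subspace_continuousP cf /subspace_continuousP cg.
by apply/subspace_continuousP => x Dx; exact: (cvg_pair (cf x Dx) (cg x Dx)).
Qed.

(** The image stays relatively open because the inverse of [Phi] is continuous. *)
Lemma open_chart_comp {X Y : topologicalType} (A : set X) (B : set Y)
    (chi : X -> Y) (Phi : Y -> Y) :
  homeomorphism B B Phi -> open_chart A B chi ->
  open_chart A B (fun x => Phi (chi x)).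
Proof.
move=> hP [hchi [U oU imU]].
have [Psi [PsiB cPsi _] [PhiK PsiK]] := homeo_inv hP.
have [PhiB _ _] := hP.
have imB : chi @` A `<=` B by rewrite imU => y [].
have im : [set Phi (chi x) | x in A] = Phi @` (chi @` A) by rewrite -image_comp.
split; first by rewrite im; exact: (homeo_comp hchi (homeo_sub imB hP)).
have : open (Psi @^-1` U : set (subspace B)).
  by move/continuousP : cPsi; apply.
move=> /open_subspaceP[V oV VB]; exists V => //.
rewrite im imU; apply/seteqP; split=> y.
  move=> [z [Bz Uz] <-]; split; first exact: PhiB.
  have : (V `&` B) (Phi z) by rewrite VB; split; [rewrite /= PhiK|exact: PhiB].
  by case.
move=> [By Vy]; have : (V `&` B) y by [].
by rewrite VB => -[/= UPy _]; exists (Psi y); [split=> //; exact: PsiB|exact: PsiK].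
Qed.

(** * Transport by a homeomorphism *)
Section Transport.
Context {R : realType} (Phi : space5 R -> space5 R).
Context (hPhi : homeomorphism (S1xS2 R) (S1xS2 R) Phi).

Lemma isotopy_conj (H : R -> space5 R -> space5 R) : ambient_isotopy H ->
  exists2 H', ambient_isotopy H' &
    forall x, S1xS2 R x -> H' 1 (Phi x) = Phi (H 1 x).
Proof.
have [Psi hPsi [PhiK PsiK]] := homeo_inv hPhi.
have [PhiX cPhi _] := hPhi; have [PsiX cPsi _] := hPsi.
move=> [cH hH H0]; exists (fun t x => Phi (H t (Psi x))); last first.
  by move=> x Sx; rewrite PhiK.
have HX t x : 0 <= t <= 1 -> S1xS2 R x -> S1xS2 R (H t x).
  by move=> /hH[hX _ _]; exact: hX.
have ct : {within `[0, 1] `*` S1xS2 R,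
    continuous (fun q : R * space5 R => (q.1, Psi q.2))}.
  apply: within_pair.
    by apply: continuous_subspaceT => q; cont.
  apply: (within_comp (B := S1xS2 R) (f := fun q : R * space5 R => q.2)) => //.
    by move=> q [].
  by apply: continuous_subspaceT => q; cont.
have st : set_fun (`[0, 1] `*` S1xS2 R) (`[0, 1] `*` S1xS2 R)
    (fun q : R * space5 R => (q.1, Psi q.2)).
  by move=> [t x] [/= t01 Sx]; split => //=; exact: PsiX.
split.
- apply: (within_comp (B := S1xS2 R)
    (f := fun q : R * space5 R => H q.1 (Psi q.2))) => //.
    move=> [t x] [/= t01 Sx]; apply: HX; last exact: PsiX.
    by move: t01; rewrite in_itv.
  exact: (within_comp st ct cH).
- move=> t t01.
  exact: (homeo_comp hPsi (homeo_comp (hH t t01) hPhi)).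
- move=> x; rewrite inE => Sx; rewrite H0 ?PsiK // inE; exact: PsiX.
Qed.

Lemma isotopic_transport (H : R -> space5 R -> space5 R) (L L' : set (space5 R)) :
  ambient_isotopy H -> L `<=` S1xS2 R -> H 1 @` L = L' ->
  ambient_isotopic (Phi @` L) (Phi @` L').
Proof.
move=> /isotopy_conj[H' iH' H'E] LX <-; exists H' => //.
by rewrite !image_comp; apply: eq_imagel => x Lx /=; rewrite H'E //; exact: LX.
Qed.

Lemma knot_transport (kappa : R -> space5 R) : is_knot kappa ->
  is_knot (fun t => Phi (kappa t)).
Proof.
have [Psi hPsi [PhiK PsiK]] := homeo_inv hPhi.
have [PhiX cPhi _] := hPhi.
case=> ck kX kinj flat.
have Sk t : S1xS2 R (kappa t) by apply: kX; exists t.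
split.
- move=> t; have ct : {within setT, continuous (fun t => Phi (kappa t))}.
    by apply: (within_comp (B := S1xS2 R)) => //; exact: continuous_subspaceT.
  exact: ((continuous_subspace_setT _).2 ct).
- by move=> x [t _ <-]; exact: PhiX.
- by move=> s t; rewrite -kinj; split=> [e|->//]; exact: (homeo_inj hPhi _ _ e).
- move=> p [t _ <-].
  have [chi [och chi0 chiE]] : exists chi : R * R * R -> space5 R,
      [/\ open_chart (open_cube R) (S1xS2 R) chi, chi (0, 0, 0) = kappa t &
      forall q, open_cube R q -> (range kappa (chi q) <-> q.1.2 = 0 /\ q.2 = 0)].
    by apply: flat; exists t.
  exists (fun q => Phi (chi q)); split.
  + exact: open_chart_comp.
  + by rewrite chi0.
  + move=> q cq; rewrite -chiE //.
    have chiX : S1xS2 R (chi q).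
      have [_ [U _ im]] := och.
      by have : (chi @` open_cube R) (chi q) by [exists q]; rewrite im => -[].
    split=> [[u _ pu]|[u _ <-]]; last by exists u.
    by exists u => //; exact: (homeo_inj hPhi _ _ pu).
Qed.

End Transport.

Lemma near_pos {R : realType} {T : topologicalType} (f : T -> R) x :
  continuous_at x f -> 0 < f x -> \forall y \near x, 0 < f y.
Proof. by move=> cf fx; exact: (cvgr_gt (f x) cf _ fx). Qed.

(** * Local flatness of the torus knot *)
Section TorusKnot.
Context {R : realType}.
Implicit Types (s t : R) (q : R * R * R) (x : space5 R).

Lemma ang_scale (r : R) (w : R * R) : r != 0 -> ang (r * w.1, r * w.2) = ang w.
Proof.
by move=> r0; rewrite /ang /= invfM mulrACA divff ?mul1r.
Qed.

Lemma ang_polar (w : R * R) : 0 < w.1 ->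
  let r := Num.sqrt (w.1 ^+ 2 + w.2 ^+ 2) in
  (r * (cis (ang w)).1, r * (cis (ang w)).2) = w.
Proof.
case: w => a b; rewrite [X in 0 < X]/= => a0 r.
have n0 : 0 < a ^+ 2 + b ^+ 2 by rewrite ltr_pwDl ?exprn_gt0 ?sqr_ge0.
have r0 : 0 < r by rewrite sqrtr_gt0.
have rn0 : r != 0 by rewrite gt_eqF.
have -> : ang (a, b) = ang (r^-1 * a, r^-1 * b).
  by rewrite (ang_scale (a, b)) // invr_eq0.
have rr : r ^+ 2 = a ^+ 2 + b ^+ 2 by rewrite sqr_sqrtr // ltW.
rewrite angK; last 2 first.
- rewrite /circle /= !exprMn -mulrDr -rr exprVn mulVf //.
  by rewrite expf_neq0.
- by rewrite mulr_gt0 // invr_gt0.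
by rewrite /= !mulVKf.
Qed.

(** Coordinates around the point of parameter [s]: along the knot, across it in the
    torus, and away from the torus.  The scale 1/24 keeps the angles within a
    quarter of a turn and the chart away from the other strands. *)
Definition chart s q : space5 R :=
  let r := Num.sqrt (1 - (q.2 / 2) ^+ 2) in
  let z := cis (4 * (s + q.1.1 / 24) + q.1.2 / 24) in
  (cis (3 * (s + q.1.1 / 24)), (q.2 / 2, r * z.2, r * z.1)).

(** The angles of these two points are those of [x] along the two factors of the
    torus, measured from the base point of the chart. *)
Definition long_dev s x : R * R := cmul (cconj (cis (3 * s))) x.1.

Definition merid_dev s x : R * R := cmul (cconj (cis (4 * s))) (x.2.2, x.2.1.2).

Definition chart_inv s x : R * R * R :=
  let a := 8 * ang (long_dev s x) in
  (a, 24 * (ang (merid_dev s x) - 4 * (a / 24)), 2 * x.2.1.1).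

Definition chart_dom s : set (space5 R) :=
  [set x | [/\ 0 < (long_dev s x).1, 0 < (merid_dev s x).1 &
    open_cube R (chart_inv s x)]].

Lemma open_cubeE (a b c : R) :
  open_cube R (a, b, c) <-> [/\ `|a| < 1, `|b| < 1 & `|c| < 1].
Proof.
rewrite /open_cube /open_square /= !in_itv /= -!ltr_norml.
by split=> [[[? ?] ?]|[? ? ?]].
Qed.

Lemma cconj_mul_cis s t : cmul (cconj (cis s)) (cis (s + t)) = cis t.
Proof. by rewrite -cisN -cisD; congr cis; ring. Qed.

Lemma cmul_scale (r : R) (p w : R * R) :
  cmul p (r * w.1, r * w.2) = (r * (cmul p w).1, r * (cmul p w).2).
Proof. by rewrite /cmul /=; congr (_, _); ring. Qed.

Lemma long_dev_chart s a b c :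
  long_dev s (chart s (a, b, c)) = cis (a / 8).
Proof.
rewrite /long_dev /chart /=.
have -> : 3 * (s + a / 24) = 3 * s + a / 8 by field.
exact: cconj_mul_cis.
Qed.

Lemma merid_dev_chart s a b c : let r := Num.sqrt (1 - (c / 2) ^+ 2) in
  let z := cis (4 * (a / 24) + b / 24) in
  merid_dev s (chart s (a, b, c)) = (r * z.1, r * z.2).
Proof.
move=> r z; rewrite /merid_dev /chart [in LHS]/= -/r.
rewrite (cmul_scale r (cconj (cis (4 * s))) (cis (4 * (s + a / 24) + b / 24))).
have -> : 4 * (s + a / 24) + b / 24 = 4 * s + (4 * (a / 24) + b / 24) by ring.
by rewrite cconj_mul_cis.
Qed.

Lemma chart_radius (c : R) : `|c| < 1 -> 0 < Num.sqrt (1 - (c / 2) ^+ 2).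
Proof. by move=> /ltr_normlP[c1 c2]; rewrite sqrtr_gt0; nra. Qed.

Lemma chartK s q : open_cube R q -> chart_inv s (chart s q) = q.
Proof.
case: q => [[a b] c] /open_cubeE[a1 b1 c1].
have r0 := chart_radius c1.
rewrite /chart_inv long_dev_chart merid_dev_chart.
rewrite (ang_scale (cis (4 * (a / 24) + b / 24))) ?gt_eqF //.
have -> : (chart s (a, b, c)).2.1.1 = c / 2 by [].
have /ltr_normlP[? ?] := a1; have /ltr_normlP[? ?] := b1.
rewrite !cisK; last 2 first.
- by rewrite ltr_norml; apply/andP; split; lra.
- by rewrite ltr_norml; apply/andP; split; lra.
by congr (_, _, _); field.
Qed.

Lemma chart_sub s q : open_cube R q -> S1xS2 R (chart s q).
Proof.
case: q => [[a b] c] /open_cubeE[a1 b1 c1]; have := chart_radius c1.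
rewrite sqrtr_gt0 => r0; split; first exact: cis_circle.
rewrite /sphere /chart /= !(exprMn _ (Num.sqrt _)) sqr_sqrtr ?(ltW r0) //.
have := cis_circle (4 * (s + a / 24) + b / 24); rewrite /circle /= => h.
by rewrite -addrA -mulrDr addrC [X in _ * X]addrC h; ring.
Qed.

Lemma chart_in_dom s q : open_cube R q -> chart_dom s (chart s q).
Proof.
move=> cq; split; last by rewrite chartK.
- case: q cq => [[a b] c] /open_cubeE[/ltr_normlP[? ?] b1 c1].
  rewrite long_dev_chart; apply: cis_gt0.
  by rewrite ltr_norml; apply/andP; split; lra.
- case: q cq => [[a b] c] /open_cubeE[/ltr_normlP[? ?] /ltr_normlP[? ?] c1].
  rewrite merid_dev_chart mulr_gt0 ?chart_radius //; apply: cis_gt0.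
  by rewrite ltr_norml; apply/andP; split; lra.
Qed.

Lemma chart_invK s x : S1xS2 R x -> chart_dom s x -> chart s (chart_inv s x) = x.
Proof.
case: x => e [[p1 p2] p3] [/= ce sp] [l0 m0 _].
rewrite /chart /chart_inv /=.
set x := (e, (p1, p2, p3)) in l0 m0 *.
set al := ang (long_dev s x); set am := ang (merid_dev s x).
have -> : 3 * (s + 8 * al / 24) = 3 * s + al by field.
have -> : 4 * (s + 8 * al / 24) + 24 * (am - 4 * (8 * al / 24)) / 24 = 4 * s + am.
  by field.
have -> : 2 * p1 / 2 = p1 by field.
congr (_, _).
  rewrite cisD angK //; last first.
    by apply: circle_mul => //; apply: circle_conj; exact: cis_circle.
  rewrite -{1}(cconjK (cis (3 * s))) cmulK //.
  by apply: circle_conj; exact: cis_circle.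
have /= := ang_polar m0; rewrite -/am.
have -> : (merid_dev s x).1 ^+ 2 + (merid_dev s x).2 ^+ 2 = 1 - p1 ^+ 2.
  have := cis_circle (4 * s); rewrite /circle /= => h.
  transitivity (((cis (4 * s)).1 ^+ 2 + (cis (4 * s)).2 ^+ 2) * (p3 ^+ 2 + p2 ^+ 2)).
    by rewrite /merid_dev /cmul /cconj /=; ring.
  by move: sp; rewrite /sphere /= h mul1r => sp; lra.
set r := Num.sqrt _ => h.
have : (r * (cis (4 * s + am)).1, r * (cis (4 * s + am)).2) = (p3, p2).
  rewrite cisD -(cmul_scale r (cis (4 * s)) (cis am)) h /merid_dev.
  rewrite -{1}(cconjK (cis (4 * s))) cmulK //.
  by apply: circle_conj; exact: cis_circle.
by move=> [-> ->].
Qed.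

Lemma chart_cont s q : continuous_at q (chart s).
Proof. by rewrite /chart /cis; cont. Qed.

Lemma cat_long_dev s x : continuous_at x (long_dev s).
Proof. by rewrite /long_dev; apply: cat_cmul; cont. Qed.

Lemma cat_merid_dev s x : continuous_at x (merid_dev s).
Proof. by rewrite /merid_dev; apply: cat_cmul; cont. Qed.

Lemma cat_ang {T : topologicalType} (f : T -> R * R) y :
  (f y).1 != 0 -> continuous_at y f -> continuous_at y (fun z => ang (f z)).
Proof. by move=> f0 cf; rewrite /ang; cont. Qed.

Lemma chart_inv_cont s x : 0 < (long_dev s x).1 -> 0 < (merid_dev s x).1 ->
  continuous_at x (chart_inv s).
Proof.
move=> l0 m0; have cl := @cat_ang _ (long_dev s) x (lt0r_neq0 l0) (@cat_long_dev s x).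
have cm := @cat_ang _ (merid_dev s) x (lt0r_neq0 m0) (@cat_merid_dev s x).
by rewrite /chart_inv; cont.
Qed.

Lemma open_chart_dom s : open (chart_dom s).
Proof.
rewrite openE => x [l0 m0 cx].
have cl := @cat_long_dev s x; have cm := @cat_merid_dev s x.
have ci := chart_inv_cont l0 m0.
have {cx} [a1 b1 c1] : [/\ `|(chart_inv s x).1.1| < 1, `|(chart_inv s x).1.2| < 1 &
    `|(chart_inv s x).2| < 1].
  by apply/open_cubeE; move: cx; case: (chart_inv s x) => [[]].
have n1 : \forall y \near x, 0 < (long_dev s y).1 by apply: near_pos => //; cont.
have n2 : \forall y \near x, 0 < (merid_dev s y).1 by apply: near_pos => //; cont.
have n3 : \forall y \near x, 0 < 1 - `|(chart_inv s y).1.1|.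
  by apply: near_pos; [cont|rewrite subr_gt0].
have n4 : \forall y \near x, 0 < 1 - `|(chart_inv s y).1.2|.
  by apply: near_pos; [cont|rewrite subr_gt0].
have n5 : \forall y \near x, 0 < 1 - `|(chart_inv s y).2|.
  by apply: near_pos; [cont|rewrite subr_gt0].
rewrite /interior /=; near=> y; split.
- by near: y.
- by near: y.
- have h3 : 0 < 1 - `|(chart_inv s y).1.1| by near: y.
  have h4 : 0 < 1 - `|(chart_inv s y).1.2| by near: y.
  have h5 : 0 < 1 - `|(chart_inv s y).2| by near: y.
  move: h3 h4 h5; rewrite !subr_gt0; case: (chart_inv s y) => [[a b] c] /= *.
  exact/open_cubeE.
Unshelve. all: by end_near. Qed.

Lemma chart_open s : open_chart (open_cube R) (S1xS2 R) (chart s).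
Proof.
have im : chart s @` open_cube R = S1xS2 R `&` chart_dom s.
  apply/seteqP; split=> x.
    by move=> [q cq <-]; split; [exact: chart_sub|exact: chart_in_dom].
  move=> [Sx dx]; exists (chart_inv s x); last exact: chart_invK.
  by case: dx.
split; last by exists (chart_dom s) => //; exact: open_chart_dom.
split; first by move=> q cq; exists q.
  by apply: within_cat => q _; exact: chart_cont.
exists (chart_inv s); split.
- by move=> x [q cq <-]; rewrite chartK.
- apply: within_cat => x; rewrite im => -[_ [l0 m0 _]].
  exact: chart_inv_cont.
- by move=> q; rewrite inE => cq; exact: chartK.
- by move=> x; rewrite inE im => -[Sx dx]; exact: chart_invK.
Qed.

Lemma same_mod1_34 s t : cis (3 * s) = cis (3 * t) -> cis (4 * s) = cis (4 * t) ->
  same_mod1 s t.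
Proof.
move=> /cis_eq[a ha] /cis_eq[b hb]; exists (b - a).
by rewrite intrD mulrNz; lra.
Qed.

Lemma small_int (k : int) : `|k%:~R : R| < 1 -> k = 0.
Proof.
by rewrite -intr_norm (_ : 1 = 1%:~R :> R) // ltr_int => h; lia.
Qed.

(** A common point with the knot, of parameter [t], gives [3 t = 3 (s + a / 24)] and
    [4 t = 4 (s + a / 24) + b / 24] modulo 1; eliminating [t] makes [3 b / 24] an
    integer, of absolute value less than 1. *)
Lemma chart_knot s q : open_cube R q ->
  range (@torus_knot R) (chart s q) <-> q.1.2 = 0 /\ q.2 = 0.
Proof.
case: q => [[a b] c] /open_cubeE[a1 b1 c1] /=.
split=> [[t _]|[-> ->]]; last first.
  exists (s + a / 24) => //; rewrite /torus_knot /chart /=.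
  by rewrite !mul0r addr0 expr0n subr0 sqrtr1 !mul1r.
rewrite /torus_knot /chart [X in _ = X -> _]/= => -[/= e1 e2 c0 w2 w1].
have {}c0 : c = 0 by lra.
split=> //; move: w2 w1; rewrite c0 mul0r expr0n subr0 sqrtr1 !mul1r => w2 w1.
have h3 : cis (3 * t) = cis (3 * (s + a / 24)) by rewrite /cis e1 e2.
have h4 : cis (4 * t) = cis (4 * (s + a / 24) + b / 24) by rewrite /cis w1 w2.
move: h3 h4 => /cis_eq[k hk] /cis_eq[l hl].
have hb : 3 * (b / 24) = (3 * l - 4 * k)%:~R :> R.
  by rewrite intrD mulrNz !intrM; lra.
have z0 : 3 * l - 4 * k = 0.
  apply: small_int; rewrite -hb; move: b1 => /ltr_normlP[? ?].
  by rewrite ltr_norml; apply/andP; split; lra.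
by move: hb; rewrite z0 => hb; lra.
Qed.

Lemma torus_knot_sub t : S1xS2 R (torus_knot t).
Proof.
split; first exact: cis_circle.
have := cis_circle (4 * t); rewrite /circle /sphere /=.
by rewrite expr0n add0r addrC.
Qed.

Lemma torus_knot_is_knot : is_knot (@torus_knot R).
Proof.
split.
- by move=> t; rewrite /torus_knot /cis /=; cont.
- by move=> x [t _ <-]; exact: torus_knot_sub.
- move=> s t; split=> [[a b c d]|[k ->]].
    by apply: same_mod1_34; rewrite /cis; congr (_, _).
  rewrite /torus_knot.
  have -> : 3 * (s + k%:~R) = 3 * s + (3 * k)%:~R :> R by rewrite intrM; ring.
  have -> : 4 * (s + k%:~R) = 4 * s + (4 * k)%:~R :> R by rewrite intrM; ring.
  by rewrite !cis_int.
- move=> p [s _ <-]; exists (chart s); split; first exact: chart_open.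
    rewrite /chart /torus_knot /= !mul0r !addr0 expr0n subr0 sqrtr1.
    by rewrite !mul1r.
  by move=> q; exact: chart_knot.
Qed.

End TorusKnot.

(** * Triple angles and smoothness *)
Section Trig.
Context {R : realType}.
Implicit Types (x s t w c : R).

Lemma cis3 x : cis (3 * x) = (4 * (cis x).1 ^+ 3 - 3 * (cis x).1,
  3 * (cis x).2 - 4 * (cis x).2 ^+ 3).
Proof.
have -> : 3 * x = x + x + x by ring.
have := cis_circle x; rewrite !cisD; case: (cis x) => a b.
rewrite /circle /cmul /= => h.
have ha : a ^+ 2 = 1 - b ^+ 2 by lra.
have hb : b ^+ 2 = 1 - a ^+ 2 by lra.
congr (_, _).
- transitivity (a ^+ 3 - 3 * a * b ^+ 2); first by ring.
  by rewrite hb; ring.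
- transitivity (3 * b * a ^+ 2 - b ^+ 3); first by ring.
  by rewrite ha; ring.
Qed.

(** The cosine is a root of [4 x^3 - 3 x - 1 = (x - 1) (2 x + 1)^2] other than 1. *)
Lemma cis_third : exists2 r : R, r ^+ 2 = 3 / 4 &
  cis (3^-1) = (- 2^-1, r) /\ cis (2 / 3) = (- 2^-1, - r).
Proof.
have := cis3 (3^-1); rewrite divff // cis1.
have := cis_circle (3^-1 : R); have : cis (3^-1) <> (1, 0) :> R * R.
  move=> /cis_eq1[m hm]; apply: (@no_int_between01 R m).
  by rewrite -hm; apply/andP; split; lra.
have -> : 2 / 3 = 3^-1 + 3^-1 :> R by field.
rewrite cisD; case: (cis _) => a b; rewrite /circle /= => ne h [e1 e2].
have ha : a = - 2^-1.
  have : (a - 1) * (2 * a + 1) ^+ 2 = 0.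
    by transitivity (4 * a ^+ 3 - 3 * a - 1); [ring|rewrite -e1 subrr].
  move=> /eqP; rewrite mulf_eq0 expf_eq0 /= => /orP[|/eqP]; last by lra.
  rewrite subr_eq0 => /eqP a1; case: ne; rewrite a1; congr (_, _).
  have : b ^+ 2 = 0 by move: h; rewrite a1 expr1n; lra.
  by move=> /eqP; rewrite expf_eq0 /= => /eqP.
exists b; first by move: h; rewrite ha; lra.
split; first by rewrite ha.
rewrite /cmul /= -!expr2; congr (_, _).
  by move: h; rewrite ha; lra.
by rewrite ha; field.
Qed.

(** This family is stable under differentiation. *)
Definition harmonic (A B w t : R) : R := A * cos (w * t) + B * sin (w * t).

Lemma is_derive_harmonic A B w t :
  is_derive t 1 (harmonic A B w) (harmonic (w * B) (- (w * A)) w t).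
Proof.
have d : is_derive t 1 (fun u => w * u) w.
  have -> : (fun u : R => w * u) = w *: id by [].
  apply: is_derive_eq; by rewrite /GRing.scale /= mulr1.
have dc : is_derive t 1 (fun u => cos (w * u)) (w *: - sin (w * t)).
  apply: is_derive_eq; exact: mulrC.
have ds : is_derive t 1 (fun u => sin (w * u)) (w *: cos (w * t)).
  apply: is_derive_eq; exact: mulrC.
have -> : harmonic A B w =
    A *: (fun u => cos (w * u)) + B *: (fun u => sin (w * u)) by [].
by apply: is_derive_eq; rewrite /harmonic /GRing.scale /=; ring.
Qed.

Lemma derive1_harmonic A B w :
  derive1 (harmonic A B w) = harmonic (w * B) (- (w * A)) w.
Proof.
apply/funext => t; rewrite derive1E.
exact: (@derive_val _ _ _ _ _ _ _ (is_derive_harmonic A B w t)).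
Qed.

Lemma smooth_harmonic A B w : smooth (harmonic A B w).
Proof.
move=> n t; suff [A' [B' ->]] : exists A' B',
    derive1n n (harmonic A B w) = harmonic A' B' w.
  exact: (@ex_derive _ _ _ _ _ _ _ (is_derive_harmonic A' B' w t)).
elim: n => [|n [A' [B' IH]]]; first by exists A, B.
by rewrite derive1nS IH derive1_harmonic; do 2 eexists.
Qed.

Lemma cis_cos_harmonic c : (fun t => (cis (c * t)).1) = harmonic 1 0 (2 * pi * c).
Proof. by apply/funext => t; rewrite /harmonic /cis /= (mulrA (2 * pi)); ring. Qed.

Lemma cis_sin_harmonic a c :
  (fun t => a * (cis (c * t)).2) = harmonic 0 a (2 * pi * c).
Proof. by apply/funext => t; rewrite /harmonic /cis /= (mulrA (2 * pi)); ring. Qed.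

Lemma derive1_cis_cos c t :
  derive1 (fun t => (cis (c * t)).1) t = - (2 * pi * c) * (cis (c * t)).2.
Proof.
by rewrite cis_cos_harmonic derive1_harmonic /harmonic /cis /= (mulrA (2 * pi)); ring.
Qed.

Lemma derive1_cis_sin a c t :
  derive1 (fun t => a * (cis (c * t)).2) t = a * (2 * pi * c) * (cis (c * t)).1.
Proof.
by rewrite cis_sin_harmonic derive1_harmonic /harmonic /cis /= (mulrA (2 * pi)); ring.
Qed.

End Trig.

(** * The alternating diagrams *)
Section Diagram.
Context {R : realType} (k : nat).
Implicit Types (s t u : R).
Let n := (3 * k + 2)%N.

Definition braid_diagram : diagram R :=
  @Diagram R 1 (fun _ => braid_curve n) (fun _ t => 0 < braid_height n t).

Local Notation strand t := (cis (n%:R * t)) (only parsing).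

Lemma braid_nE : n%:R = 3 * k%:R + 2 :> R.
Proof. by rewrite /n natrD natrM. Qed.

Lemma braid_height_alg t : braid_height n t = 2^-1 * (strand t).1 * (strand t).2.
Proof.
rewrite /braid_height.
have -> : 2 * (n%:R * t) = n%:R * t + n%:R * t by ring.
by rewrite cisD; case: (cis _) => a b; rewrite /cmul /=; field.
Qed.

Lemma same_mod1_3n s t : cis (3 * s) = cis (3 * t) -> strand s = strand t ->
  same_mod1 s t.
Proof.
move=> /cis_eq[p hp] /cis_eq[m hm]; exists (p - (m - p * k%:Z)).
have := congr1 (fun z => k%:R * z) hp.
by move: hm; rewrite braid_nE !rmorphB rmorphM /= -[(k%:Z)%:~R]/(k%:R) => hm hp'; lra.
Qed.

Lemma same_mod1_strand s t : same_mod1 s t ->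
  cis (3 * s) = cis (3 * t) /\ strand s = strand t.
Proof.
move=> [m ->].
have -> : 3 * (s + m%:~R) = 3 * s + (3 * m)%:~R :> R by rewrite intrM; ring.
have -> : n%:R * (s + m%:~R) = n%:R * s + (n%:Z * m)%:~R :> R.
  by rewrite intrM; ring.
by rewrite !cis_int.
Qed.

Lemma same_paramE (i j : 'I_1) s t :
  same_param (D := braid_diagram) i s j t <-> same_mod1 s t.
Proof. by split=> [[]//|h]; split=> //; rewrite (ord1 i) (ord1 j). Qed.

Lemma curve_eq s t : braid_curve n s = braid_curve n t <->
  cis (3 * s) = cis (3 * t) /\ (strand s).2 = (strand t).2.
Proof.
rewrite /braid_curve; split=> [[h1 h2 h3]|[-> ->]//].
split; first by rewrite /cis h1 h2.
by apply: (mulfI (x := 2^-1)) h3; rewrite invr_eq0 pnatr_eq0.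
Qed.

(** The two strands have the same sine.  Equal cosines would make the parameters
    equal modulo 1, because [n] is prime to 3; hence the cosines are opposite.  The
    triple angles agree, as they are [n] times the angle of the point in the
    annulus, so that the cosine [c] satisfies [4 c^3 - 3 c = 0] and is not 0. *)
Lemma crossing_alg (i j : 'I_1) s t : double_point (D := braid_diagram) i s j t ->
  [/\ cis (3 * s) = cis (3 * t), (strand t).2 = (strand s).2,
      (strand t).1 = - (strand s).1, (strand s).1 ^+ 2 = 3 / 4 &
      (strand s).2 ^+ 2 = 4^-1].
Proof.
move=> [/curve_eq[h3 h2] /same_paramE ns].
have h1 : (strand t).1 = - (strand s).1.
  have := cis_circle (n%:R * s); have := cis_circle (n%:R * t).
  rewrite /circle /mkset h2 => ht hs.
  have : (strand t).1 ^+ 2 == (strand s).1 ^+ 2 by apply/eqP; lra.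
  rewrite eqf_sqr => /orP[/eqP e|/eqP//].
  by case: ns; apply: same_mod1_3n => //; rewrite [LHS]surjective_pairing -e h2 -surjective_pairing.
have c0 : (strand s).1 != 0.
  apply/eqP => c0; apply: ns; apply: same_mod1_3n => //.
  by rewrite [LHS]surjective_pairing [RHS]surjective_pairing h2 h1 c0 oppr0.
have cc : cis (3 * (n%:R * s)) = cis (3 * (n%:R * t)).
  have e (x : R) : 3 * (n%:R * x) = n%:R * (3 * x) by ring.
  by rewrite !e !(cis_natmul n) h3.
have c2 : (strand s).1 ^+ 2 = 3 / 4.
  move: cc; rewrite !cis3 h1; set c := (cis (n%:R * s)).1 in c0 * => /(congr1 fst) /= e.
  by apply: (mulfI c0); rewrite -exprS; lra.
split=> //.
by have := cis_circle (n%:R * s); rewrite /circle /mkset c2 => h; lra.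
Qed.

Lemma shift_third t : cis (3 * (t + 3^-1)) = cis (3 * t) /\
  cis (n%:R * (t + 3^-1)) = cmul (strand t) (cis (2 / 3)).
Proof.
split.
  have -> : 3 * (t + 3^-1) = 3 * t + 1 by field.
  exact: cisD1.
have -> : n%:R * (t + 3^-1) = n%:R * t + 2 / 3 + k%:R by rewrite braid_nE; field.
by rewrite cis_nat cisD.
Qed.

Lemma shift_two_thirds t : cis (3 * (t + 2 / 3)) = cis (3 * t) /\
  cis (n%:R * (t + 2 / 3)) = cmul (strand t) (cis (3^-1)).
Proof.
split.
  have -> : 3 * (t + 2 / 3) = 3 * t + 2%:R by field.
  exact: cis_nat.
have -> : n%:R * (t + 2 / 3) = n%:R * t + 3^-1 + (2 * k + 1)%:R.
  by rewrite braid_nE natrD natrM; field.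
by rewrite cis_nat cisD.
Qed.

Lemma not_mod1_third t (r : R) : 0 < r < 1 -> ~ same_mod1 t (t + r).
Proof.
move=> r01 [m hm]; have hr : m%:~R = r by lra.
by move: r01; rewrite -hr; exact: no_int_between01.
Qed.

(** The other two points of the fibre are rotated by thirds of a turn; one of them
    has the same sine. *)
Lemma crossing_double s : (strand s).2 ^+ 2 = 4^-1 ->
  exists t, double_point (D := braid_diagram) ord0 s ord0 t.
Proof.
move=> hs; have [r r2 [c1 c2]] := @cis_third R.
have hc : (strand s).1 ^+ 2 = 3 / 4.
  by have := cis_circle (n%:R * s); rewrite /circle /mkset => h; lra.
have : (r * (strand s).1) ^+ 2 == (3 / 2 * (strand s).2) ^+ 2.
  by rewrite !exprMn r2 hc hs; apply/eqP; field.
rewrite eqf_sqr => /orP[/eqP e|/eqP e].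
- exists (s + 2 / 3); have [h3 hn] := shift_two_thirds s; split.
    apply/curve_eq; rewrite h3; split=> //.
    by move: e; rewrite hn c1; case: (cis _) => a b /=; lra.
  by move=> /same_paramE; apply: not_mod1_third; apply/andP; split; lra.
- exists (s + 3^-1); have [h3 hn] := shift_third s; split.
    apply/curve_eq; rewrite h3; split=> //.
    by move: e; rewrite hn c2; case: (cis _) => a b /=; lra.
  by move=> /same_paramE; apply: not_mod1_third; apply/andP; split; lra.
Qed.

Lemma crossing_paramE (i : 'I_1) s :
  crossing_param (D := braid_diagram) i s <-> (strand s).2 ^+ 2 = 4^-1.
Proof.
split=> [[j [t]]|/crossing_double[t]]; first by case/crossing_alg.
by move=> h; exists ord0, t; rewrite (ord1 i).
Qed.

Lemma over_under_alg (i j : 'I_1) s t :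
  double_point (D := braid_diagram) i s j t ->
  braid_height n t = - braid_height n s /\ braid_height n s != 0.
Proof.
move=> /crossing_alg[_ h2 h1 hc hs].
rewrite !braid_height_alg h2 h1; split; first by ring.
rewrite !mulf_neq0 // ?invr_eq0 ?pnatr_eq0 //; apply/eqP => h0.
  by move: hc; rewrite h0; lra.
by move: hs; rewrite h0; lra.
Qed.

Lemma velocityE t : velocity (braid_curve n) t =
  (- (2 * pi * 3) * (cis (3 * t)).2, 2 * pi * 3 * (cis (3 * t)).1,
   2^-1 * (2 * pi * n%:R) * (strand t).1).
Proof.
rewrite /velocity /braid_curve; congr (_, _, _).
- exact: derive1_cis_cos.
- rewrite -[RHS]mul1r mulrA -derive1_cis_sin; congr (derive1 _ _).
  by apply/funext => u; rewrite mul1r.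
- exact: derive1_cis_sin.
Qed.

Lemma pi_neq0 : (pi : R) != 0.
Proof. by rewrite gt_eqF ?pi_gt0. Qed.

(** At a double point the velocities have the same angular component and opposite
    nonzero vertical components.  A third strand through the point would share its
    cosine with one of the two. *)
Lemma braid_is_diagram : finite_set (crossings braid_diagram) ->
  is_link_diagram braid_diagram.
Proof.
have per t : cis (3 * (t + 1)) = cis (3 * t) /\ strand (t + 1) = strand t.
  by have [-> ->] := @same_mod1_strand t (t + 1) (ex_intro _ 1 erefl).
move=> fin; split=> //=.
- by move=> _ t; apply/curve_eq; have [-> ->] := per t.
- by move=> _ t; rewrite !braid_height_alg; have [_ ->] := per t.
- move=> _ t; split; first exact: cis_circle.
  rewrite /= in_itv /= -ltr_norml normrM ger0_norm // ltr_pdivrMl //.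
  by rewrite mulr1 (le_lt_trans (sin_max _)) // ltr1n.
- move=> _; split.
  + rewrite (_ : (fun t => _) = (fun t => (cis (3 * t)).1)) // cis_cos_harmonic.
    exact: smooth_harmonic.
  + rewrite (_ : (fun t => _) = (fun t => 1 * (cis (3 * t)).2)); last first.
      by apply/funext => t; rewrite mul1r.
    by rewrite cis_sin_harmonic; exact: smooth_harmonic.
  + rewrite (_ : (fun t => _) = (fun t => 2^-1 * (strand t).2)) //.
    by rewrite cis_sin_harmonic; exact: smooth_harmonic.
- move=> _ t; rewrite velocityE => -[h1 h2 _].
  have p0 := pi_neq0.
  have c30 : 2 * pi * 3 != 0 :> R by rewrite !mulf_neq0 // pnatr_eq0.
  have := cis_circle (3 * t); rewrite /circle /mkset.
  have -> : (cis (3 * t)).2 = 0.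
    by apply: (mulfI c30); rewrite mulr0 -[RHS]oppr0 -h1 mulNr opprK.
  have -> : (cis (3 * t)).1 = 0 by apply: (mulfI c30); rewrite mulr0 -[RHS]h2.
  by rewrite expr0n addr0 => /eqP; rewrite eq_sym oner_eq0.
- move=> i j s t dp a b; have [h3 h2 h1 hc hs] := crossing_alg dp.
  rewrite !velocityE h1 h3 => -[e1 e2 e3].
  have p0 := pi_neq0.
  have c30 : 2 * pi * 3 != 0 :> R by rewrite !mulf_neq0 // pnatr_eq0.
  have cn0 : 2^-1 * (2 * pi * n%:R) != 0 :> R.
    by rewrite !mulf_neq0 ?invr_eq0 ?pnatr_eq0 // /n addn2.
  have c0 : (strand s).1 != 0 by apply/eqP => c0; move: hc; rewrite c0; lra.
  have ab : a - b = 0.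
    apply: (mulfI cn0); apply: (mulfI c0); rewrite !mulr0 -[RHS]e3.
    by rewrite /GRing.scale /=; ring.
  have s1 : (a + b) * (cis (3 * t)).2 = 0.
    apply: (mulfI c30); rewrite mulr0 -[RHS]oppr0 -e1 /GRing.scale /=; ring.
  have s2 : (a + b) * (cis (3 * t)).1 = 0.
    apply: (mulfI c30); rewrite mulr0 -[RHS]e2 /GRing.scale /=; ring.
  have ab2 : a + b = 0.
    rewrite -[LHS]mulr1 -(cis_circle (3 * t)) !expr2 mulrDr !mulrA s1 s2.
    by rewrite !mul0r addr0.
  by split; lra.
- move=> i j l s t u dp /curve_eq[g3 g2]; have [h3 h2 h1 hc hs] := crossing_alg dp.
  have : (strand u).1 ^+ 2 == (strand s).1 ^+ 2.
    have := cis_circle (n%:R * s); have := cis_circle (n%:R * u).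
    by rewrite /circle /mkset g2 => ht hs'; apply/eqP; lra.
  rewrite eqf_sqr => /orP[/eqP e|/eqP e]; [left|right]; apply/same_paramE.
    by apply: same_mod1_3n => //; rewrite [LHS]surjective_pairing e g2 -surjective_pairing.
  apply: same_mod1_3n; first by rewrite g3.
  by rewrite [LHS]surjective_pairing e g2 -h1 -h2 -surjective_pairing.
- move=> i j s t /over_under_alg[-> h0].
  by rewrite oppr_gt0 -leNgt le_eqVlt eq_sym (negPf h0).
Qed.

Lemma braid_height_diagram : diagram_height (D := braid_diagram) (fun _ => braid_height n).
Proof.
split=> /=.
- move=> _ t; rewrite !braid_height_alg.
  by have [_ ->] := @same_mod1_strand t (t + 1) (ex_intro _ 1 erefl).
- move=> _ t; rewrite -ltr_norml /braid_height normrM ger0_norm // ltr_pdivrMl //.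
  by rewrite mulr1 (le_lt_trans (sin_max _)) // ltr1n.
- move=> _; rewrite (_ : braid_height n = fun t => 4^-1 * (cis (2 * n%:R * t)).2).
    by rewrite cis_sin_harmonic; exact: smooth_harmonic.
  by apply/funext => t; rewrite /braid_height mulrA.
- move=> i s j t /over_under_alg[-> _] h.
  by rewrite (lt_trans _ h) // oppr_lt0.
Qed.

(** In terms of the angle [2 n t], the crossings are at 1/6, where the strand passes
    over, and at -1/6, where it passes under.  Two crossings with the same sign are
    at least a full turn apart, and a crossing of the other sign lies in between. *)
Lemma braid_alternating : alternating_diagram braid_diagram.
Proof.
move=> i s t st /crossing_paramE hs /crossing_paramE ht noc.
rewrite /= => same.
have n0 : 0 < n%:R :> R by rewrite ltr0n /n addn2.
have dbl (x : R) : (cis (2 * (n%:R * x))) =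
    ((strand x).1 ^+ 2 - (strand x).2 ^+ 2, 2 * (strand x).1 * (strand x).2).
  have -> : 2 * (n%:R * x) = n%:R * x + n%:R * x by ring.
  by rewrite cisD /cmul; congr (_, _); ring.
have cr (x : R) : (strand x).2 ^+ 2 = 4^-1 -> (cis (2 * (n%:R * x))).1 = 2^-1.
  rewrite dbl; have := cis_circle (n%:R * x); case: (cis _) => a b.
  by rewrite /circle /= => c h; lra.
have rc (x : R) : (cis (2 * (n%:R * x))).1 = 2^-1 -> (strand x).2 ^+ 2 = 4^-1.
  rewrite dbl; have := cis_circle (n%:R * x); case: (cis _) => a b.
  by rewrite /circle /= => c h; lra.
have s2 := cr s hs; have t2 := cr t ht.
have hh (x : R) : braid_height n x = 4^-1 * (cis (2 * (n%:R * x))).2 by [].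
have q0 (x : R) : 0 < braid_height n x = (0 < (cis (2 * (n%:R * x))).2).
  by rewrite hh pmulr_rgt0.
have eqst : cis (2 * (n%:R * s)) = cis (2 * (n%:R * t)).
  have := cis_circle (2 * (n%:R * s)); have := cis_circle (2 * (n%:R * t)).
  move: same; rewrite !q0.
  rewrite [cis (2 * (n%:R * s))]surjective_pairing [cis (2 * (n%:R * t))]surjective_pairing.
  rewrite s2 t2 /circle /mkset /=.
  set y := sin _; set z := sin _ => yz hz hy.
  have : z ^+ 2 == y ^+ 2 by apply/eqP; lra.
  rewrite eqf_sqr => /orP[/eqP -> //|/eqP e].
  move: yz hy; rewrite e oppr_gt0; case: (ltgtP y 0) => // ->.
  by rewrite expr0n /= => _ h; exfalso; lra.
have [m hm] := (cis_eq _ _).1 eqst.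
have m1 : 1 <= m%:~R :> R.
  have : 0 < (m%:~R : R) by nra.
  by rewrite (_ : 1 = 1%:~R :> R) // (_ : 0 = 0%:~R :> R) // ltr_int ler_int; lia.
have [r r2 [c1 c2]] := @cis_third R.
have y2 : (cis (2 * (n%:R * s))).2 ^+ 2 = r ^+ 2.
  have := cis_circle (2 * (n%:R * s)); rewrite /circle /mkset s2 r2 => h; lra.
(* Two thirds of a turn from the angle 1/6, or a third from -1/6, lead to the
   other of these angles, which is that of a crossing with the other sign. *)
have [d d01 hd] : exists2 d : R, 0 < d < 1 & (cis (2 * (n%:R * s) + d)).1 = 2^-1.
  move: y2 => /eqP; rewrite eqf_sqr => /orP[/eqP e|/eqP e].
  - exists (2 / 3); first by apply/andP; split; lra.
    by move: s2 e; rewrite cisD c2; case: (cis _) => a b /= -> ->; lra.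
  - exists 3^-1; first by apply/andP; split; lra.
    by move: s2 e; rewrite cisD c1; case: (cis _) => a b /= -> ->; lra.
pose u := s + d / (2 * n%:R).
have un : 2 * (n%:R * u) = 2 * (n%:R * s) + d by rewrite /u; field; rewrite gt_eqF.
move: d01 => /andP[d0 d1].
apply: (noc u); last by apply/crossing_paramE/rc; rewrite un.
by apply/andP; split; nra.
Qed.

End Diagram.

(** * The crossings and the equation of the diagram *)
Section Count.
Context {R : realType} (k : nat).
Implicit Types (s t u : R).
Let n := (3 * k + 2)%N.

Lemma n_gt0 : 0 < n%:R :> R.
Proof. by rewrite ltr0n /n addn2. Qed.

Definition node (m : nat) : R := (2 * m%:R + 1) / (4 * n%:R).

Definition crossing_pt (m : nat) : R * R * R :=
  (cis (node m), 4^-1 * (cis (n%:R * node m)).2).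

Lemma node_mul m : node m * (4 * n%:R) = 2 * m%:R + 1.
Proof. by rewrite /node divfK // mulf_neq0 // gt_eqF // n_gt0. Qed.

Lemma node_n m : n%:R * node m = m%:R / 2 + 4^-1.
Proof. by rewrite /node; field; rewrite gt_eqF // n_gt0. Qed.

Lemma cos_eq0 x : (cis x).1 = 0 -> exists m : int, 2 * x + 2^-1 = m%:~R :> R.
Proof.
move=> x0; apply: cis_eq1.
have -> : 2 * x + 2^-1 = x + x + 2^-1 by ring.
have := cis_circle x; rewrite !cisD cis_half; move: x0.
case: (cis x) => a b; rewrite /circle /cmul /= => -> h.
by congr (_, _); [lra|ring].
Qed.

Lemma crossing_height s : (cis (n%:R * s)).2 ^+ 2 = 4^-1 ->
  2^-1 * (cis (n%:R * s)).2 = 4^-1 * (cis (n%:R * (3 * s))).2.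
Proof.
move=> h; have -> : n%:R * (3 * s) = 3 * (n%:R * s) by ring.
rewrite cis3 [in RHS]/=; set a := sin _.
have ha : a ^+ 2 = 4^-1 by exact: h.
have -> : (cis (n%:R * s)).2 = a by [].
have -> : a ^+ 3 = a * a ^+ 2 by rewrite exprS.
by rewrite ha; field.
Qed.

(** If [3 a] is an odd multiple of a quarter of a turn, the cosine of [a] is 0 or
    has square 3/4; in the first case, a rotation by a third leads to the second. *)
Lemma crossing_over (x : R) : (cis (n%:R * x)).1 = 0 ->
  exists s, cis (3 * s) = cis x /\ (cis (n%:R * s)).2 ^+ 2 = 4^-1.
Proof.
move=> x0; set a := cis (n%:R * (x / 3)).
have ca : circle R a by exact: cis_circle.
have a1 : 4 * a.1 ^+ 3 - 3 * a.1 = 0.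
  rewrite -[RHS]x0 (_ : n%:R * x = 3 * (n%:R * (x / 3))); last by field.
  by rewrite cis3.
have x3 : 3 * (x / 3) = x by field.
have : a.1 * (a.1 ^+ 2 - 3 / 4) = 0.
  by transitivity (4^-1 * (4 * a.1 ^+ 3 - 3 * a.1)); [field|rewrite a1 mulr0].
move=> /eqP; rewrite mulf_eq0 => /orP[/eqP a10|/eqP a13].
- have [h3 hn] := @shift_third R k (x / 3).
  exists (x / 3 + 3^-1); rewrite h3 x3; split=> //.
  rewrite hn -/n -/a; have [r r2 [_ ->]] := @cis_third R.
  move: ca a10; case: a {a1} => a1 a2; rewrite /circle /= => ca a10.
  rewrite /cmul /= a10 mul0r addr0 exprMn sqrrN.
  by move: ca; rewrite a10 expr0n /= add0r => ->; field.
- exists (x / 3); rewrite x3; split=> //.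
  by move: ca; rewrite /circle /mkset -/a => ca; lra.
Qed.

(** The crossings lie over the [2 n] angles whose [n]-fold multiple has zero cosine,
    and the height [w / 2] at such a crossing is determined by the angle, since
    [sin (3 a) = 2 sin a] when [sin a ^ 2 = 1/4]. *)
Lemma crossingsE : crossings (@braid_diagram R k) = crossing_pt @` `I_(2 * n).
Proof.
have n0 := n_gt0.
apply/seteqP; split=> c.
- move=> [i [s [j [t [dp ->]]]]].
  have [_ _ _ _ h] := crossing_alg dp.
  have : (cis (n%:R * (3 * s))).1 = 0.
    have -> : n%:R * (3 * s) = 3 * (n%:R * s) by ring.
    have := cis_circle (n%:R * s); rewrite cis3; move: h; rewrite -/n.
    case: (cis (n%:R * s)) => a b; rewrite /circle /= => hb hc.
    transitivity (a * (4 * a ^+ 2 - 3)); first by ring.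
    by rewrite (_ : 4 * a ^+ 2 - 3 = 0) ?mulr0 //; lra.
  move=> /cos_eq0[p hp].
  pose N : int := (2 * n)%N%:Z.
  have N0 : N != 0 by rewrite /N /n; lia.
  pose m := `|((p - 1) %% N)%Z|%N.
  have mE : m%:Z = ((p - 1) %% N)%Z by rewrite /m gez0_abs // modz_ge0.
  have mlt : (m < 2 * n)%N.
    have : ((p - 1) %% N)%Z < `|N| by exact: ltz_mod.
    by rewrite -mE /N; lia.
  exists m => //.
  have e3 : cis (node m) = cis (3 * s).
    apply/cis_eq; exists ((p - 1) %/ N)%Z.
    have := congr1 (fun z : int => z%:~R : R) (divz_eq (p - 1) N).
    rewrite -mE rmorphB rmorphD rmorphM /=.
    have -> : (N%:~R : R) = 2 * n%:R by rewrite /N -[LHS]/((2 * n)%:R) natrM.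
    rewrite -[(m%:Z)%:~R]/(m%:R) => hq.
    apply: (mulfI (x := 4 * n%:R)); first by rewrite mulf_neq0 // gt_eqF.
    rewrite mulrDr (mulrC _ (node m)) node_mul.
    by lra.
  rewrite /crossing_pt (cis_natmul n) e3 -(cis_natmul n) -crossing_height //.
- move=> [m _ <-]; have : (cis (n%:R * node m)).1 = 0.
    have : cis (2 * (n%:R * node m)) = (-1, 0).
      rewrite node_n (_ : 2 * (m%:R / 2 + 4^-1) = 2^-1 + m%:R); last by field.
      by rewrite cis_nat cis_half.
    rewrite (_ : 2 * (n%:R * node m) = n%:R * node m + n%:R * node m); last by ring.
    have := cis_circle (n%:R * node m); rewrite cisD.
    case: (cis _) => a b; rewrite /circle /cmul /= => h [h1 _].
    have : a ^+ 2 = 0 by lra.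
    by move/eqP; rewrite expf_eq0 /= => /eqP.
  move=> /crossing_over[s [h3 hs]].
  have [t dp] := crossing_double hs.
  exists ord0, s, ord0, t; split=> //=.
  by rewrite /braid_curve /crossing_pt -/n crossing_height // !(cis_natmul n) h3.
Qed.

Lemma crossings_card : (crossings (@braid_diagram R k) #= `I_(2 * n))%card.
Proof.
have n0 := n_gt0.
rewrite crossingsE; apply: inj_card_eq => m m'; rewrite !inE /= => hm hm'.
move=> [h1 h2 _]; have : cis (node m) = cis (node m') by rewrite /cis h1 h2.
move=> /cis_eq[p] /(congr1 (fun z => z * (4 * n%:R))).
rewrite (mulrDl (node m)) (node_mul m) (node_mul m') => e.
have : (m'%:Z - m%:Z)%:~R = (p * (2 * n)%N%:Z)%:~R :> R.
  rewrite rmorphB rmorphM /= -[(m'%:Z)%:~R]/(m'%:R) -[(m%:Z)%:~R]/(m%:R).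
  by rewrite -[((2 * n)%N%:Z)%:~R]/((2 * n)%:R) natrM; lra.
move: hm hm'; move: (2 * n)%N => N hm hm' /intr_inj e2.
have [p0|p0|p0] := ltgtP p 0; last by rewrite p0 in e2; lia.
- have : p * N%:Z <= - N%:Z by nia.
  lia.
- have : N%:Z <= p * N%:Z by nia.
  lia.
Qed.

Lemma crossings_finite : finite_set (crossings (@braid_diagram R k)).
Proof. by exists (2 * n)%N; exact: crossings_card. Qed.

(** With [w = 2 z.2], the triple angle formula makes the strands over [e] the roots
    of [4 w^3 - 3 w + Im (e ^ n)]. *)
Definition braid_eqn (z : R * R * R) : R :=
  4 * (2 * z.2) ^+ 3 - 3 * (2 * z.2) + (cpow z.1 n).2.

Lemma braid_eqn_curve t : braid_eqn (braid_curve n t) = 0.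
Proof.
rewrite /braid_eqn /braid_curve -(cis_natmul n).
rewrite (_ : n%:R * (3 * t) = 3 * (n%:R * t)); last by ring.
by rewrite (cis3 (n%:R * t)); case: (cis (n%:R * t)) => a b /=; field.
Qed.

Lemma braid_eqn_support (z : R * R * R) : circle R z.1 -> braid_eqn z = 0 ->
  exists t, z = braid_curve n t.
Proof.
case: z => e y /= /cis_surj[x ->]; rewrite /braid_eqn /= -cis_natmul.
set a := cis (n%:R * (x / 3)); set w := 2 * y.
have ca : circle R a by exact: cis_circle.
have -> : n%:R * x = 3 * (n%:R * (x / 3)) by field.
rewrite cis3 -/a => /= h.
have x3 : 3 * (x / 3) = x by field.
have done1 s : cis (3 * s) = cis x -> (cis (n%:R * s)).2 = w ->
    exists t, (cis x, y) = braid_curve n t.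
  by move=> h3 hw; exists s; rewrite /braid_curve h3 hw /w; congr (_, _); field.
have [r r2 [c1 c2]] := @cis_third R.
have : (w - a.2) * ((w + 2^-1 * a.2) ^+ 2 - (r * a.1) ^+ 2) = 0.
  rewrite exprMn r2 (_ : a.1 ^+ 2 = 1 - a.2 ^+ 2); last first.
    by move: ca; rewrite /circle /mkset => ca; lra.
  by transitivity (4^-1 * (4 * w ^+ 3 - 3 * w + (3 * a.2 - 4 * a.2 ^+ 3)));
    [field|rewrite h mulr0].
move=> /eqP; rewrite mulf_eq0 subr_eq0 => /orP[/eqP wa|].
  by apply: (done1 (x / 3)); rewrite ?x3 -/a ?wa.
rewrite subr_eq0 eqf_sqr => /orP[/eqP e1|/eqP e1].
- have [h3 hn] := @shift_two_thirds R k (x / 3).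
  apply: (done1 (x / 3 + 2 / 3)); first by rewrite h3 x3.
  rewrite hn -/n -/a c1; move: e1; case: (a) => a1 a2 /= e1; rewrite /cmul /=; lra.
- have [h3 hn] := @shift_third R k (x / 3).
  apply: (done1 (x / 3 + 3^-1)); first by rewrite h3 x3.
  rewrite hn -/n -/a c2; move: e1; case: (a) => a1 a2 /= e1; rewrite /cmul /=; lra.
Qed.

Lemma braid_supportE (z : R * R * R) : circle R z.1 ->
  (diagram_support (@braid_diagram R k) z <-> braid_eqn z = 0).
Proof.
move=> cz; split=> [[i [t ->]]|/braid_eqn_support[//|t ->]].
  exact: braid_eqn_curve.
by exists ord0, t.
Qed.

End Count.

(** * Connected sets and opposite quadrants *)
Section Connectedness.
Context {R : realType}.

(** A union of paths that start from [x]. *)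
Lemma star_connected {T : topologicalType} (A : set T) (x : T) :
  (forall y, A y -> exists g : R -> T, [/\ {within `[0, 1], continuous g},
     forall t, 0 <= t <= 1 -> A (g t), g 0 = x & g 1 = y]) ->
  connected A.
Proof.
move=> star.
pose path_ y (g : R -> T) := [/\ {within `[0, 1], continuous g},
     forall t, 0 <= t <= 1 -> A (g t), g 0 = x & g 1 = y].
pose I : set (R -> T) := [set g | exists y, path_ y g].
have -> : A = \bigcup_(g in I) g @` `[0, 1].
  apply/seteqP; split=> y.
    move=> /star[g pg]; exists g; first by exists y.
    by case: pg => _ _ _ g1; exists 1 => //=; rewrite in_itv /= ler01 lexx.
  move=> [g [z [_ gA _ _]] [t]]; rewrite /= in_itv /= => t01 <-; exact: gA.
apply: bigcup_connected.
  exists x => g [z [_ _ g0 _]]; exists 0 => //=.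
  by rewrite in_itv /= ler01 lexx.
move=> g [z [cg _ _ _]]; apply: connected_continuous_connected => //.
exact: segment_connected.
Qed.

Lemma connected_pos {T : topologicalType} (A : set T) (f : T -> R) x y :
  connected A -> continuous f -> (forall z, A z -> f z <> 0) ->
  A x -> A y -> 0 < f x -> 0 < f y.
Proof.
move=> cA cf f0 Ax Ay fx; rewrite ltNge; apply/negP => fy.
have : connected (f @` A).
  by apply: connected_continuous_connected => //; exact: continuous_subspaceT.
move=> /connected_intervalP /(_ (f y) (f x) (ex_intro2 _ _ y Ay erefl)
  (ex_intro2 _ _ x Ax erefl) 0).
by rewrite fy (ltW fx) => /(_ isT)[z Az fz]; exact: (f0 z).
Qed.

Lemma ge0_endpoint (g : R -> R) (b : R) : 0 < b ->
  {within `[0, b], continuous g} -> (forall t, 0 < t <= b -> 0 < g t) -> 0 <= g 0.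
Proof.
move=> b0 cg gpos; rewrite leNgt; apply/negP => g0.
have gb : 0 < g b by apply: gpos; rewrite b0 lexx.
have [c] : exists2 c, c \in `[0, b] & g c = 0.
  apply: IVT => //; first exact: ltW.
  by rewrite ge_min le_max (ltW g0) (ltW gb) orbT.
rewrite in_itv /= le_eqVlt => /andP[/orP[/eqP <- _ gc|c0 cb gc]].
  by rewrite gc ltxx in g0.
by have := gpos c; rewrite c0 cb gc ltxx => /(_ isT).
Qed.

Lemma quadrantE (a b : bool) (p : R * R) : quadrant a b p <->
  [/\ `|p.1| < 1, `|p.2| < 1, 0 < (-1) ^+ a * p.1 & 0 < (-1) ^+ b * p.2].
Proof.
rewrite /quadrant /open_square /= !in_itv /= -!ltr_norml.
by split=> [[[? ?] [? ?]]|[? ? ? ?]].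
Qed.

Lemma open_squareE (p : R * R) : open_square R p <-> `|p.1| < 1 /\ `|p.2| < 1.
Proof. by rewrite /open_square /= !in_itv /= -!ltr_norml. Qed.

Lemma convex_lt (c x y t : R) : c < x -> c < y -> 0 <= t <= 1 ->
  c < x + t * (y - x).
Proof.
move=> cx cy /andP[t0 t1]; have [->|tn0] := eqVneq t 0; first by rewrite mul0r addr0.
have tp : 0 < t by rewrite lt_neqAle eq_sym tn0.
by nra.
Qed.

Lemma convex_norm_lt (c x y t : R) : `|x| < c -> `|y| < c -> 0 <= t <= 1 ->
  `|x + t * (y - x)| < c.
Proof.
move=> /ltr_normlP[x1 x2] /ltr_normlP[y1 y2] t01; apply/ltr_normlP; split.
  by have := @convex_lt (- c) x y t; lra.
by have := @convex_lt (- c) (- x) (- y) t; lra.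
Qed.

Lemma quadrant_convex (a b : bool) (p q : R * R) (t : R) :
  quadrant a b p -> quadrant a b q -> 0 <= t <= 1 ->
  quadrant a b (p.1 + t * (q.1 - p.1), p.2 + t * (q.2 - p.2)).
Proof.
move=> /quadrantE[p1 p2 p3 p4] /quadrantE[q1 q2 q3 q4] t01.
apply/quadrantE; split=> /=; [exact: convex_norm_lt|exact: convex_norm_lt|..].
  rewrite mulrDr mulrCA mulrBr; exact: convex_lt.
rewrite mulrDr mulrCA mulrBr; exact: convex_lt.
Qed.

Lemma quadrant_image_connected {T : topologicalType} (psi : R * R -> T) a b :
  {within open_square R, continuous psi} -> connected (psi @` quadrant a b).
Proof.
move=> cpsi; have [[p Qp]|] := pselect (@quadrant R a b !=set0); last first.
  by move=> /nonemptyPn ->; rewrite image_set0; exact: connected0.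
apply: (star_connected (x := psi p)) => _ [q Qq <-].
exists (fun t => psi (p.1 + t * (q.1 - p.1), p.2 + t * (q.2 - p.2))).
split.
- have sq : set_fun `[0, 1] (open_square R)
      (fun t : R => (p.1 + t * (q.1 - p.1), p.2 + t * (q.2 - p.2))).
    move=> t; rewrite /= in_itv /= => t01.
    by have [] := quadrant_convex Qp Qq t01.
  apply: (within_comp sq _ cpsi).
  by apply: continuous_subspaceT => t; cont.
- by move=> t t01; exists (p.1 + t * (q.1 - p.1), p.2 + t * (q.2 - p.2)) => //;
    exact: quadrant_convex.
- by congr psi; rewrite !mul0r !addr0 -surjective_pairing.
- by congr psi; rewrite !mul1r !(addrC _ (_ - _)) !subrK -surjective_pairing.
Qed.

(** Each point of the axes is in the closure of one of the two opposite quadrants,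
    where [G] is positive. *)
Lemma axis_limit {T : topologicalType} (psi : R * R -> T) (G : T -> R)
    (a b : bool) (q : R * R) :
  {within open_square R, continuous psi} -> continuous G ->
  (forall p, quadrant a b p \/ quadrant (~~ a) (~~ b) p -> 0 < G (psi p)) ->
  open_square R q -> q.1 = 0 \/ q.2 = 0 -> 0 <= G (psi q).
Proof.
move=> cpsi cG Gpos /open_squareE[q1 q2] axis.
have [a' [b' [Gpos' qa qb]]] : exists a' b', [/\
    forall p, quadrant a' b' p -> 0 < G (psi p),
    0 <= (-1) ^+ a' * q.1 & 0 <= (-1) ^+ b' * q.2].
  have sgn (c : bool) (x : R) : (-1) ^+ (~~ c) * x = - ((-1) ^+ c * x).
    by case: c; rewrite /= ?expr0 ?expr1; ring.
  case: axis => h; rewrite h.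
  - have [hb|hb] := leP 0 ((-1) ^+ b * q.2).
      by exists a, b; rewrite mulr0; split=> // p Qp; apply: Gpos; left.
    exists (~~ a), (~~ b); rewrite !sgn mulr0 oppr0 oppr_ge0 (ltW hb).
    by split=> // p Qp; apply: Gpos; right.
  - have [hb|hb] := leP 0 ((-1) ^+ a * q.1).
      by exists a, b; rewrite mulr0; split=> // p Qp; apply: Gpos; left.
    exists (~~ a), (~~ b); rewrite !sgn mulr0 oppr0 oppr_ge0 (ltW hb).
    by split=> // p Qp; apply: Gpos; right.
pose ea : R := (-1) ^+ a'; pose eb : R := (-1) ^+ b'.
have eae : ea * ea = 1 by rewrite /ea; case: (a'); rewrite ?expr0 ?expr1; ring.
have ebe : eb * eb = 1 by rewrite /eb; case: (b'); rewrite ?expr0 ?expr1; ring.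
have nea : `|ea| = 1 by rewrite normrX normrN1 expr1n.
have neb : `|eb| = 1 by rewrite normrX normrN1 expr1n.
pose d := Num.min (1 - `|q.1|) (1 - `|q.2|) / 2.
have m0 : 0 < Num.min (1 - `|q.1|) (1 - `|q.2|) by rewrite lt_min !subr_gt0 q1 q2.
have d0 : 0 < d by rewrite divr_gt0.
have d1 : d < 1 - `|q.1|.
  have := ge_min (1 - `|q.1|) (1 - `|q.1|) (1 - `|q.2|); rewrite lexx /= /d => h; lra.
have d2 : d < 1 - `|q.2|.
  have := ge_min (1 - `|q.2|) (1 - `|q.1|) (1 - `|q.2|); rewrite lexx orbT /= /d => h; lra.
pose pt (t : R) := (q.1 + t * ea, q.2 + t * eb).
have nt (x e t : R) : `|e| = 1 -> 0 <= t <= d -> d < 1 - `|x| -> `|x + t * e| < 1.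
  move=> ne /andP[t0 td] dx; apply: le_lt_trans (ler_normD _ _) _.
  by rewrite normrM ne mulr1 (ger0_norm t0); lra.
have sq t : 0 <= t <= d -> open_square R (pt t).
  by move=> td; apply/open_squareE; split; exact: nt.
have -> : psi q = psi (pt 0) by rewrite /pt !mul0r !addr0 -surjective_pairing.
apply: (@ge0_endpoint (fun t => G (psi (pt t))) d) => //.
- have sq' : set_fun `[0, d] (open_square R) pt.
    by move=> t; rewrite /= in_itv /=; exact: sq.
  have cpt : {within `[0, d], continuous pt}.
    by apply: continuous_subspaceT => t; rewrite /pt; cont.
  have sT : set_fun `[0, d] [set: T] (fun t => psi (pt t)) by [].
  apply: (within_comp sT (within_comp sq' cpt cpsi)).
  exact: continuous_subspaceT.
- move=> t /andP[t0 td]; apply: Gpos'; apply/quadrantE.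
  have /open_squareE[? ?] : open_square R (pt t) by apply: sq; rewrite ltW.
  split=> //=; rewrite mulrDr mulrCA.
    by rewrite -/ea eae mulr1 ltr_wpDl.
  by rewrite -/eb ebe mulr1 ltr_wpDl.
Qed.

End Connectedness.

(** * Simplicity of the diagrams *)
Section Simplicity.
Context {R : realType} (k : nat).
Implicit Types (s t u x : R) (z : R * R * R).
Let n := (3 * k + 2)%N.
Local Notation D := (@braid_diagram R k).

Lemma cat_braid_eqn z : continuous_at z (@braid_eqn R k).
Proof. by rewrite /braid_eqn; cont; apply: cat_cpow; cont. Qed.

Definition off_diagram z : Prop := annulus R z /\ ~ diagram_support D z.

Lemma braid_eqn_off z : off_diagram z -> braid_eqn k z <> 0.
Proof. by case=> -[cz _] nD h; apply: nD; exact: ((braid_supportE k cz).2 h). Qed.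

Lemma pow_sin_bound z : annulus R z -> -1 <= (cpow z.1 n).2 <= 1.
Proof.
move=> [cz _]; have := circle_pow n cz; rewrite /circle /mkset.
by case: (cpow _ _) => a b /= h; apply/andP; split; nra.
Qed.

(** The sign [eps] selects one of the two boundary circles.  On [A] the polynomial
    [eps * braid_eqn] stays positive, whereas it is at most 0 where
    [eps * w = 1/2], for [w] twice the height; so [eps * w] remains above 1/2. *)
Lemma outer_face (eps : R) (A : set (R * R * R)) z z' : eps = 1 \/ eps = -1 ->
  connected A -> A `<=` off_diagram -> A z -> A z' -> z.2 = eps ->
  2^-1 < eps * (2 * z'.2).
Proof.
move=> heps cA offA Az Az' zE.
have ee : eps * eps = 1 by case: heps => ->; ring.
have e3 x : eps * (4 * x ^+ 3 - 3 * x) = 4 * (eps * x) ^+ 3 - 3 * (eps * x).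
  transitivity (eps * eps * (4 * eps * x ^+ 3) - 3 * (eps * x)); last by ring.
  by rewrite ee; ring.
have bnd v : annulus R v -> -1 <= eps * (cpow v.1 n).2 <= 1.
  by move=> /pow_sin_bound; case: heps => ->; rewrite ?mul1r // mulN1r => /andP[? ?];
    apply/andP; split; lra.
have Ppos v : A v -> 0 < eps * braid_eqn k v.
  move=> Av; apply: (connected_pos (x := z) (f := fun v => eps * braid_eqn k v) cA _ _ Az Av).
  - by move=> y; cont; exact: cat_braid_eqn.
  - move=> y /offA/braid_eqn_off hy /eqP; rewrite mulf_eq0 => /orP[/eqP e0|/eqP//].
    by move: ee; rewrite e0 mul0r => /eqP; rewrite eq_sym oner_eq0.
  - have /andP[b1 b2] := bnd z (offA _ Az).1.
    rewrite /braid_eqn mulrDr e3 zE (_ : eps * (2 * eps) = 2); last by rewrite mulrCA ee mulr1.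
    by rewrite -/n; lra.
rewrite -subr_gt0; apply: (connected_pos (x := z) (f := fun z => eps * (2 * z.2) - 2^-1) cA _ _ Az Az').
- by move=> y; cont.
- move=> v Av hv; have := Ppos v Av; rewrite /braid_eqn mulrDr e3.
  have -> : eps * (2 * v.2) = 2^-1 by lra.
  have /andP[b1 b2] := bnd v (offA _ Av).1.
  by rewrite -/n; lra.
- by rewrite zE (_ : eps * (2 * eps) = 2); [lra|rewrite mulrCA ee mulr1].
Qed.

Lemma arc_limit (eps : R) (g : R -> R * R * R) : eps = 1 \/ eps = -1 ->
  {within `[0, 1], continuous g} -> (g 1).2 = eps ->
  (forall t, 0 < t <= 1 -> off_diagram (g t)) ->
  2^-1 <= eps * (2 * (g 0).2).
Proof.
move=> heps cg g1 offg; rewrite -subr_ge0.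
apply: (@ge0_endpoint R (fun t => eps * (2 * (g t).2) - 2^-1) 1) => //.
  have sT : set_fun `[0, 1] [set: R * R * R] g by [].
  apply: (within_comp sT cg (g := fun z => eps * (2 * z.2) - 2^-1)).
  by apply: continuous_subspaceT => z; cont.
move=> t t01; rewrite subr_gt0.
apply: (@outer_face eps (g @` `]0, 1]) (g 1) (g t)) => //.
- apply: connected_continuous_connected.
    exact/connected_intervalP/interval_is_interval.
  apply: continuous_subspaceW cg => u; rewrite /= !in_itv /= => /andP[u0 u1].
  by rewrite (ltW u0).
- by move=> _ [u u01 <-]; apply: offg; move: u01; rewrite /= in_itv.
- by exists 1 => //=; rewrite in_itv /= ltr01 lexx.
Qed.

(** On the way from the lower boundary to [c], the arc stays in the lower outer face,
    so that [w <= -1/2] at [c]; from [c] to the upper boundary it stays in the upper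
    outer face, so that [w >= 1/2] at [c]. *)
Lemma braid_not_typeII c : ~ typeII D c.
Proof.
move=> [al [t0 [hal [al0 al1 alo] [/andP[t00 t01] alc] off _]]].
have [_ cal _] := hal.
have al_ann t : 0 <= t <= 1 -> annulus R (al t).
  move=> /andP[]; rewrite le_eqVlt => /orP[/eqP <- _|t0'].
    by case: al0 => c0 /= e; split=> //=; rewrite in_itv /= e; apply/andP; split; lra.
  rewrite le_eqVlt => /orP[/eqP ->|t1'].
    by case: al1 => c0 /= e; split=> //=; rewrite in_itv /= e; apply/andP; split; lra.
  have [|c0 /=] := alo t; first by rewrite t0' t1'.
  by rewrite !in_itv /= => /andP[? ?]; split=> //=; rewrite in_itv /= !ltW.
have al_off t : 0 <= t <= 1 -> t <> t0 -> off_diagram (al t).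
  move=> tI tn; split; first exact: al_ann.
  move=> Dt; apply: tn; apply: (homeo_inj hal); rewrite /= ?in_itv //=.
    by rewrite (ltW t00) (ltW t01).
  by rewrite alc; exact: off.
have cont_al (a b : R) : (forall t, 0 <= t <= 1 -> 0 <= a + t * b <= 1) ->
    {within `[0, 1], continuous (fun t => al (a + t * b))}.
  move=> hab; have sI : set_fun `[0, 1] `[0, 1] (fun t => a + t * b).
    by move=> t; rewrite /= !in_itv /=; exact: hab.
  by apply: (within_comp sI _ cal); apply: continuous_subspaceT => t; cont.
have up : 2^-1 <= 1 * (2 * (al (t0 + 0 * (1 - t0))).2).
  apply: (@arc_limit 1 (fun t => al (t0 + t * (1 - t0)))); first by left.
  - by apply: cont_al => t /andP[? ?]; apply/andP; split; nra.
  - by rewrite mul1r addrC subrK; case: al1.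
  - by move=> t /andP[? ?]; apply: al_off; [apply/andP; split|]; nra.
have dn : 2^-1 <= -1 * (2 * (al (t0 + 0 * - t0)).2).
  apply: (@arc_limit (-1) (fun t => al (t0 + t * - t0))); first by right.
  - by apply: cont_al => t /andP[? ?]; apply/andP; split; nra.
  - by rewrite mul1r subrr; case: al0.
  - by move=> t /andP[? ?]; apply: al_off; [apply/andP; split|]; nra.
by move: up dn; rewrite !mul0r addr0; lra.
Qed.

(** The strand crosses the height of the crossing with nonzero slope. *)
Lemma near_node s (eps : R) : eps = 1 \/ eps = -1 -> (cis (n%:R * s)).2 = eps / 2 ->
  forall eta : R, 0 < eta ->
  (exists2 u, `|u - s| < eta & eps * (2 * (braid_curve n u).2) < 2^-1) /\
  (exists2 u, `|u - s| < eta & 2^-1 < eps * (2 * (braid_curve n u).2)).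
Proof.
move=> heps hs eta eta0; have n0 := @n_gt0 R k.
have ee : eps * eps = 1 by case: heps => ->; ring.
have hc : (cis (n%:R * s)).1 ^+ 2 = 3 / 4.
  have := cis_circle (n%:R * s); rewrite /circle /mkset hs exprMn (expr2 eps) ee => h; lra.
pose d := Num.min (eta / 2) (8^-1 / n%:R).
have m0 : 0 < d by rewrite lt_min !divr_gt0.
have deta : d < eta.
  have : d <= eta / 2 by rewrite /d ge_min lexx.
  by move=> h; lra.
have nd : 0 < n%:R * d < 4^-1.
  rewrite mulr_gt0 //=; have : d <= 8^-1 / n%:R by rewrite /d ge_min lexx orbT.
  by rewrite ler_pdivlMr // => h; lra.
have cy : 0 < (cis (n%:R * d)).1.
  by apply: cis_gt0; rewrite ger0_norm; case/andP: nd => ? ?; lra.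
have sy : 0 < (cis (n%:R * d)).2.
  by apply: cis_sin_gt0; case/andP: nd => ? ?; apply/andP; split; lra.
have wE (sg : R) : sg = 1 \/ sg = -1 ->
    eps * (2 * (braid_curve n (s + sg * d)).2) =
    2^-1 * (cis (n%:R * d)).1 + sg * (eps * (cis (n%:R * s)).1) * (cis (n%:R * d)).2.
  move=> hsg; rewrite /braid_curve.
  have -> : n%:R * (s + sg * d) = n%:R * s + sg * (n%:R * d) by ring.
  have -> : cis (n%:R * s + sg * (n%:R * d)) = cmul (cis (n%:R * s))
      ((cis (n%:R * d)).1, sg * (cis (n%:R * d)).2).
    rewrite cisD; congr cmul; case: hsg => ->; last by rewrite !mulN1r cisN.
    by rewrite !mul1r -surjective_pairing.
  move: hs; case: (cis (n%:R * s)) => a b /= ->; rewrite /cmul /=.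
  set C := cos _; set S := sin _.
  by transitivity (eps * eps / 2 * C + eps * sg * a * S); [field|rewrite ee; field].
have near_d (sg : R) : sg = 1 \/ sg = -1 -> `|s + sg * d - s| < eta.
  by move=> hsg; rewrite addrC addKr normrM (gtr0_norm m0);
    case: hsg => ->; rewrite ?normrN normr1 mul1r.
have := cis_circle (n%:R * d); rewrite /circle /mkset.
set C := (cis (n%:R * d)).1 in cy wE *; set S := (cis (n%:R * d)).2 in sy wE * => CS.
set kap := eps * (cis (n%:R * s)).1 in wE *.
have kap2 : kap ^+ 2 = 3 / 4 by rewrite exprMn hc expr2 ee mul1r.
have C1 : C < 1 by nra.
have CS1 : 1 < C + S by nra.
have [sg [hsg hk]] : exists sg : R, (sg = 1 \/ sg = -1) /\ 3 / 4 < sg * kap.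
  have [k0|k0] := leP 0 kap; [exists 1|exists (-1)]; split; try by auto.
    by rewrite mul1r; nra.
  by rewrite mulN1r; nra.
have hsgN : - sg = 1 \/ - sg = -1 by case: hsg => ->; [right|left; rewrite opprK].
split.
  exists (s + (- sg) * d); first exact: near_d.
  by rewrite wE // mulNr; nra.
exists (s + sg * d); first exact: near_d.
by rewrite wE //; nra.
Qed.

(** The sine of the angle from the base point of the crossing to [z]. *)
Definition turn_dev s z : R := (cmul (cconj (cis (3 * s))) z.1).2.

Lemma near_turn s (eta : R) : 0 < eta ->
  (exists2 u, `|u - s| < eta & turn_dev s (braid_curve n u) < 0) /\
  (exists2 u, `|u - s| < eta & 0 < turn_dev s (braid_curve n u)).
Proof.
move=> eta0.
pose d := Num.min (eta / 2) (8^-1).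
have m0 : 0 < d by rewrite lt_min; apply/andP; split; lra.
have deta : d < eta.
  have : d <= eta / 2 by rewrite /d ge_min lexx.
  by move=> h; lra.
have d8 : d <= 8^-1 by rewrite /d ge_min lexx orbT.
have pos : 0 < (cis (3 * d)).2.
  by apply: cis_sin_gt0; apply/andP; split; lra.
have tE (x : R) : turn_dev s (braid_curve n (s + x)) = (cis (3 * x)).2.
  by rewrite /turn_dev /braid_curve mulrDr cconj_mul_cis.
split; [exists (s - d)|exists (s + d)].
- by rewrite addrC addKr normrN gtr0_norm.
- by rewrite tE mulrN cisN /cconj /= oppr_lt0.
- by rewrite addrC addKr gtr0_norm.
- by rewrite tE.
Qed.

(** Here [A] stands for a connected set that accumulates on the diagram on all sides
    of the crossing, in the weak sense that functions positive on [A] are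
    nonnegative on the strand near the crossing.  Let [eps] be the sign of the height
    of the crossing, [w] twice the height and [P = eps * braid_eqn], of constant sign
    on [A].  If [P > 0], then [eps * w] is never 1/2 on [A], since that value entails
    [P <= 0]; so it is always less or always greater, but the strand goes through
    this height.  If
    [P < 0], then [eps * w > -1/2] on [A], and [P >= 0] in this range over the
    angle of the crossing and over the opposite angle, which have the same [n]-fold
    multiple because [n] is even; so [A] does not meet the fibres over them and stays
    on one side of the crossing, but the strand turns through it. *)
Lemma opposite_corners s (A : set (R * R * R)) : ~~ odd k ->
  (cis (n%:R * s)).2 ^+ 2 = 4^-1 ->
  connected A -> A !=set0 -> A `<=` off_diagram ->
  (forall G : R * R * R -> R, continuous G -> (forall z, A z -> 0 < G z) ->
    exists2 eta : R, 0 < eta & forall u, `|u - s| < eta -> 0 <= G (braid_curve n u)) ->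
  False.
Proof.
move=> ke hs2 cA [z0 Az0] offA lim.
have [eps heps hs] : exists2 eps : R, eps = 1 \/ eps = -1 &
    (cis (n%:R * s)).2 = eps / 2.
  have : (cis (n%:R * s)).2 ^+ 2 == (2^-1) ^+ 2.
    by rewrite hs2; apply/eqP; field.
  rewrite eqf_sqr => /orP[/eqP ->|/eqP ->]; [exists 1|exists (-1)]; auto.
    by rewrite mul1r.
  by rewrite mulN1r.
have ee : eps * eps = 1 by case: heps => ->; ring.
have en0 : eps != 0.
  by apply/eqP => e0; move: ee; rewrite e0 mul0r => /eqP; rewrite eq_sym oner_eq0.
have e3 x : eps * (4 * x ^+ 3 - 3 * x) = 4 * (eps * x) ^+ 3 - 3 * (eps * x).
  transitivity (eps * eps * (4 * eps * x ^+ 3) - 3 * (eps * x)); last by ring.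
  by rewrite ee; ring.
have bnd v : annulus R v -> -1 <= eps * (cpow v.1 n).2 <= 1.
  by move=> /pow_sin_bound; case: heps => ->; rewrite ?mul1r // mulN1r => /andP[? ?];
    apply/andP; split; lra.
have eqnE v : eps * braid_eqn k v = 4 * (eps * (2 * v.2)) ^+ 3 - 3 * (eps * (2 * v.2)) +
    eps * (cpow v.1 n).2 by rewrite /braid_eqn mulrDr e3.
have const_sign (f : R * R * R -> R) : continuous f -> (forall z, A z -> f z <> 0) ->
    (forall z, A z -> 0 < f z) \/ (forall z, A z -> 0 < - f z).
  move=> cf f0; have [h|h] := ltP 0 (f z0); [left|right] => z Az.
    exact: (connected_pos (x := z0) (f := f) cA cf f0).
  apply: (connected_pos (x := z0) (f := fun z => - f z) cA) => //.
  - by move=> y; cont; exact: cf.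
  - by move=> y Ay /eqP; rewrite oppr_eq0 => /eqP; exact: f0.
  - by rewrite oppr_gt0 lt_neqAle h andbT; apply/eqP; exact: f0.
have cP : continuous (fun v => eps * braid_eqn k v).
  by move=> v; cont; exact: cat_braid_eqn.
have P0 v : A v -> eps * braid_eqn k v <> 0.
  by move=> /offA/braid_eqn_off hv /eqP; rewrite mulf_eq0 (negPf en0) => /eqP.
have ch (c : R) : continuous (fun v : R * R * R => eps * (2 * v.2) + c).
  by move=> v; cont.
case: (const_sign _ cP P0) => Ps.
(* [A] is above or below the crossing. *)
- have w0 v : A v -> eps * (2 * v.2) + - 2^-1 <> 0.
    move=> Av hv; have := Ps v Av; rewrite eqnE.
    have /andP[_ b2] := bnd v (offA _ Av).1.
    by rewrite (_ : eps * (2 * v.2) = 2^-1); [lra|lra].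
  case: (const_sign _ (ch (- 2^-1)) w0) => ws.
    have [eta eta0 h] := lim _ (ch (- 2^-1)) ws.
    have [[u us hu] _] := near_node heps hs eta0.
    by move: (h u us) hu => /= ? ?; lra.
  have cN : continuous (fun v : R * R * R => - (eps * (2 * v.2) + - 2^-1)).
    by move=> v; cont.
  have [eta eta0 h] := lim _ cN ws.
  have [_ [u us hu]] := near_node heps hs eta0.
  by move: (h u us) hu => /= ? ?; lra.
(* [A] is on the left or on the right of the crossing. *)
- have w0 v : A v -> eps * (2 * v.2) + 2^-1 <> 0.
    move=> Av hv; have := Ps v Av; rewrite eqnE.
    have /andP[b1 _] := bnd v (offA _ Av).1.
    by rewrite (_ : eps * (2 * v.2) = - 2^-1); [lra|lra].
  have wpos v : A v -> 0 < eps * (2 * v.2) + 2^-1.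
    case: (const_sign _ (ch 2^-1) w0) => ws; first exact: ws.
    have cN : continuous (fun v : R * R * R => - (eps * (2 * v.2) + 2^-1)).
      by move=> y; cont.
    have [eta eta0 h] := lim _ cN ws.
    have := h s; rewrite subrr normr0 => /(_ eta0).
    have -> : (braid_curve n s).2 = 2^-1 * (eps / 2) by rewrite -hs.
    rewrite (_ : eps * (2 * (2^-1 * (eps / 2))) = eps * eps / 2); last by field.
    by rewrite ee; lra.
  have ct : continuous (turn_dev s).
    by move=> v; rewrite /turn_dev; cont; apply: cat_cmul; cont.
  have t0 v : A v -> turn_dev s v <> 0.
    move=> Av tv; have := Ps v Av; rewrite eqnE.
    have [cv _] := (offA _ Av).1.
    have ce : circle R (cmul (cconj (cis (3 * s))) v.1).
      by apply: circle_mul => //; apply: circle_conj; exact: cis_circle.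
    have vE : v.1 = cmul (cis (3 * s)) (cmul (cconj (cis (3 * s))) v.1).
      rewrite -[X in cmul X (cmul _ _)](cconjK (cis (3 * s))) cmulK //.
      by apply: circle_conj; exact: cis_circle.
    have powE : cpow v.1 n = cpow (cis (3 * s)) n.
      move: ce tv vE; rewrite /turn_dev; case: (cmul _ _) => a b.
      rewrite /circle /= => ab b0; rewrite b0 expr0n addr0 in ab.
      have : a ^+ 2 == 1 by apply/eqP.
      rewrite sqrf_eq1 b0 => /orP[/eqP ->|/eqP ->] ->.
        by congr cpow; rewrite /cmul /=; rewrite !mulr0 !mulr1 subr0 addr0.
      have -> : cmul (cis (3 * s)) (-1, 0) = cis (3 * s + 2^-1).
        by rewrite cisD cis_half.
      rewrite -!cis_natmul mulrDr.
      have -> : n%:R * 2^-1 = (n./2)%:R :> R.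
        have : n = (n./2).*2.
          rewrite -[LHS](odd_double_half n) /n oddD oddM /= (negPf ke) //.
        by move=> h; rewrite {1}h -muln2 natrM; field.
      by rewrite cis_nat.
    have -> : eps * (cpow v.1 n).2 = 1.
      rewrite powE -cis_natmul (_ : n%:R * (3 * s) = 3 * (n%:R * s)); last by ring.
      rewrite cis3; move: hs; case: (cis (n%:R * s)) => a b /= ->.
      transitivity (3 / 2 * (eps * eps) - 2^-1 * (eps * eps) ^+ 2); first by field.
      by rewrite ee; field.
    have := wpos v Av; set y := eps * _ => yp.
    have : 0 <= (y + 1) * (2 * y - 1) ^+ 2.
      by rewrite mulr_ge0 ?sqr_ge0 //; lra.
    by rewrite (_ : (y + 1) * (2 * y - 1) ^+ 2 = 4 * y ^+ 3 - 3 * y + 1); [lra|ring].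
  case: (const_sign _ ct t0) => ts.
    have [eta eta0 h] := lim _ ct ts.
    have [[u us hu] _] := near_turn s eta0.
    by move: (h u us) hu => /= ? ?; lra.
  have cN : continuous (fun v => - turn_dev s v) by move=> v; cont; exact: ct.
  have [eta eta0 h] := lim _ cN ts.
  have [_ [u us hu]] := near_turn s eta0.
  by move: (h u us) hu => /= ? ?; lra.
Qed.

(** The circle without [c] and the two opposite quadrants of the chart that it enters
    form a connected set [A] off the diagram.  In the chart, the diagram consists of
    the axes, which are in the closure of [A]. *)
Lemma braid_not_typeI c : ~~ odd k -> ~ typeI D c.
Proof.
move=> ke [d [t0 [hd dann bc off [i [s [j [t [psi [dp bs chart_psi]]]]]]]]].
move=> [a [b [e e0 he]]].
have [_ _ _ _ hs2] := crossing_alg dp.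
case: chart_psi => [[hpsi [U oU imU]] psi0 psiD _].
have [_ cpsi _] := hpsi; have [_ cd _] := hd.
set beta := fun t => d (cos t, sin t) in bc off he bs.
have disk_cs u : disk R (cos u, sin u) by rewrite /disk /= cos2Dsin2.
have beta_ann u : annulus R (beta u) by apply: dann; exists (cos u, sin u).
have psi_ann q : open_square R q -> annulus R (psi q) /\ U (psi q).
  by move=> sq; have : (psi @` open_square R) (psi q) by [exists q]; rewrite imU.
have tau0 : 0 < (pi : R) *+ 2 by rewrite mulrn_wgt0 // pi_gt0.
pose B := beta @` `]t0, t0 + pi *+ 2[.
pose Q1 := psi @` quadrant a b; pose Q2 := psi @` quadrant (~~ a) (~~ b).
have cB : connected B.
  apply: connected_continuous_connected.
    exact/connected_intervalP/interval_is_interval.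
  have sT : set_fun `]t0, t0 + pi *+ 2[ (disk R) (fun u => (cos u, sin u)).
    by move=> u _.
  apply: (within_comp sT _ cd); apply: continuous_subspaceT => u; cont.
have cQ1 : connected Q1 by exact: quadrant_image_connected.
have cQ2 : connected Q2 by exact: quadrant_image_connected.
pose h := Num.min e pi / 2.
have m0 : 0 < Num.min e pi by rewrite lt_min e0 pi_gt0.
have h0 : 0 < h by rewrite divr_gt0.
have he' : h < e.
  by have : Num.min e pi <= e; [rewrite ge_min lexx|rewrite /h; lra].
have hpi : h < pi.
  by have : Num.min e pi <= pi; [rewrite ge_min lexx orbT|rewrite /h; lra].
have [bh _] := he (t0 + h); have [_ bh'] := he (t0 - h).
have BQ1 : B `&` Q1 !=set0.
  exists (beta (t0 + h)); split.
    exists (t0 + h) => //=; rewrite in_itv /= mulr2n; apply/andP; split; lra.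
  by apply: bh; apply/andP; split; lra.
have BQ2 : B `&` Q2 !=set0.
  exists (beta (t0 - h)); split.
    exists (t0 - h + pi *+ 2); last by rewrite /beta sinD2pi cosD2pi.
    by rewrite /= in_itv /= mulr2n; apply/andP; split; lra.
  by apply: bh'; apply/andP; split; lra.
pose A := B `|` Q1 `|` Q2.
have cA : connected A.
  apply: connectedU => //; last exact: connectedU.
  by case: BQ2 => x [Bx Qx]; exists x; split=> //; left.
have offQ a' b' q : quadrant a' b' q -> off_diagram (psi q).
  move=> Qq; have [sq _] := Qq; split; first exact: (psi_ann q sq).1.
  move=> /(psiD q sq) ax; have /quadrantE[_ _ q1 q2] := Qq.
  by case: ax => q0; move: q1 q2; rewrite q0 mulr0 ltxx.
have offA : A `<=` off_diagram.
  move=> z [[[u ub <-]|[q Qq <-]]|[q Qq <-]]; [|exact: offQ Qq|exact: offQ Qq].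
  split; first exact: beta_ann.
  move=> /off bu; move: ub; rewrite /= in_itv /= => /andP[u0 u1].
  have /(homeo_inj hd) : beta u = beta t0 by exact: (etrans bu (esym bc)).
  move=> /(_ (disk_cs u) (disk_cs t0)) [cu su].
  have pn := @pi_neq0 R.
  have sm : same_mod1 (t0 / (2 * pi)) (u / (2 * pi)).
    by apply/cis_eq; rewrite /cis !(mulrC (2 * pi)) !divfK ?mulf_neq0 // cu su.
  case: sm => m hm.
  have {}hm : u = t0 + m%:~R * (2 * pi).
    by rewrite -[u](divfK (x := 2 * pi)) ?mulf_neq0 // hm mulrDl divfK // mulf_neq0.
  apply: (@no_int_between01 R m).
  have := @pi_gt0 R => p0; move: u0 u1; rewrite hm mulr2n => u0 u1.
  by apply/andP; split; nra.
apply: (@opposite_corners s A ke hs2 cA) => //.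
  by case: BQ1 => x [Bx _]; exists x; left; left.
move=> G cG Gpos.
have cc : continuous (braid_curve n : R -> R * R * R).
  by move=> u; rewrite /braid_curve /cis; cont.
have Us : U (braid_curve n s).
  have sq0 : open_square R (0, 0) by apply/open_squareE; rewrite /= normr0.
  by have [_] := psi_ann _ sq0; rewrite psi0.
have : \forall u \near s, U (braid_curve n u).
  by apply: (cc s U); apply: open_nbhs_nbhs; split.
move=> /nbhs_ballP[eta /= eta0 ball_eta]; exists eta => // u us.
have Uu : U (braid_curve n u).
  by apply: ball_eta; rewrite /ball /= distrC.
have : (psi @` open_square R) (braid_curve n u).
  rewrite imU; split => //; split; first exact: cis_circle.
  rewrite /= in_itv /= -ler_norml normrM ger0_norm // ler_pdivrMl //.
  by rewrite mulr1 (le_trans (sin_max _)) // ler1n.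
move=> [q sq qu]; rewrite -qu.
apply: (@axis_limit R _ psi G a b q) => //.
  move=> p [Qp|Qp]; apply: Gpos; [left; right|right]; by exists p.
by apply/(psiD q sq); rewrite qu; exists ord0, u.
Qed.

Lemma braid_simple : ~~ odd k -> simple_diagram D.
Proof.
by move=> ke c _; split; [exact: braid_not_typeI|exact: braid_not_typeII].
Qed.

End Simplicity.

(** * Lifting maps to the circle *)
Section Lifting.
Context {R : realType}.

Definition unit_square : set (R * R) := `[0, 1] `*` `[0, 1].

Lemma unit_squareE (x y : R) : unit_square (x, y) <-> 0 <= x <= 1 /\ 0 <= y <= 1.
Proof. by rewrite /unit_square /= !in_itv. Qed.

Definition dot (p q : R * R) : R := (cmul (cconj p) q).1.

Lemma dot_near (f p q : R * R) : circle R f ->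
  `|p.1 - f.1| < 8^-1 -> `|p.2 - f.2| < 8^-1 ->
  `|q.1 - f.1| < 8^-1 -> `|q.2 - f.2| < 8^-1 -> 0 < dot p q.
Proof.
case: f p q => [f1 f2] [p1 p2] [q1 q2]; rewrite /circle /dot /cmul /cconj /= => h.
move=> /ltr_normlP[a1 a2] /ltr_normlP[b1 b2] /ltr_normlP[c1 c2] /ltr_normlP[d1 d2].
pose x1 := p1 - f1; pose x2 := p2 - f2; pose y1 := q1 - f1; pose y2 := q2 - f2.
have -> : p1 * q1 - - p2 * q2 = f1 ^+ 2 + f2 ^+ 2 + f1 * (x1 + y1) + f2 * (x2 + y2)
    + x1 * y1 + x2 * y2 by rewrite /x1 /x2 /y1 /y2; ring.
rewrite h.
have e1 : - 4^-1 * 4^-1 - (f1 ^+ 2) / 4 <= f1 * (x1 + y1).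
  have : - 4^-1 < x1 + y1 < 4^-1 by rewrite /x1 /y1; apply/andP; split; lra.
  move=> /andP[? ?]; have := sqr_ge0 (f1 / 2 + (x1 + y1)); nra.
have e2 : - 4^-1 * 4^-1 - (f2 ^+ 2) / 4 <= f2 * (x2 + y2).
  have : - 4^-1 < x2 + y2 < 4^-1 by rewrite /x2 /y2; apply/andP; split; lra.
  move=> /andP[? ?]; have := sqr_ge0 (f2 / 2 + (x2 + y2)); nra.
have e3 : - 8^-1 * 8^-1 <= x1 * y1.
  have : - 8^-1 < x1 < 8^-1 by rewrite /x1; apply/andP; split; lra.
  have : - 8^-1 < y1 < 8^-1 by rewrite /y1; apply/andP; split; lra.
  move=> /andP[? ?] /andP[? ?]; nra.
have e4 : - 8^-1 * 8^-1 <= x2 * y2.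
  have : - 8^-1 < x2 < 8^-1 by rewrite /x2; apply/andP; split; lra.
  have : - 8^-1 < y2 < 8^-1 by rewrite /y2; apply/andP; split; lra.
  move=> /andP[? ?] /andP[? ?]; nra.
lra.
Qed.

Lemma compact_unit_square : compact unit_square.
Proof. by apply: compact_setX; exact: segment_compact. Qed.

(** Uniform continuity, by compactness: images of close points on a horizontal line
    are less than a quarter of a turn apart. *)
Lemma uniform_dot (f : R * R -> R * R) :
  {within unit_square, continuous f} -> set_fun unit_square (circle R) f ->
  exists N : nat, forall x x' y : R, unit_square (x, y) -> unit_square (x', y) ->
    `|x - x'| <= N.+1%:R^-1 -> 0 < dot (f (x', y)) (f (x, y)).
Proof.
move=> /subspace_continuousP cf fc.
have /compact_near_coveringP/(_ nat \oo
  (fun N (p : R * R) => forall x', unit_square p -> unit_square (x', p.2) ->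
    `|p.1 - x'| <= N.+1%:R^-1 -> 0 < dot (f (x', p.2)) (f p)) _) := compact_unit_square.
move=> H.
have {}H : \forall N \near \oo, forall p, unit_square p -> forall x', unit_square p ->
    unit_square (x', p.2) -> `|p.1 - x'| <= N.+1%:R^-1 -> 0 < dot (f (x', p.2)) (f p).
  apply: H => p0 Sp0.
  have c1 := cf p0 Sp0.
  have e8 : 0 < 8^-1 :> R by [].
  have c2 : \forall p \near within unit_square (nbhs p0),
      `|(f p).1 - (f p0).1| < 8^-1 /\ `|(f p).2 - (f p0).2| < 8^-1.
    have c3 : within unit_square (nbhs p0) (f @^-1` ball (f p0) 8^-1).
      exact: (c1 _ (nbhsx_ballx (f p0) 8^-1 e8)).
    apply: filterS c3 => p [h1 h2].
    by rewrite distrC; split=> //; rewrite distrC.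
  have [d /= d0 hd] := (nbhs_ballP _ _).1 c2.
  have d2 : 0 < d / 2 by rewrite divr_gt0.
  have nb : nbhs p0 (ball p0 (d / 2)) by exact: nbhsx_ballx.
  have nN : \forall N \near \oo, N.+1%:R^-1 < d / 2 by exact: (near_infty_natSinv_lt (PosNum d2)).
  exists (ball p0 (d / 2), [set N : nat | N.+1%:R^-1 < d / 2]) => //.
  move=> [[x y] N] [/= [b1 b2] hN] x' Sp Sp' xx'.
  move: hN xx' => /= hN xx'.
  have {}b1 : `|p0.1 - x| < d / 2 := b1.
  have {}b2 : `|p0.2 - y| < d / 2 := b2.
  have [] := hd (x, y) _ Sp.
    by split; rewrite /ball /=; lra.
  have [] := hd (x', y) _ Sp'.
    split; rewrite /ball /=; last by lra.
    rewrite (_ : p0.1 - x' = (p0.1 - x) + (x - x')); last by ring.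
    apply: le_lt_trans (ler_normD _ _) _; rewrite [ltRHS]splitr.
    by apply: ltrD => //; exact: le_lt_trans hN.
  by move=> *; apply: (@dot_near (f p0)) => //; exact: fc.
have [N _ HN] := H; exists N => x x' y Sx Sx' h.
exact: (HN N (leqnn N) (x, y) Sx x' Sx Sx' h).
Unshelve. all: by end_near. Qed.

(** Horizontal segments are cut into steps along which [f] turns by less than a
    quarter of a turn, and the angles of the steps are added up.  The left side, on
    which [f] is constant, is where the sums start. *)
Lemma circle_lift (f : R * R -> R * R) :
  {within unit_square, continuous f} -> set_fun unit_square (circle R) f ->
  (forall y, 0 <= y <= 1 -> f (0, y) = f (0, 0)) ->
  exists G : R * R -> R, [/\ {within unit_square, continuous G},
    forall p, unit_square p -> cis (G p) = f p &
    forall y, 0 <= y <= 1 -> G (0, y) = G (0, 0)].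
Proof.
move=> cf fc f0.
have [N HN] := uniform_dot cf fc.
have I0 : 0 <= (0 : R) <= 1 by rewrite lexx ler01.
have [a ha] := cis_surj (fc (0, 0) ((unit_squareE 0 0).2 (conj I0 I0))).
pose M : R := N.+1%:R.
have M0 : 0 < M by rewrite ltr0n.
pose sub (i : nat) (p : R * R) : R * R := (p.1 * (i%:R / M), p.2).
pose step (i : nat) (p : R * R) : R * R := cmul (cconj (f (sub i p))) (f (sub i.+1 p)).
pose G (j : nat) (p : R * R) : R := a + \sum_(i < j) ang (step i p).
have subS i p : (i <= N.+1)%N -> unit_square p -> unit_square (sub i p).
  case: p => x y iN /unit_squareE[/andP[x0 x1] y01]; apply/unit_squareE; split=> //.
  have i0 : 0 <= i%:R / M by rewrite divr_ge0 // ltW.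
  have i1 : i%:R / M <= 1 by rewrite ler_pdivrMr // mul1r ler_nat.
  by rewrite mulr_ge0 // mulr_ile1.
have step_circle i p : (i < N.+1)%N -> unit_square p -> circle R (step i p).
  move=> iN Sp; apply: circle_mul; last by apply: fc; exact: subS.
  by apply: circle_conj; apply: fc; apply: subS => //; exact: ltnW.
have step_pos i p : (i < N.+1)%N -> unit_square p -> 0 < (step i p).1.
  move=> iN Sp; apply: HN; [exact: subS|by apply: subS => //; exact: ltnW|].
  rewrite /= -mulrBr -mulrBl -natr1 addrC addKr mul1r normrM.
  case: p Sp => x y /unit_squareE[/andP[x0 x1] _] /=.
  rewrite (ger0_norm x0) ger0_norm ?invr_ge0 ?(ltW M0) //.
  by rewrite -[leRHS]mul1r ler_wpM2r // invr_ge0 ltW.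
have GE j p : (j <= N.+1)%N -> unit_square p -> cis (G j p) = f (sub j p).
  elim: j => [|j IH] jN Sp.
    rewrite /G big_ord0 addr0 /sub mul0r mulr0 -ha.
    by case: p Sp => x y /unit_squareE[_ y01]; rewrite f0.
  rewrite /G big_ord_recr /= addrA cisD -/(G j p) IH //; last exact: ltnW.
  rewrite angK; [|exact: step_circle|exact: step_pos].
  rewrite /step -{1}(cconjK (f (sub j p))) cmulK //.
  by apply: circle_conj; apply: fc; apply: subS => //; exact: ltnW.
exists (G N.+1); split.
- have cstep i : (i < N.+1)%N -> {within unit_square, continuous (fun p => ang (step i p))}.
    move=> iN; have cs j : (j <= N.+1)%N -> {within unit_square, continuous (fun p => f (sub j p))}.
      move=> jN; have sS : set_fun unit_square unit_square (sub j) by move=> p; exact: subS.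
      apply: (within_comp sS _ cf); apply: continuous_subspaceT => p.
      by rewrite /sub; cont.
    rewrite continuous_subspace_in => p; rewrite inE => Sp.
    apply: (@cat_ang _ (subspace unit_square) (step i)).
      by rewrite gt_eqF //; exact: step_pos.
    rewrite /step; apply: cat_cmul; last exact: cs.
    by rewrite /cconj; cont; apply: (cs i); exact: ltnW.
  rewrite /G; elim: {-2}N.+1 (leqnn N.+1) => [|j IH] jN.
    have -> : (fun p => a + \sum_(i < 0) ang (step i p)) = fun _ => a.
      by apply/funext => p; rewrite big_ord0 addr0.
    by move=> p; exact: cat_cst.
  have -> : (fun p => a + \sum_(i < j.+1) ang (step i p)) =
      fun p => (a + \sum_(i < j) ang (step i p)) + ang (step j p).
    by apply/funext => p; rewrite big_ord_recr /= addrA.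
  by move=> p; apply: catD; [apply: IH; exact: ltnW|exact: cstep].
- move=> p Sp; rewrite GE //; congr f.
  by rewrite /sub divff ?mulr1 -?surjective_pairing // gt_eqF.
- move=> y y01; rewrite /G; congr (_ + _); apply: eq_bigr => i _.
  by rewrite /step /sub /= !mul0r f0.
Qed.

End Lifting.

(** The class of the head of [L] has even size and contributes an even number to the
    count; it is removed, and the other classes are unchanged. *)
Lemma even_classes {T : Type} (r : T -> T -> bool) (W : T -> bool) :
  (forall x, r x x) -> (forall x y, r x y -> r y x) ->
  (forall x y z, r x y -> r y z -> r x z) -> (forall x y, r x y -> W x = W y) ->
  forall L : seq T, (forall x, odd (count (r x) L) = false) ->
  odd (count W L) = false.
Proof.
move=> rr rs rt rW L; elim: {L}_.+1 {-2}L (ltnSn (size L)) => // N IH [|x L] sL ev //.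
set L' := x :: L in sL ev *.
have split_count (a : pred T) (M : seq T) : count a M =
    (count (predI a (r x)) M + count (predI a (predC (r x))) M)%N.
  by elim: M => //= z M ->; case: (a z); case: (r x z) => /=; lia.
rewrite split_count oddD.
have -> : odd (count (predI W (r x)) L') = false.
  have -> M : count (predI W (r x)) M = (W x * count (r x) M)%N.
    elim: M => [|z M IHM] /=; first by rewrite muln0.
    rewrite IHM mulnDr; case: (boolP (r x z)) => xz /=; last by rewrite andbF muln0.
    by rewrite andbT (rW _ _ xz) muln1.
  by rewrite oddM ev andbF.
rewrite -count_filter; apply: IH => [|y].
  have p0 : (0 < count (r x) L')%N by rewrite /L' /= rr.
  by have := count_predC (r x) L'; rewrite size_filter; lia.
rewrite count_filter; have [xy|xy] := boolP (r x y).
  rewrite (eq_count (a2 := pred0)) ?count_pred0 // => z /=.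
  by apply/negP => /andP[yz /negP]; apply; exact: rt yz.
rewrite (eq_count (a2 := r y)) // => z /=.
have [yz|//] := boolP (r y z); apply/negP => xz.
by move/negP: xy; apply; apply: rt xz _; exact: rs.
Qed.

Lemma odd_absz_add (a b : int) : odd (absz (a + b)) = odd (absz a) (+) odd (absz b).
Proof.
have o (z : int) : exists m : int, z = m * 2 + (odd (absz z) : nat)%:Z.
  have := odd_double_half (absz z); rewrite -muln2 => e.
  have [z0|z0] := leP 0 z;
    [exists ((absz z)./2)%:Z|exists (- ((absz z)./2)%:Z - (odd (absz z) : nat)%:Z)];
    by case: (odd (absz z)) e => /= e; lia.
have [m1 e1] := o a; have [m2 e2] := o b; have [m3 e3] := o (a + b).
by move: e1 e2 e3; case: (odd (absz a)); case: (odd (absz b));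
  case: (odd (absz (a + b))) => //=; lia.
Qed.

(** * Parity of the winding number as a cocycle *)
Section Winding.
Context {R : realType}.
Context (X : set (space5 R)) (q : space5 R -> R * R).
Context (qX : set_fun X (circle R) q).
Context (cq : {within X, continuous q}).
Implicit Types (tau : R -> space5 R).

Definition angle_of (p : R * R) : R := xget 0 [set x | cis x = p].

Lemma angle_ofK p : circle R p -> cis (angle_of p) = p.
Proof.
move=> /cis_surj[x px]; rewrite /angle_of.
by case: xgetP => [y _ //|/(_ x)]; case.
Qed.

Definition path_lift tau (l : R -> R) : Prop :=
  {within `[0, 1], continuous l} /\ forall t, 0 <= t <= 1 -> cis (l t) = q (tau t).

(** The total variation of the angle is corrected at the ends by a fixed choice of
    angles, which makes it an integer and an additive function of paths. *)
Definition defect tau (l : R -> R) : R :=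
  (l 1 - angle_of (q (tau 1))) - (l 0 - angle_of (q (tau 0))).

Definition winding tau (m : int) : Prop :=
  exists2 l, path_lift tau l & defect tau l = m%:~R.

Definition odd_winding tau : bool :=
  `[< exists2 m : int, winding tau m & odd (absz m) >].

Lemma int_valued_const (g : R -> R) : {within `[0, 1], continuous g} ->
  (forall t, 0 <= t <= 1 -> exists m : int, g t = m%:~R) -> g 0 = g 1.
Proof.
wlog g01 : g / g 0 <= g 1.
  move=> H cg gi; have [h|h] := leP (g 0) (g 1); first exact: H.
  apply: oppr_inj; apply: (H (fun t => - g t)); first by rewrite lerN2 ltW.
    by move=> t; apply: catN; exact: cg.
  by move=> t /gi[m ->]; exists (- m); rewrite mulrNz.
move=> cg gi; apply/eqP; rewrite eq_le g01 /= leNgt; apply/negP => lt01.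
have I0 : 0 <= (0 : R) <= 1 by rewrite lexx ler01.
have I1 : 0 <= (1 : R) <= 1 by rewrite lexx ler01.
have [a ha] := gi 0 I0; have [b hb] := gi 1 I1.
have [c cI gc] : exists2 c, c \in `[0, 1] & g c = g 0 + 2^-1.
  apply: (@IVT _ g 0 1) => //; rewrite ge_min le_max; apply/andP; split; apply/orP.
    by left; lra.
  right; have : a%:~R + 1 <= b%:~R :> R.
    by move: lt01; rewrite ha hb ltr_int -lezD1 -(ler_int R) intrD.
  by rewrite ha hb; lra.
have [m hm] := gi c cI; have e : (2 * (m - a))%:~R = 1%:~R :> R.
  by rewrite intrM intrD mulrNz; lra.
have : 2 * (m - a) = 1 by exact: intr_inj e.
by lia.
Qed.

(** The difference of two lifts is continuous with integer values. *)
Lemma winding_uniq tau m m' : winding tau m -> winding tau m' -> m = m'.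
Proof.
move=> [l [cl hl] dl] [l' [cl' hl'] dl'].
have e : (fun t => l t - l' t) 0 = (fun t => l t - l' t) 1.
  apply: (@int_valued_const (fun t => l t - l' t)).
    by move=> t; apply: catD; [exact: cl|apply: catN; exact: cl'].
  move=> t t01; have /cis_eq[p hp] : cis (l' t) = cis (l t) by rewrite hl // hl'.
  by exists p; rewrite hp; ring.
apply: (@intr_inj R); rewrite -dl -dl' /defect; move: e => /=; lra.
Qed.

Lemma lift_winding tau l : path_lift tau l ->
  (forall t, 0 <= t <= 1 -> X (tau t)) -> exists m, winding tau m /\ defect tau l = m%:~R.
Proof.
move=> pl tX; have [cl hl] := pl.
have I t : 0 <= t <= 1 -> exists m : int, l t - angle_of (q (tau t)) = m%:~R.
  move=> t01; have /cis_eq[m hm] : cis (angle_of (q (tau t))) = cis (l t).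
    by rewrite angle_ofK ?hl //; exact/qX/tX.
  by exists m; rewrite hm; ring.
have I0 : 0 <= (0 : R) <= 1 by rewrite lexx ler01.
have I1 : 0 <= (1 : R) <= 1 by rewrite lexx ler01.
have [a ha] := I 0 I0; have [b hb] := I 1 I1.
have dE : defect tau l = (b - a)%:~R by rewrite /defect ha hb intrD mulrNz.
by exists (b - a); split=> //; exists l.
Qed.

Lemma odd_windingE tau m : winding tau m -> odd_winding tau = odd (absz m).
Proof.
move=> wm; apply/asboolP/idP => [[m' wm']|om]; last by exists m.
by rewrite (winding_uniq wm wm').
Qed.

Lemma odd_winding_eq tau tau' : {in `[0, 1], tau' =1 tau} ->
  odd_winding tau = odd_winding tau'.
Proof.
move=> e; have {}e t : 0 <= t <= 1 -> tau' t = tau t.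
  by move=> t01; apply: e; rewrite in_itv.
have I0 : 0 <= (0 : R) <= 1 by rewrite lexx ler01.
have I1 : 0 <= (1 : R) <= 1 by rewrite lexx ler01.
rewrite /odd_winding; congr asbool; apply/propext.
split=> -[m [l [cl hl] dl] om]; exists m => //; exists l.
- by split=> // t t01; rewrite hl // e.
- by rewrite -dl /defect !e.
- by split=> // t t01; rewrite hl // e.
- by rewrite -dl /defect !e.
Qed.

(** The triangle is a square with the left side collapsed; a lift on the square
    restricts to lifts of the three faces with common values at the vertices, so that
    the winding of one face is the sum of the other two. *)
Lemma triangle_winding (sigma : R * R -> space5 R) : singular_triangle X sigma ->
  odd (count odd_winding (faces sigma)) = false.
Proof.
move=> [sX cs].
pose fold_ (p : R * R) : R * R := (p.1 * (1 - p.2), p.1 * p.2).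
have foldT p : unit_square p -> triangle R (fold_ p).
  case: p => x y /unit_squareE[/andP[x0 x1] /andP[y0 y1]].
  by split=> /=; [rewrite mulr_ge0 // subr_ge0|rewrite mulr_ge0|nra].
have cf : {within unit_square, continuous (fun p => q (sigma (fold_ p)))}.
  have sf : set_fun unit_square (triangle R) fold_ by move=> p; exact: foldT.
  have sfX : set_fun unit_square X (fun p => sigma (fold_ p)).
    by move=> p Sp; apply: sX; exact: foldT.
  have cfold : {within unit_square, continuous fold_}.
    by apply: continuous_subspaceT => p; rewrite /fold_; cont.
  exact: (within_comp sfX (within_comp sf cfold cs) cq).
have [G [cG GE G0]] : exists G : R * R -> R, [/\ {within unit_square, continuous G},
    forall p, unit_square p -> cis (G p) = q (sigma (fold_ p)) &
    forall y, 0 <= y <= 1 -> G (0, y) = G (0, 0)].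
  apply: circle_lift => //.
    by move=> p Sp; apply: qX; apply: sX; exact: foldT.
  by move=> y _; rewrite /fold_ /= !mul0r.
have I0 : 0 <= (0 : R) <= 1 by rewrite lexx ler01.
have I1 : 0 <= (1 : R) <= 1 by rewrite lexx ler01.
have lift tau (e : R -> R * R) : (forall t, 0 <= t <= 1 -> unit_square (e t)) ->
    continuous e -> (forall t, tau t = sigma (fold_ (e t))) ->
    exists m, winding tau m /\ defect tau (fun t => G (e t)) = m%:~R.
  move=> eS ce tE; apply: lift_winding.
    split; last by move=> t t01; rewrite GE ?tE //; exact: eS.
    have sS : set_fun `[0, 1] unit_square e by move=> t; rewrite /= in_itv /=; exact: eS.
    by apply: (within_comp sS _ cG); exact: continuous_subspaceT.
  by move=> t t01; rewrite tE; apply: sX; apply: foldT; exact: eS.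
have [m0 [w0 d0]] : exists m, winding (fun t => sigma (1 - t, t)) m /\
    defect (fun t => sigma (1 - t, t)) (fun t => G (1, t)) = m%:~R.
  apply: (lift _ (fun t => (1, t))).
  - by move=> t t01; apply/unit_squareE.
  - by move=> t; cont.
  - by move=> t; rewrite /fold_ /= !mul1r.
have [m1 [w1 d1]] : exists m, winding (fun t => sigma (0, t)) m /\
    defect (fun t => sigma (0, t)) (fun t => G (t, 1)) = m%:~R.
  apply: (lift _ (fun t => (t, 1))).
  - by move=> t t01; apply/unit_squareE.
  - by move=> t; cont.
  - by move=> t; rewrite /fold_ /= subrr mulr0 mulr1.
have [m2 [w2 d2]] : exists m, winding (fun t => sigma (t, 0)) m /\
    defect (fun t => sigma (t, 0)) (fun t => G (t, 0)) = m%:~R.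
  apply: (lift _ (fun t => (t, 0))).
  - by move=> t t01; apply/unit_squareE.
  - by move=> t; cont.
  - by move=> t; rewrite /fold_ /= subr0 mulr0 mulr1.
have m12 : m1 = m0 + m2.
  apply: (@intr_inj R); rewrite intrD -d0 -d1 -d2 /defect subrr subr0.
  by rewrite (G0 1 I1); ring.
rewrite /faces /= (odd_windingE w0) (odd_windingE w1) (odd_windingE w2).
rewrite m12 odd_absz_add addn0 !oddD !oddb.
by case: (odd (absz m0)); case: (odd (absz m2)).
Qed.

(** The cocycle vanishes on the boundary of each 2-simplex and is 1 on [kappa].  It
    depends only on the restrictions of the simplices to [0,1], so it takes the same
    value on chains with the same coefficients. *)
Lemma odd_winding_not_null (kappa : R -> space5 R) (w : int) :
  (forall t, q (kappa t) = cis (w%:~R * t)) -> odd (absz w) ->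
  ~ Z2_null_homologous X kappa.
Proof.
move=> qk ow [c cX cE].
pose same (tau tau' : R -> space5 R) : bool := `[< {in `[0, 1], tau' =1 tau} >].
have W1 : odd_winding kappa = true.
  rewrite (@odd_windingE _ w) //; exists (fun t => w%:~R * t).
    split; last by move=> t _; rewrite qk.
    by apply: continuous_subspaceT => t; cont.
  rewrite /defect !qk mulr0 mulr1.
  have -> : cis w%:~R = cis 0 :> R * R by rewrite -[w%:~R]add0r cis_int.
  by ring.
have W0 : odd (count odd_winding (flatten (map (@faces R) c))) = false.
  elim: c cX {cE} => [|sigma c IH] cX //.
  have -> : flatten (map (@faces R) (sigma :: c)) =
    faces sigma ++ flatten (map (@faces R) c) by [].
  rewrite count_cat oddD (triangle_winding (cX 0%N isT)) IH //.
  by move=> i ic; exact: (cX i.+1).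
have rr tau : same tau tau by apply/asboolP.
have rs t1 t2 : same t1 t2 -> same t2 t1.
  by move=> /asboolP h; apply/asboolP => t tI; rewrite h.
have rt t1 t2 t3 : same t1 t2 -> same t2 t3 -> same t1 t3.
  by move=> /asboolP h /asboolP h'; apply/asboolP => t tI; rewrite h' // h.
have rW t1 t2 : same t1 t2 -> odd_winding t1 = odd_winding t2.
  by move=> /asboolP h; exact: odd_winding_eq.
have even_coef tau :
    odd (count (same tau) (flatten (map (@faces R) c) ++ [:: kappa])) = false.
  rewrite count_cat oddD.
  by have := cE tau; rewrite /Z2_coef => ->; rewrite addbb.
have := even_classes rr rs rt rW even_coef.
by rewrite count_cat oddD W0 /= addn0 W1.
Qed.

End Winding.

(** * The theorem *)
Section Representation.
Context {R : realType}.

Lemma braid_thick (n : nat) (t : R) :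
  thick_annulus R (braid_curve n t, braid_height n t).
Proof.
have le1 (a x : R) : 0 <= a <= 1 -> `|x| <= 1 -> `|a * x| <= 1.
  by move=> /andP[a0 a1] x1; rewrite normrM (ger0_norm a0) mulr_ile1.
apply/thickE; split; first exact: cis_circle.
- by apply: le1; [apply/andP; split; lra|exact: sin_max].
- by apply: le1; [apply/andP; split; lra|exact: sin_max].
Qed.

Lemma braid_represents (k : nat) (Phi : space5 R -> space5 R)
    (phi : R * R * R * R -> space5 R) :
  homeomorphism (S1xS2 R) (S1xS2 R) Phi ->
  (forall p, thick_annulus R p -> phi p = Phi (std_thickening p)) ->
  represents phi (braid_diagram k) (range (fun t => Phi (torus_knot t))).
Proof.
move=> hPhi phiE; exists (fun _ => @braid_height R (3 * k + 2)).
  exact: braid_height_diagram.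
pose lift t := std_thickening (braid_curve (3 * k + 2) t, @braid_height R (3 * k + 2) t).
have -> : [set p | exists (i : 'I_(ncomp (@braid_diagram R k))) t,
    p = phi (curve i t, braid_height (3 * k + 2) t)] = Phi @` range lift.
  apply/seteqP; split=> p.
    move=> [i [t ->]]; exists (lift t); first by exists t.
    by rewrite phiE //; exact: braid_thick.
  move=> [_ [t _ <-] <-]; exists ord0, t.
  by rewrite phiE //; exact: braid_thick.
have -> : range (fun t => Phi (torus_knot t)) = Phi @` range (@torus_knot R).
  by rewrite -image_comp.
have [M' MM] := @straightening_family R k.
apply: (isotopic_transport hPhi (H := fibre_map (straightening k))).
- by apply: (fibre_map_isotopy MM) => e p; exact: straightening0.
- move=> _ [t _ <-].
  by have [/upperE[]] := std_thickening_height (braid_thick (3 * k + 2) t).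
- rewrite image_comp; apply: eq_imagel => t _ /=.
  exact: straightening_braid.
Qed.

End Representation.

Unset Implicit Arguments.

Theorem mainTheorem3 (R : realType) (V1 V2 V : set (space5 R))
    (phi : R * R * R * R -> space5 R) :
  H_decomposition V1 V2 ->
  V = V1 \/ V = V2 ->
  annulus_thickening V (V1 `&` V2) phi ->
  exists (kappa : R -> space5 R) (D1 D2 : diagram R) (n1 n2 : nat),
    [/\ is_knot kappa /\ ~ Z2_null_homologous (S1xS2 R) kappa,
        [/\ is_link_diagram D1, alternating_diagram D1 & simple_diagram D1],
        [/\ is_link_diagram D2, alternating_diagram D2 & simple_diagram D2],
        [/\ (crossings D1 #= `I_n1)%card, (crossings D2 #= `I_n2)%card &
            n1 <> n2] &
        represents phi D1 (range kappa) /\ represents phi D2 (range kappa)].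
Proof.
move=> hV VV hphi; have [Phi hPhi phiE] := standardize hV VV hphi.
have [Psi hPsi [PhiK _]] := homeo_inv hPhi.
have [PsiX cPsi _] := hPsi.
have good k : is_link_diagram (@braid_diagram R k) /\
    alternating_diagram (@braid_diagram R k).
  by split; [exact/braid_is_diagram/crossings_finite|exact: braid_alternating].
(* [n = 2] and [n = 8] *)
exists (fun t => Phi (torus_knot t)), (braid_diagram 0), (braid_diagram 2).
exists (2 * (3 * 0 + 2))%N, (2 * (3 * 2 + 2))%N; split.
- split; first exact: (knot_transport hPhi (@torus_knot_is_knot R)).
  apply: (@odd_winding_not_null R (S1xS2 R) (fun x => (Psi x).1) _ _ _ 3%:Z) => //.
  + by move=> x /PsiX[].
  + have sT : set_fun (S1xS2 R) [set: space5 R] Psi by [].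
    apply: (within_comp sT cPsi (g := fst)); apply: continuous_subspaceT => x.
    exact: cvg_fst.
  + by move=> t; rewrite PhiK //; exact: torus_knot_sub.
- by have [] := good 0%N; split=> //; exact: braid_simple.
- by have [] := good 2%N; split=> //; exact: braid_simple.
- by split; [exact: crossings_card|exact: crossings_card|].
- by split; exact: braid_represents.
Qed.
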